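(* Let $\mu\in\mathbb{C}$ with $\Re(\mu)>1$, and let $k\in\{0,-1\}$. Then $$\zeta(\mu)=\sum_{n=0}^\infty B_{n,\ge 2}^{(\mu)}\frac{\bigl(W_k(-1)\bigr)^n}{n!},$$ where $\zeta$ is the Riemann zeta function.
   Context: $W_k$ ($k\in\mathbb{Z}$) denote the branches of the Lambert $W$ function, i.e. the solutions $W$ of $We^W=a$, with $W_0$ the principal branch and $W_{-1}$ the other standard branch; $W_0(-1)=\overline{W_{-1}(-1)}\approx -0.318132+1.33724i$. For integers $n,k\ge0$, $\left\{ {n \atop k} \right\}_{\ge 2}$ is the number of partitions of an $n$-element set into $k$ nonempty blocks each having at least $2$ elements (with the value $1$ for $n=k=0$). For complex $\mu$, define $$B_{n,\ge 2}^{(\mu)}=\sum_{k=0}^n(-1)^{n-k}\frac{k!}{(k+1)^\mu}\left\{ {n \atop k} \right\}_{\ge 2}\qquad(n\ge0),$$ with $(k+1)^\mu=e^{\mu\log(k+1)}$. *)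

(* Defs.v *)
From HB Require Import structures.
From mathcomp Require Import all_boot all_order all_algebra complex.
From mathcomp Require Import all_classical all_reals all_analysis.

Set Implicit Arguments.
Unset Strict Implicit.
Unset Printing Implicit Defensive.

Import Order.TTheory GRing.Theory Num.Theory.
Import numFieldNormedType.Exports.

Local Open Scope classical_set_scope.
Local Open Scope ring_scope.
Local Open Scope complex_scope.

(* [finset.partition] already requires the blocks to be nonempty; for
   n = k = 0 the empty partition of 'I_0 is counted. *)
Definition stirling2_ge2 (n k : nat) : nat :=
  #|[set P : {set {set 'I_n}} | [&& finset.partition P [set: 'I_n]%SET,
      #|P| == k & [forall (B | B \in P), 2 <= #|B|]%N]]%SET|.

Definition cexp (R : realType) (z : R[i]) : R[i] :=
  (expR (complex.Re z) * cos (complex.Im z)) +i*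
  (expR (complex.Re z) * sin (complex.Im z)).

(* x ^ mu = e ^ (mu log x), meaningful for x > 0. *)
Definition cpow (R : realType) (x : R) (mu : R[i]) : R[i] :=
  cexp (mu * (ln x)%:C).

Definition poly_bernoulli_ge2 (R : realType) (mu : R[i]) (n : nat) : R[i] :=
  \sum_(k < n.+1) (-1) ^+ (n - k) * (k`!%:R / cpow k.+1%:R mu) *
    (stirling2_ge2 n k)%:R.

(* The Dirichlet series of zeta: only meaningful for Re mu > 1. The topology of
   the complex plane is the one that the numFieldType R[i] induces on R[i]^o. *)
Definition zeta (R : realType) (mu : R[i]) : R[i]^o :=
  limn (series (fun n : nat => (cpow n.+1%:R mu)^-1 : R[i]^o)).

(* Branches of the Lambert function, following the conventions of Corless,
   Gonnet, Hare, Jeffrey and Knuth, "On the Lambert W function" (1996),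
   Section 4. The ranges of the branches are separated by the curves
   -b cot b + i b, for 2 m pi < |b| < (2 m + 1) pi, which separate the range
   of W_m from that of W_(m+1) (b > 0) and the range of W_(-m) from that of
   W_(-m-1) (b < 0), and by the ray ]-oo, -1], which separates those of W_1
   and W_(-1). Every branch cut lies on the negative real axis and is closed
   from above (counter-clockwise continuity), so that a point of a separating
   curve belongs to the region lying below that curve. *)
Definition lambert_curve (R : realType) (b : R) : R := - (b * cos b / sin b).

(* w lies in the range of some W_j with j > m. *)
Definition lambert_above (R : realType) (m : nat) (w : R[i]) : Prop :=
  let a := complex.Re w in let b := complex.Im w in
  (m.*2.+1%:R * pi <= b) \/
  (m.*2%:R * pi < b < m.*2.+1%:R * pi /\ a < lambert_curve b).

(* w lies in the range of some W_(-j) with j > m. *)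
Definition lambert_below (R : realType) (m : nat) (w : R[i]) : Prop :=
  let a := complex.Re w in let b := complex.Im w in
  [\/ b <= - (m.*2.+1%:R * pi),
      - (m.*2.+1%:R * pi) < b < - (m.*2%:R * pi) /\ a <= lambert_curve b |
      [/\ m = 0%N, b = 0 & a <= -1]].

(* The branch point -1 = W_0(-1/e) = W_(-1)(-1/e) is the only point that
   belongs to two ranges. *)
Definition lambert_range (R : realType) (k : int) (w : R[i]) : Prop :=
  match k with
  | Posz 0 => ~ lambert_above 0 w /\ (~ lambert_below 0 w \/ w = -1)
  | Posz m.+1 => lambert_above m w /\ ~ lambert_above m.+1 w
  | Negz m => lambert_below m w /\ ~ lambert_below m.+1 w
  end.

(* W_k(z); the value is 0 by default where W_k is undefined, i.e. for z = 0 and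
   k != 0. *)
Definition lambertW (R : realType) (k : int) (z : R[i]) : R[i] :=
  xget 0 [set w | w * cexp w = z /\ lambert_range k w].

(* Main.v *)
Require Import Defs.
From HB Require Import structures.
From mathcomp Require Import all_boot all_order all_algebra complex.
From mathcomp Require Import all_classical all_reals all_analysis.
From mathcomp Require Import cyclic separable cyclotomic measurable_realfun.
From mathcomp Require Import ring lra zify.

(* Put u(x) = 1 - x - e^-x, so that the sum of B_n x^n / n! is formally the sum
   of u(x)^k / (k+1)^mu, and u(W) = 1 exactly when W e^W = -1. The double series
   does not converge absolutely at x = W, so the order of summation is exchanged
   through the Gamma integral: with s = e^-t, Gamma(mu) (k+1)^-mu is the integral
   of t^(mu-1) e^-t s^k, hence Gamma(mu) B_n / n! is the integral of t^(mu-1) e^-t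
   p_n(s), where p_n(s) is the n-th Taylor coefficient of 1 / (1 - s u(x)).

   Everything follows by dominated convergence from the estimate
     sum_n |p_n(s)| |W|^n <= C / (1 - s)   (0 < s < 1),
   since then the sum of p_n(s) W^n is 1 / (1 - s u(W)) = 1 / (1 - s), which is
   also the limit of the geometric sums that produce zeta(mu).

   For s < 1 the function 1 - s u has no zero in the disc |x| <= |W|: its zeros
   satisfy x + e^-x = -tau with tau > 0, and Im x, |x| increase with tau. A
   Wiener-type lemma (wiener_inverse) then puts its inverse in the algebra of
   absolutely convergent Taylor series, locally uniformly in s. Near s = 1 the
   two simple zeros W and its conjugate of 1 - u are split off as a quadratic
   factor, whose perturbed roots leave the disc at a speed proportional to 1 - s. *)

Set Implicit Arguments.
Unset Strict Implicit.
Unset Printing Implicit Defensive.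

Import Order.TTheory GRing.Theory Num.Theory.
Import numFieldNormedType.Exports.
Import Normc.

Local Open Scope classical_set_scope.
Local Open Scope ring_scope.
Local Open Scope complex_scope.

(** The evaluation point sits on the circle through the nearest singularities: at s = 1 the poles of
    1 / (1 - s u) are W and its conjugate themselves, so absolute convergence at |x| = |W| must be
    proved on a closed disc and must degrade as s tends to 1. The rate C / (1 - s) is just
    affordable: the weight t^(mu-1) e^-t / (1 - e^-t) behaves like t^(mu-2) at 0, which is
    integrable exactly when Re mu > 1. A direct exchange fails because absolute values lead to
    powers of e^|W| - 1 - |W|, a number greater than 1. All estimates live in the algebra of
    absolutely convergent Taylor series in the variable x / |W|, so that the disc is the closed unit
    disc and W becomes a point of the unit circle; finite sums over roots of unity play the part of
    contour integrals. The limit integral is never evaluated: both series converge to it divided by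
    Gamma(mu), which is why Gamma(mu) has to be shown nonzero. *)

(** * Modulus and convergence of complex sequences *)

Section ComplexModulus.
Variable R : realType.
Implicit Types x y z : R[i].

Lemma normcE_C z : `|z| = (normc z)%:C.
Proof. by []. Qed.

Lemma normc_ge0 z : 0 <= normc z.
Proof. by case: z => a b /=; exact: sqrtr_ge0. Qed.

Lemma normcD_le x y : normc (x + y) <= normc x + normc y.
Proof. exact: le_normcD. Qed.

Lemma normc_opp x : normc (- x) = normc x.
Proof. exact: normcN. Qed.

Lemma normcB_le x y : normc (x - y) <= normc x + normc y.
Proof. by rewrite -(normc_opp y); exact: normcD_le. Qed.

Lemma normcBC x y : normc (x - y) = normc (y - x).
Proof. by rewrite -normc_opp opprB. Qed.

Lemma normcB_ge x y : normc x - normc y <= normc (x - y).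
Proof. by rewrite lerBlDr; apply: le_trans (normcD_le _ _); rewrite subrK. Qed.

Lemma normcX x n : normc (x ^+ n) = normc x ^+ n.
Proof.
elim: n => [|n IH]; first by rewrite !expr0 normc1.
by rewrite !exprS normcM IH.
Qed.

Lemma normcR (r : R) : normc r%:C = `|r|.
Proof. by rewrite /= expr0n /= addr0 sqrtr_sqr. Qed.

Lemma normc_nat n : normc (n%:R : R[i]) = n%:R.
Proof.
rewrite -(rmorph_nat (real_complex R)) normcR ger0_norm//.
Qed.

Lemma normc_eq0 x : (normc x == 0) = (x == 0).
Proof.
by apply/eqP/eqP => [/eq0_normc//|->]; rewrite normc0.
Qed.

Lemma normc_gt0 x : (0 < normc x) = (x != 0).
Proof. by rewrite lt_def normc_eq0 normc_ge0 andbT. Qed.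

Lemma normc_sqr x : normc x ^+ 2 = complex.Re x ^+ 2 + complex.Im x ^+ 2.
Proof. by case: x => a b /=; rewrite sqr_sqrtr// addr_ge0 ?sqr_ge0. Qed.

Lemma ler_Re_normc x : `|complex.Re x| <= normc x.
Proof.
case: x => a b /=; rewrite -sqrtr_sqr ler_wsqrtr// lerDl sqr_ge0//.
Qed.

Lemma ler_Im_normc x : `|complex.Im x| <= normc x.
Proof.
case: x => a b /=; rewrite -sqrtr_sqr ler_wsqrtr// lerDr sqr_ge0//.
Qed.

Lemma normc_le_ReIm x : normc x <= `|complex.Re x| + `|complex.Im x|.
Proof.
rewrite -(@ler_pXn2r _ 2)// ?nnegrE ?normc_ge0 ?addr_ge0//.
rewrite normc_sqr sqrrD !real_normK ?num_real//.
have := mulr_ge0 (normr_ge0 (complex.Re x)) (normr_ge0 (complex.Im x)).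
by move: (_ * _) => t; lra.
Qed.

Lemma normc_sum (I : Type) (r : seq I) (P : pred I) (F : I -> R[i]) :
  normc (\sum_(i <- r | P i) F i) <= \sum_(i <- r | P i) normc (F i).
Proof.
elim/big_rec2: _ => [|i y1 y2 _ h]; first by rewrite normc0.
by apply: le_trans (normcD_le _ _) _; rewrite lerD2l.
Qed.

(** The norm of [R[i]] is [R[i]]-valued, so convergence is tested with complex radii; a positive one
    has zero imaginary part, which reduces the test to real radii. *)
Lemma cvgC_normcP (u : nat -> R[i]^o) (l : R[i]^o) :
  (u @ \oo --> l) <->
  (forall e : R, 0 < e -> \forall n \near \oo, normc (l - u n) < e).
Proof.
split=> [/cvgrPdist_lt h e e0|h].
  have e0C : 0 < e%:C :> R[i] by rewrite ltcR.
  by apply: filterS (h _ e0C) => n; rewrite normcE_C ltcR.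
apply/cvgrPdist_lt => -[e e'] /[dup] he; rewrite ltcE /= => /andP[/eqP -> e0].
by apply: filterS (h _ e0) => n; rewrite normcE_C ltcR.
Qed.

Lemma cvgC_ReIm (u : nat -> R[i]^o) (a b : R) :
  (fun n => complex.Re (u n)) @ \oo --> a ->
  (fun n => complex.Im (u n)) @ \oo --> b ->
  u @ \oo --> (a +i* b : R[i]^o).
Proof.
move=> /cvgrPdist_lt ha /cvgrPdist_lt hb; apply/cvgC_normcP => e e0.
have e2 : 0 < e / 2 by lra.
near=> n.
apply: le_lt_trans (normc_le_ReIm _) _.
have : `|a - complex.Re (u n)| < e / 2 by near: n; exact: ha.
have : `|b - complex.Im (u n)| < e / 2 by near: n; exact: hb.
case: (u n) => c d /= h1 h2; lra.
Unshelve. all: by end_near. Qed.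

Lemma cvgC_normc_le (u : nat -> R[i]^o) (l : R[i]^o) (M : R) :
  u @ \oo --> l -> (forall n, normc (u n) <= M) -> normc l <= M.
Proof.
move=> /cvgC_normcP h uM; apply/ler_addgt0Pr => e e0.
have [N _ hN] := h e e0.
have := hN N (leqnn N).
have := normcB_ge l (l - u N); rewrite subKr => h1 h2.
have := uM N; lra.
Qed.

End ComplexModulus.

(** * Absolutely summable sequences *)

Section Summable.
Variable R : realType.
Implicit Types a b c : nat -> R[i].

(** A bound on the partial sums instead of a value of the norm: it presupposes no convergence, and
    the ring operations act directly on the constant [M]. *)
Definition l1_le a (M : R) := forall n, \sum_(i < n) normc (a i) <= M.
Definition summableC a := exists M, l1_le a M.

Lemma l1_le_ge0 a M : l1_le a M -> 0 <= M.
Proof. by move/(_ 0%N); rewrite big_ord0. Qed.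

Lemma l1_le_trans a M N : l1_le a M -> M <= N -> l1_le a N.
Proof. by move=> h MN n; exact: le_trans (h n) MN. Qed.

Lemma l1_leS a b M : (forall n, normc (a n) <= normc (b n)) ->
  l1_le b M -> l1_le a M.
Proof.
by move=> ab h n; apply: le_trans (h n); apply: ler_sum => i _; exact: ab.
Qed.

Lemma l1_leD a b M N : l1_le a M -> l1_le b N ->
  l1_le (fun n => a n + b n) (M + N).
Proof.
move=> ha hb n; apply: le_trans (lerD (ha n) (hb n)).
by rewrite -big_split /=; apply: ler_sum => i _; exact: normcD_le.
Qed.

Lemma l1_le_scale a (k : R[i]) M : l1_le a M ->
  l1_le (fun n => k * a n) (normc k * M).
Proof.
move=> ha n; under eq_bigr do rewrite normcM.
by rewrite -mulr_sumr ler_wpM2l ?normc_ge0.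
Qed.

Lemma l1_le_coef a M n : l1_le a M -> normc (a n) <= M.
Proof.
move=> /(_ n.+1); rewrite big_ord_recr /=; apply: le_trans.
by rewrite lerDr sumr_ge0// => i _; exact: normc_ge0.
Qed.

Lemma l1_le_pow a M x : normc x <= 1 -> l1_le a M ->
  l1_le (fun n => a n * x ^+ n) M.
Proof.
move=> x1; apply: l1_leS => n.
by rewrite normcM normcX ler_piMr ?normc_ge0// exprn_ile1 ?normc_ge0.
Qed.

Lemma summable_cvgC a : summableC a -> cvgn (series (a : nat -> R[i]^o)).
Proof.
move=> [M aM].
have cv (f : R[i] -> R) : (forall z, `|f z| <= normc z) ->
    cvgn (series (fun n => f (a n))).
  move=> fle; apply: normed_cvg.
  apply: nondecreasing_is_cvgn.
    apply: nondecreasing_series => n _ _; exact: normr_ge0.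
  exists M => _ [n _ <-].
  suff : \sum_(0 <= k < n) `|f (a k)| <= M by []; rewrite big_mkord.
  by apply: le_trans (aM n); apply: ler_sum => i _; exact: fle.
have h1 := cv (@complex.Re R) (@ler_Re_normc _).
have h2 := cv (@complex.Im R) (@ler_Im_normc _).
apply/cvg_ex; exists (limn (series (fun n => complex.Re (a n))) +i*
  limn (series (fun n => complex.Im (a n)))).
apply: cvgC_ReIm.
- rewrite (_ : (fun _ => _) = series (fun n => complex.Re (a n))) //.
  apply/funext => n; rewrite /series /=.
  exact: (raddf_sum (@complex.Re R : {additive Rcomplex R -> R})).
- rewrite (_ : (fun _ => _) = series (fun n => complex.Im (a n))) //.
  apply/funext => n; rewrite /series /=.
  exact: (raddf_sum (@complex.Im R : {additive Rcomplex R -> R})).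
Qed.

Definition csum a : R[i] := limn (series (a : nat -> R[i]^o)).

Lemma csumP a : summableC a -> series (a : nat -> R[i]^o) @ \oo --> (csum a : R[i]^o).
Proof. exact: summable_cvgC. Qed.

Lemma csum_unique a (l : R[i]) :
  series (a : nat -> R[i]^o) @ \oo --> (l : R[i]^o) -> csum a = l.
Proof. by move=> h; apply: (cvg_lim _ h); exact: norm_hausdorff. Qed.

Lemma csum_le a M : l1_le a M -> normc (csum a) <= M.
Proof.
move=> aM; have := csumP (ex_intro _ M aM); move/cvgC_normc_le; apply => n.
rewrite /series /= big_mkord; apply: le_trans (aM n); exact: normc_sum.
Qed.

End Summable.

Global Opaque csum.

(** * Finite Cauchy products *)

Section CauchyProductSums.
Variable K : comNzRingType.
Implicit Types a b : nat -> K.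

Lemma sum_cauchy_prod a b m :
  \sum_(n < m) \sum_(i < n.+1) a i * b (n - i)%N =
  \sum_(i < m) a i * \sum_(j < m - i) b j.
Proof.
elim: m => [|m IH]; first by rewrite !big_ord0.
rewrite big_ord_recr /= IH [in RHS]big_ord_recr /= subSnn big_ord1.
rewrite [\sum_(i < m.+1) _]big_ord_recr /= subnn addrA; congr (_ + _).
rewrite -big_split /=; apply: eq_bigr => i _.
by rewrite (subSn (ltnW (ltn_ord i))) big_ord_recr /= mulrDr.
Qed.

End CauchyProductSums.

Lemma sumrB_ord (V : zmodType) (f : nat -> V) m n : (m <= n)%N ->
  \sum_(i < n) f i - \sum_(i < m) f i = \sum_(m <= i < n) f i.
Proof.
move=> mn; rewrite -(big_mkord xpredT f) (big_cat_nat _ mn)//= big_mkord.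
by rewrite addrAC subrr add0r.
Qed.

Lemma ler_sum_ord (K : numDomainType) (f : nat -> K) m n :
  (forall i, 0 <= f i) -> (m <= n)%N -> \sum_(i < m) f i <= \sum_(i < n) f i.
Proof.
move=> f0 mn; rewrite -!(big_mkord xpredT) (big_cat_nat _ mn)//=.
by rewrite lerDl sumr_ge0.
Qed.

(** The triangle [i + j < m] lies in the square of side [m]. *)
Lemma sum_cauchy_prod_le (K : numDomainType) (a b : nat -> K) m :
  (forall i, 0 <= a i) -> (forall i, 0 <= b i) ->
  \sum_(n < m) \sum_(i < n.+1) a i * b (n - i)%N <=
  (\sum_(i < m) a i) * (\sum_(i < m) b i).
Proof.
move=> a0 b0; rewrite sum_cauchy_prod mulr_suml; apply: ler_sum => i _.
by rewrite ler_wpM2l// ler_sum_ord// leq_subr.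
Qed.

(** The square of side [N] lies in the triangle [i + j < m] as soon as [2 N <= m]. *)
Lemma sum_cauchy_prod_ge (K : numDomainType) (a b : nat -> K) N m :
  (forall i, 0 <= a i) -> (forall i, 0 <= b i) -> (N.*2 <= m)%N ->
  (\sum_(i < N) a i) * (\sum_(i < N) b i) <=
  \sum_(n < m) \sum_(i < n.+1) a i * b (n - i)%N.
Proof.
move=> a0 b0 Nm; rewrite sum_cauchy_prod.
have Nm' : (N <= m)%N by lia.
apply: le_trans (ler_sum_ord (f := fun i => a i * \sum_(j < m - i) b j) _ Nm').
  rewrite mulr_suml; apply: ler_sum => -[i iN] _ /=.
  by rewrite ler_wpM2l// ler_sum_ord//; lia.
by move=> i; rewrite mulr_ge0// sumr_ge0.
Qed.

(** * The ring of formal power series, and evaluation on the closed unit disc *)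

Definition fps (R : realType) := nat -> R[i].

Section FormalPowerSeries.
Variable R : realType.
Implicit Types a b c : fps R.

HB.instance Definition _ := GRing.Zmodule.copy (fps R) (nat -> R[i]).

Definition fps_one : fps R := fun n => (n == 0%N)%:R.
Definition fps_mul a b : fps R := fun n => \sum_(i < n.+1) a i * b (n - i)%N.

Let trunc n a := \poly_(i < n) a i.

(** The n-th coefficient of a product only sees truncations, so the ring laws are inherited from
    polynomials. *)
Let trunc_mul a b n m : (n < m)%N -> fps_mul a b n = (trunc m a * trunc m b)`_n.
Proof.
move=> nm; rewrite coefM; apply: eq_bigr => -[i /= iN] _.
by rewrite !coef_poly !ifT//; lia.
Qed.

Let fps_mulC : commutative fps_mul.
Proof.
by move=> a b; apply/funext => n; rewrite !(@trunc_mul _ _ _ n.+1)// mulrC.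
Qed.

Let fps_mulA : associative fps_mul.
Proof.
move=> a b c; apply/funext => n.
transitivity ((trunc n.+1 a * (trunc n.+1 b * trunc n.+1 c))`_n).
  rewrite coefM; apply: eq_bigr => -[i /= iN] _.
  by rewrite -trunc_mul ?coef_poly ?ifT//; lia.
rewrite mulrA coefM; apply: eq_bigr => -[i /= iN] _.
by rewrite -trunc_mul ?coef_poly ?ifT//; lia.
Qed.

Let fps_mul1 : left_id fps_one fps_mul.
Proof.
move=> a; apply/funext => n; rewrite /fps_mul big_ord_recl /= subn0 mul1r.
by rewrite big1 ?addr0// => i _; rewrite /fps_one /= mul0r.
Qed.

Let fps_mulDl : left_distributive fps_mul +%R.
Proof.
move=> a b c; apply/funext => n.
rewrite -[RHS]/(fps_mul a c n + fps_mul b c n) /fps_mul -big_split /=.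
by apply: eq_bigr => i _; rewrite mulrDl.
Qed.

Let fps_oner_neq0 : fps_one != 0 :> fps R.
Proof.
apply/eqP => /(congr1 (fun f : fps R => f 0%N)); apply/eqP; exact: oner_neq0.
Qed.

HB.instance Definition _ := GRing.Zmodule_isComNzRing.Build (fps R)
  fps_mulA fps_mulC fps_mul1 fps_mulDl fps_oner_neq0.

Lemma fpsDE a b n : (a + b) n = a n + b n. Proof. by []. Qed.
Lemma fpsNE a n : (- a) n = - a n. Proof. by []. Qed.
Lemma fpsME a b n : (a * b) n = \sum_(i < n.+1) a i * b (n - i)%N.
Proof. by []. Qed.
Lemma fps1E n : (1 : fps R) n = (n == 0%N)%:R. Proof. by []. Qed.

Definition fpsC (k : R[i]) : fps R := fun n => k * (n == 0%N)%:R.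
Definition fpsX : fps R := fun n => (n == 1%N)%:R.

Lemma fpsCM k a n : (fpsC k * a) n = k * a n.
Proof.
rewrite fpsME big_ord_recl /= /fpsC /= subn0 mulr1 big1 ?addr0// => i _.
by rewrite mulr0 mul0r.
Qed.

Lemma fpsC_mul k l : fpsC (k * l) = fpsC k * fpsC l.
Proof. by apply/funext => n; rewrite fpsCM /fpsC mulrA. Qed.

Lemma fpsC_add k l : fpsC (k + l) = fpsC k + fpsC l.
Proof. by apply/funext => n; rewrite fpsDE /fpsC mulrDl. Qed.

Lemma fpsC1 : fpsC 1 = 1.
Proof. by apply/funext => n; rewrite /fpsC mul1r. Qed.

Lemma fpsXM0 a : (fpsX * a) 0%N = 0.
Proof. by rewrite fpsME big_ord1 /fpsX mul0r. Qed.

Lemma fpsXMS a n : (fpsX * a) n.+1 = a n.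
Proof.
rewrite fpsME big_ord_recl big_ord_recl /= /fpsX /= mul0r add0r mul1r.
by rewrite subSS subn0 big1 ?addr0// => i _; rewrite /bump /= mul0r.
Qed.

Lemma fps_inv_ex a : a 0%N != 0 -> exists b, a * b = 1.
Proof.
move=> a0.
(* Course-of-values recursion: [L n] lists the first [n] coefficients of the inverse, and [next]
   computes the following one from them. *)
pose next (l : seq R[i]) := ((size l == 0%N)%:R
  - \sum_(i < size l) a (size l - i)%N * l`_i) / a 0%N.
pose L := fix L n := if n is n'.+1 then rcons (L n') (next (L n')) else [::].
have szL n : size (L n) = n by elim: n => //= n IH; rewrite size_rcons IH.
have nthL n m i : (i < n <= m)%N -> (L m)`_i = (L n)`_i.
  elim: m => [|m IH] /andP[iN nm]; first by lia.
  case: (ltngtP n m.+1) nm => // [nm _|-> //].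
  rewrite /= nth_rcons szL ifT; last by lia.
  by apply: IH; lia.
exists (fun n => (L n.+1)`_n); apply/funext => n.
rewrite mulrC fpsME big_ord_recr /= subnn nth_rcons szL ltnn eqxx /next szL.
rewrite divfK//; set S := \sum_(i < n) _; set T := \sum_(i < n) _.
suff -> : S = T by rewrite addrC subrK fps1E.
apply: eq_bigr => -[i iN] _ /=.
by rewrite mulrC -[rcons _ _]/(L i.+1) (nthL i.+1 n)// ltnSn iN.
Qed.

Lemma sum_normcM_le a b m : \sum_(n < m) normc ((a * b) n) <=
  (\sum_(i < m) normc (a i)) * (\sum_(i < m) normc (b i)).
Proof.
apply: (le_trans _ (sum_cauchy_prod_le (a := fun i => normc (a i))
  (b := fun i => normc (b i)) m (fun i => normc_ge0 _) (fun i => normc_ge0 _))).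
apply: ler_sum => n _; rewrite fpsME; apply: le_trans (normc_sum _ _ _) _.
by apply: ler_sum => i _; rewrite normcM.
Qed.

Lemma l1_leM a b M N : l1_le a M -> l1_le b N -> l1_le (a * b) (M * N).
Proof.
move=> aM bN m; apply: le_trans (sum_normcM_le _ _ _) _.
by apply: ler_pM => //; apply: sumr_ge0 => i _; exact: normc_ge0.
Qed.

Lemma summableCM a b : summableC a -> summableC b -> summableC (a * b).
Proof. by move=> [M aM] [N bN]; exists (M * N); exact: l1_leM. Qed.

Lemma summableCD a b : summableC a -> summableC b -> summableC (a + b).
Proof. by move=> [M aM] [N bN]; exists (M + N); exact: l1_leD. Qed.

Lemma l1_leN a M : l1_le a M -> l1_le (- a) M.
Proof. by apply: l1_leS => n; rewrite fpsNE normc_opp. Qed.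

Lemma l1_le_finite a N : (forall n, (N <= n)%N -> a n = 0) ->
  l1_le a (\sum_(i < N) normc (a i)).
Proof.
move=> h n; case: (leqP n N) => nN.
  by apply: (ler_sum_ord (f := fun i => normc (a i))) => // i; exact: normc_ge0.
rewrite -(big_mkord xpredT (fun i => normc (a i))).
rewrite (big_cat_nat _ (ltnW nN))//= big_mkord [X in _ + X]big_nat_cond [X in _ + X]big1.
  by rewrite addr0.
by move=> i /andP[/andP[Ni _] _]; rewrite h// normc0.
Qed.

Lemma l1_leC k : l1_le (fpsC k) (normc k).
Proof.
have := @l1_le_finite (fpsC k) 1%N; rewrite big_ord1 /fpsC /= mulr1; apply.
by case=> // n _; rewrite mulr0.
Qed.

Lemma l1_le1 : l1_le (1 : fps R) 1.
Proof. by rewrite -fpsC1 -[X in l1_le _ X](@normc1 R); exact: l1_leC. Qed.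

Lemma l1_leX : l1_le fpsX 1.
Proof.
have := @l1_le_finite fpsX 2%N; rewrite 2!big_ord_recl big_ord0 /fpsX.
rewrite !normc_nat add0r addr0; apply.
by case=> [|[|]].
Qed.

Definition ev a (x : R[i]) : R[i] := csum (fun n => a n * x ^+ n).

Lemma summable_pow a x : normc x <= 1 -> summableC a ->
  summableC (fun n => a n * x ^+ n).
Proof. by move=> x1 [M aM]; exists M; exact: l1_le_pow. Qed.

Lemma evP a x : normc x <= 1 -> summableC a ->
  series ((fun n => a n * x ^+ n) : nat -> R[i]^o) @ \oo --> (ev a x : R[i]^o).
Proof. by move=> x1 sa; exact: csumP (summable_pow x1 sa). Qed.

Lemma ev_le a x M : normc x <= 1 -> l1_le a M -> normc (ev a x) <= M.
Proof. by move=> x1 aM; apply: csum_le; exact: l1_le_pow. Qed.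

Lemma csumD (a b : nat -> R[i]) : summableC a -> summableC b ->
  csum (fun n => a n + b n) = csum a + csum b.
Proof.
move=> sa sb; apply: csum_unique.
have -> : series ((fun n => a n + b n) : nat -> R[i]^o) =
    series (a : nat -> R[i]^o) + series (b : nat -> R[i]^o).
  by apply/funext => n; rewrite /series /= big_split.
exact: cvgD (csumP sa) (csumP sb).
Qed.

Lemma csumZ (k : R[i]) (a : nat -> R[i]) : summableC a ->
  csum (fun n => k * a n) = k * csum a.
Proof.
move=> sa; apply: csum_unique.
have -> : series ((fun n => k * a n) : nat -> R[i]^o) =
    (fun n => k * series (a : nat -> R[i]^o) n).
  by apply/funext => n; rewrite /series /= mulr_sumr.
exact: cvgMl_tmp (csumP sa).
Qed.

(** The square and the triangular partial sums differ by the pairs with [i, j < m <= i + j]. The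
    same difference for the norms dominates it, and that one is at most the distance from
    [A n0 * B n0] to the limit of [A * B] once [n0.*2 <= m]. *)
Lemma csumM a b : summableC a -> summableC b ->
  csum (a * b) = csum a * csum b.
Proof.
move=> sa sb; apply: csum_unique.
have h : series (a : nat -> R[i]^o) * series (b : nat -> R[i]^o) @ \oo
    --> (csum a * csum b : R[i]^o).
  exact: cvgM (csumP sa) (csumP sb).
move: sa sb => [M aM] [N bN].
pose A n := \sum_(i < n) normc (a i); pose B n := \sum_(i < n) normc (b i).
have cA : cvgn A.
  apply: nondecreasing_is_cvgn.
    move=> m n mn; apply: (ler_sum_ord (f := fun i => normc (a i))) => // i.
    exact: normc_ge0.
  by exists M => _ [n _ <-]; exact: aM.
have cB : cvgn B.
  apply: nondecreasing_is_cvgn.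
    move=> m n mn; apply: (ler_sum_ord (f := fun i => normc (b i))) => // i.
    exact: normc_ge0.
  by exists N => _ [n _ <-]; exact: bN.
have cAB : cvgn (A * B) by apply: is_cvgM.
have ndAB : nondecreasing_seq (A * B).
  move=> m n mn; rewrite !fctE; apply: ler_pM.
  - by apply: sumr_ge0 => i _; exact: normc_ge0.
  - by apply: sumr_ge0 => i _; exact: normc_ge0.
  - apply: (ler_sum_ord (f := fun i => normc (a i))) => // i; exact: normc_ge0.
  - apply: (ler_sum_ord (f := fun i => normc (b i))) => // i; exact: normc_ge0.
apply/cvgC_normcP => e e0.
have e2 : 0 < e / 2 by lra.
move: h => /cvgC_normcP/(_ _ e2) h.
have /cvgrPdist_lt/(_ _ e2)[n0 _ hn0] : (A * B)%R @ \oo --> limn (A * B)%R by exact: cAB.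
pose P := series (a : nat -> R[i]^o) * series (b : nat -> R[i]^o).
pose Q := series ((a * b : fps R) : nat -> R[i]^o).
near=> m.
have h1 : normc (csum a * csum b - P m) < e / 2.
  by near: m; exact: h.
have nm : (n0.*2 <= m)%N by near: m; exists n0.*2.
apply: le_lt_trans (_ : normc (csum a * csum b - P m) + normc (P m - Q m) < _).
  by apply: le_trans (normcD_le _ _); rewrite addrA subrK.
suff h2 : normc (P m - Q m) < e / 2 by lra.
rewrite /P /Q.
apply: (@le_lt_trans _ _ (A m * B m -
    \sum_(n < m) \sum_(i < n.+1) normc (a i) * normc (b (n - i)%N))).
  rewrite fctE /series /= !big_mkord (sum_cauchy_prod a b m).
  rewrite (sum_cauchy_prod (fun i => normc (a i)) (fun i => normc (b i)) m).
  rewrite !mulr_suml -!sumrB; apply: le_trans (normc_sum _ _ _) _.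
  apply: ler_sum => i _ /=; rewrite -!mulrBr normcM ler_wpM2l ?normc_ge0//.
  have mi : (m - i <= m)%N by exact: leq_subr.
  rewrite /B (sumrB_ord _ mi) (sumrB_ord (fun j => normc (b j)) mi).
  exact: normc_sum.
have := sum_cauchy_prod_ge (a := fun i => normc (a i))
  (b := fun i => normc (b i)) (N := n0) (m := m).
move=> /(_ (fun i => normc_ge0 _) (fun i => normc_ge0 _) nm) /=.
have := hn0 n0 (leqnn _); rewrite fctE.
have := nondecreasing_cvgn_le ndAB cAB m.
have := nondecreasing_cvgn_le ndAB cAB n0.
rewrite !fctE => h3 h4; rewrite ger0_norm ?subr_ge0// => h5.
rewrite -/(A n0) -/(B n0) => h6; lra.
Unshelve. all: by end_near. Qed.

Lemma evM a b x : normc x <= 1 -> summableC a -> summableC b ->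
  ev (a * b) x = ev a x * ev b x.
Proof.
move=> x1 sa sb.
rewrite /ev -[RHS](csumM (summable_pow x1 sa) (summable_pow x1 sb)).
congr csum; apply/funext => n; rewrite !fpsME mulr_suml; apply: eq_bigr => i _.
by rewrite mulrACA -exprD subnKC// -ltnS.
Qed.

Lemma evD a b x : normc x <= 1 -> summableC a -> summableC b ->
  ev (a + b) x = ev a x + ev b x.
Proof.
move=> x1 sa sb.
rewrite /ev -[RHS](csumD (summable_pow x1 sa) (summable_pow x1 sb)).
by congr csum; apply/funext => n; rewrite -mulrDl.
Qed.

Lemma evCM k a x : normc x <= 1 -> summableC a -> ev (fpsC k * a) x = k * ev a x.
Proof.
move=> x1 sa; rewrite /ev -(csumZ _ (summable_pow x1 sa)).
by congr csum; apply/funext => n; rewrite fpsCM mulrA.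
Qed.

Lemma csum_finite (a : nat -> R[i]) N : (forall n, (N <= n)%N -> a n = 0) ->
  csum a = \sum_(i < N) a i.
Proof.
move=> h; apply: csum_unique; apply/cvgC_normcP => e e0; exists N => // n Nn.
rewrite normcBC /series /= big_mkord sumrB_ord// big_nat_cond big1 ?normc0//.
by move=> i /andP[/andP[Ni _] _]; exact: h.
Qed.

Lemma ev1 x : ev 1 x = 1.
Proof.
rewrite /ev (@csum_finite _ 1%N) ?big_ord1 ?fps1E ?mulr1//.
by case=> // n _; rewrite fps1E mul0r.
Qed.

Lemma evC k x : ev (fpsC k) x = k.
Proof.
rewrite /ev (@csum_finite _ 1%N) ?big_ord1 /fpsC ?mulr1//.
by case=> // n _; rewrite mulr0 mul0r.
Qed.

Lemma evX x : ev fpsX x = x.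
Proof.
rewrite /ev (@csum_finite _ 2%N).
  by rewrite 2!big_ord_recl big_ord0 /fpsX /= mul0r add0r mul1r addr0 expr1.
by case=> [|[|]]// n _; rewrite /fpsX mul0r.
Qed.

Lemma evN a x : normc x <= 1 -> summableC a -> ev (- a) x = - ev a x.
Proof.
move=> x1 sa.
have -> : - a = fpsC (-1) * a.
  by apply/funext => n; rewrite fpsCM mulN1r.
by rewrite evCM// mulN1r.
Qed.

End FormalPowerSeries.

(** * Invertibility under small perturbations *)

Section Perturbation.
Variable R : realType.
Implicit Types a b e : fps R.

(* The inequality B <= 1 + theta B for the partial sums B of the norms of b,
   read off b = 1 + e b, replaces the convergence of the Neumann series. *)
Lemma l1_le_inv_sub1 e b theta : l1_le e theta -> theta < 1 ->
  (1 - e) * b = 1 -> l1_le b (1 - theta)^-1.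
Proof.
move=> et t1 eb m.
have bE : b = 1 + e * b by rewrite -eb; ring.
set B := \sum_(i < m) _.
have B0 : 0 <= B by apply: sumr_ge0 => i _; exact: normc_ge0.
have h : B <= 1 + theta * B.
  rewrite {1}/B {1}bE.
  apply: (@le_trans _ _ (\sum_(i < m) normc ((1 : fps R) i) + \sum_(i < m) normc ((e * b) i))).
    by rewrite -big_split /=; apply: ler_sum => i _; exact: normcD_le.
  apply: lerD; first exact: (@l1_le1 R).
  apply: le_trans (sum_normcM_le _ _ _) _; rewrite -/B ler_wpM2r//.
have t1' : 0 < 1 - theta by lra.
by rewrite -[leRHS]mul1r ler_pdivlMr//; lra.
Qed.

(** [a + e = a * (1 + e * b)] and [e * b] has norm at most 1/2, so inverting the second factor costs
    a factor 2. *)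
Lemma inv_perturb a b e M d : a * b = 1 -> l1_le b M -> l1_le e d ->
  d * M <= 2^-1 -> exists2 c, (a + e) * c = 1 & l1_le c (2 * M).
Proof.
move=> ab bM ed dM.
have M0 := l1_le_ge0 bM.
have ebM : l1_le (- (e * b)) 2^-1.
  by apply: l1_leN; exact: l1_le_trans (l1_leM ed bM) dM.
have [c hc] : exists c, (1 - (- (e * b))) * c = 1.
  apply: fps_inv_ex; rewrite fpsDE fpsNE fps1E /= subr_eq0 eq_sym.
  apply/eqP => h; have := l1_le_coef 0 ebM; rewrite h normc1; lra.
exists (b * c).
  by rewrite -hc opprK -ab; ring.
have h1 : 2^-1 < 1 :> R by lra.
have := l1_leM bM (l1_le_inv_sub1 ebM h1 hc).
by have -> : M * (1 - 2^-1)^-1 = 2 * M by field.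
Qed.

End Perturbation.

(** * Coefficients bounded by the supremum on the unit circle *)

Section CoefficientBound.
Variable R : realType.
Implicit Types a b c : fps R.

(** The tail of the norms bounds the tail at every [x] of the disc. Uniformity matters: the
    evaluation points will be N-th roots of unity, which change with the truncation order [N]. *)
Lemma ev_tail c : summableC c -> forall e : R, 0 < e ->
  exists N, forall n x, (N <= n)%N -> normc x <= 1 ->
    normc (ev c x - \sum_(i < n) c i * x ^+ i) <= e.
Proof.
move=> [M cM] e e0; pose A n := \sum_(i < n) normc (c i).
have ndA : nondecreasing_seq A.
  move=> m n mn; apply: (ler_sum_ord (f := fun i => normc (c i))) => // i.
  exact: normc_ge0.
have cA : cvgn A.
  by apply: nondecreasing_is_cvgn => //; exists M => _ [n _ <-]; exact: cM.
have /cvgrPdist_lt/(_ _ e0)[N _ hN] : A @ \oo --> limn A by exact: cA.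
exists N => n x Nn x1.
have := hN n Nn; rewrite ger0_norm ?subr_ge0; last exact: nondecreasing_cvgn_le.
move=> hn; apply/ler_addgt0Pr => d d0.
have := evP x1 (ex_intro _ M cM); move=> /cvgC_normcP/(_ _ d0)[m _ hm].
have := hm (maxn m n) (leq_maxl _ _).
rewrite /series /= big_mkord => h1.
set y := ev c x; set S := \sum_(i < n) _; set T := \sum_(i < maxn m n) _ in h1.
have h2 : normc (T - S) <= e.
  rewrite /T /S (sumrB_ord (fun i => c i * x ^+ i) (leq_maxr _ _)).
  apply: le_trans (normc_sum _ _ _) _.
  apply: (@le_trans _ _ (\sum_(n <= i < maxn m n) normc (c i))).
    apply: ler_sum => i _.
    by rewrite normcM normcX ler_piMr ?normc_ge0// exprn_ile1 ?normc_ge0.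
  rewrite -(sumrB_ord (fun i => normc (c i)) (leq_maxr _ _)).
  have := nondecreasing_cvgn_le ndA cA (maxn m n); rewrite /A in hn *.
  by move: hn => /ltW hn h; apply: le_trans hn; rewrite lerD2r.
have -> : y - S = (y - T) + (T - S) by ring.
apply: le_trans (normcD_le _ _) _; rewrite -/y in h1; lra.
Qed.

(** [X^n - 1] splits and is separable, so there are [n] distinct n-th roots of unity, and one of
    them must be primitive. *)
Lemma complex_prim_root n : (0 < n)%N -> exists z : R[i], n.-primitive_root z.
Proof.
move=> n0; pose p : {poly R[i]} := 'X^n - 1.
have [r Dp] := closed_field_poly_normal p.
rewrite (monicP _) ?monicXnsubC // scale1r in Dp.
have rn1 : all n.-unity_root r by apply/allP=> z; rewrite -root_prod_XsubC -Dp.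
have sz_r : (n < (size r).+1)%N.
  by rewrite -(size_prod_XsubC r id) -Dp size_XnsubC.
have [|z] := hasP (has_prim_root n0 rn1 _ sz_r); last by exists z.
by rewrite -separable_prod_XsubC -Dp separable_Xn_sub_1// pnatr_eq0 -lt0n.
Qed.

Lemma prim_root_normc n (z : R[i]) : n.-primitive_root z -> normc z = 1.
Proof.
move=> zn; have n0 := prim_order_gt0 zn.
have := prim_expr_order zn => /(congr1 (@normc R)); rewrite normcX normc1 => /eqP.
by rewrite pexpr_eq1 ?normc_ge0// => /eqP.
Qed.

(* c_n is recovered from the values of c at the N-th roots of unity, N > n, by
   the discrete Fourier inversion formula, up to the tail of the series. *)
Lemma coef_le_sup c S n : summableC c ->
  (forall x, normc x = 1 -> normc (ev c x) <= S) -> normc (c n) <= S.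
Proof.
move=> sc hS; apply/ler_addgt0Pr => e e0.
have [N0 hN0] := ev_tail sc e0.
pose N := (maxn N0 n.+1).
have N0N : (N0 <= N)%N by exact: leq_maxl.
have nN : (n < N)%N by exact: leq_maxr.
have Ngt0 : (0 < N)%N by exact: leq_trans nN.
have [w hw] := complex_prim_root Ngt0.
have w1 := prim_root_normc hw.
pose p j := \sum_(i < N) c i * (w ^+ j) ^+ i.
have key : N%:R * c n = \sum_(j < N) p j * (w ^+ (N - n)) ^+ j.
  rewrite /p; under eq_bigr do rewrite mulr_suml.
  rewrite exchange_big /= (bigD1 (Ordinal nN))//= [X in _ + X]big1 ?addr0.
    under eq_bigr do rewrite -exprM -mulrA -exprM mulnC -exprD -mulnDl subnKC ?(ltnW nN)//.
    under eq_bigr do rewrite exprM (prim_expr_order hw) expr1n mulr1.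
    by rewrite sumr_const card_ord mulr_natl.
  move=> i ni.
  (* Since [0 < i + (N - n) < 2 N], this power of [w] is 1 only for [i = n]; otherwise its geometric
     sum over [j] vanishes. *)
  pose z := w ^+ (i + (N - n)).
  have z1 : z != 1.
    rewrite /z -(prim_order_dvd hw); apply/negP => /dvdnP[q hq].
    case/eqP: ni; apply/val_inj => /=.
    have iN := ltn_ord i.
    case: q hq => [|[|q]] hq; lia.
  have : (z - 1) * \sum_(j < N) z ^+ j = 0.
    by rewrite -subrX1 /z -exprM mulnC exprM (prim_expr_order hw) expr1n subrr.
  move/eqP; rewrite mulf_eq0 subr_eq0 (negbTE z1) /= => /eqP hz.
  under eq_bigr do rewrite -mulrA -exprM -exprM mulnC -exprD -mulnDl exprM -/z.
  by rewrite -mulr_sumr hz mulr0.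
have N0R : 0 < N%:R :> R by rewrite ltr0n.
have : normc (N%:R * c n) <= N%:R * (S + e).
  rewrite key; apply: le_trans (normc_sum _ _ _) _.
  apply: (@le_trans _ _ (\sum_(j < N) (S + e))); last first.
    by rewrite sumr_const card_ord mulr_natl.
  apply: ler_sum => j _; rewrite normcM !normcX w1 !expr1n mulr1.
  have wj : normc (w ^+ j) = 1 by rewrite normcX w1 expr1n.
  have := hN0 N (w ^+ j) N0N; rewrite wj lexx => /(_ isT).
  have := hS _ wj; rewrite -/(p j); set y := ev c _ => h1 h2.
  have -> : p j = y - (y - p j) by ring.
  by apply: le_trans (normcB_le _ _) _; rewrite lerD.
by rewrite normcM normc_nat ler_pM2l.
Qed.

End CoefficientBound.

(** * A positive minimum modulus on the closed disc *)

Section MinimumModulus.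
Variable R : realType.
Implicit Types a b c : fps R.

(** The Euler operator [x d/dx]: unlike [d/dx] it keeps the degree of each term, hence commutes with
    dilations, and it is still a derivation. *)
Definition fpsD a : fps R := fun n => n%:R * a n.

Lemma subrX_le (x y : R[i]) n : normc x <= 1 -> normc y <= 1 ->
  normc (x ^+ n - y ^+ n) <= n%:R * normc (x - y).
Proof.
move=> x1 y1; elim: n => [|n IH]; first by rewrite !expr0 subrr normc0 mul0r.
have -> : x ^+ n.+1 - y ^+ n.+1 = x * (x ^+ n - y ^+ n) + y ^+ n * (x - y).
  by rewrite !exprS; ring.
apply: le_trans (normcD_le _ _) _; rewrite !normcM -natr1 mulrDl mul1r lerD//.
  by apply: le_trans IH; rewrite ler_piMl ?normc_ge0.
by rewrite ler_piMl ?normc_ge0// normcX exprn_ile1 ?normc_ge0.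
Qed.

Lemma csumB (a b : nat -> R[i]) : summableC a -> summableC b ->
  csum (fun n => a n - b n) = csum a - csum b.
Proof.
move=> sa [M bM]; rewrite -[in RHS](mulN1r (csum b)) -csumZ; last by exists M.
rewrite -csumD//; last by exists (normc (-1) * M); exact: l1_le_scale.
by congr csum; apply/funext => n; rewrite mulN1r.
Qed.

Lemma ev_lipschitz a K x y : summableC a -> l1_le (fpsD a) K ->
  normc x <= 1 -> normc y <= 1 -> normc (ev a x - ev a y) <= K * normc (x - y).
Proof.
move=> sa aK x1 y1; rewrite /ev -csumB; try exact: summable_pow.
apply: csum_le; rewrite mulrC.
have := l1_le_scale ((normc (x - y))%:C) aK.
rewrite normcR ger0_norm ?normc_ge0//; apply: l1_leS => n.
rewrite /fpsD -mulrBr !normcM normcR normc_nat ger0_norm ?normc_ge0//.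
by rewrite mulrC mulrA ler_wpM2r ?normc_ge0// [leRHS]mulrC subrX_le.
Qed.

(** Compactness in near-covering form: each point of the disc, seen in the real plane, gets a
    neighbourhood and a threshold below which every [m] is a lower bound; one [m] for the whole disc
    results. *)
Lemma ev_lower_bound a : summableC a -> summableC (fpsD a) ->
  (forall x, normc x <= 1 -> ev a x != 0) ->
  exists2 m : R, 0 < m & forall x, normc x <= 1 -> m <= normc (ev a x).
Proof.
move=> sa [K aK] a0.
have K0 := l1_le_ge0 aK.
pose D := [set p : R * R | p.1 ^+ 2 + p.2 ^+ 2 <= 1].
have sq1 (x y : R) : x ^+ 2 + y ^+ 2 <= 1 -> x \in `[-1, 1].
  by move=> h; rewrite in_itv /= -ler_norml -(@ler_pXn2r _ 2)// ?nnegrE//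
    real_normK ?num_real// expr1n; have := sqr_ge0 y; lra.
have cD : compact D.
  refine (subclosed_compact _ (compact_setX
    (@segment_compact R (-1) 1) (@segment_compact R (-1) 1)) _).
  - rewrite (_ : D = (fun p : R * R => p.1 ^+ 2 + p.2 ^+ 2) @^-1` [set x | x <= 1])//.
    apply: preimage_closed; last exact: closed_le.
    move=> p _; apply: cvgD; rewrite /=.
    + by apply: (@continuous_comp _ _ _ fst (fun x : R => x ^+ 2));
        [exact: cvg_fst | exact: exprn_continuous].
    + by apply: (@continuous_comp _ _ _ snd (fun x : R => x ^+ 2));
        [exact: cvg_snd | exact: exprn_continuous].
  - by move=> [x y] /= h; split; [exact: (sq1 x y)|apply: (sq1 y x); rewrite addrC].
have Dnorm x y : D (x, y) -> normc (x +i* y) <= 1.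
  by rewrite /D /= => h; rewrite -sqrtr1 ler_wsqrtr.
move: cD => /compact_near_coveringP/near_covering_withinP.
move=> /(_ R (0:R)^'+ (fun m p => m <= normc (ev a (p.1 +i* p.2))) _).
case.
- move=> [x y] Dxy.
  pose v := normc (ev a (x +i* y)).
  have v0 : 0 < v by rewrite normc_gt0 a0// Dnorm.
  (* If both coordinates move by less than this radius, the point moves by at most
     [v / (2 * (K + 1))] and the value by at most [v / 2]; [K + 1] keeps the denominator
     positive. *)
  have d0 : 0 < v / (4 * (K + 1)) by rewrite divr_gt0//; lra.
  exists (ball (x, y) (v / (4 * (K + 1))), [set m | m < v / 2]).
    split => /=; first exact: nbhsx_ballx.
    by apply: nbhs_right_lt; lra.
  move=> [[x' y'] m] [[/= bx by_]] mv Dxy' /=.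
  have := ev_lipschitz sa aK (Dnorm _ _ Dxy) (Dnorm _ _ Dxy').
  have h1 : normc ((x +i* y) - (x' +i* y')) <= v / (2 * (K + 1)).
    apply: le_trans (normc_le_ReIm _) _ => /=.
    have -> : v / (2 * (K + 1)) = v / (4 * (K + 1)) + v / (4 * (K + 1)).
      by field; lra.
    by apply: lerD; apply: ltW.
  have h2 : K * normc ((x +i* y) - (x' +i* y')) <= v / 2.
    apply: (@le_trans _ _ (K * (v / (2 * (K + 1))))); first by rewrite ler_wpM2l.
    have -> : K * (v / (2 * (K + 1))) = v / 2 * (K / (K + 1)) by field; lra.
    by rewrite ler_piMr ?ler_pdivrMr; lra.
  have h3 : v - normc (ev a (x' +i* y')) <= normc (ev a (x +i* y) - ev a (x' +i* y')).
    exact: normcB_ge.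
  move: mv h2 h3 => /= mv h2 h3 h4; clearbody v.
  move: (normc (_ - _)) (K * _) (normc _) h2 h3 h4 => A1 A2 A3; lra.
- move=> e /= e0 he; exists (e / 2); first by lra.
  move=> [x y] xy1.
  have := he (e / 2); rewrite /= sub0r normrN ger0_norm; last by lra.
  have he2 : e / 2 < e by lra.
  have he3 : 0 < e / 2 by lra.
  move=> /(_ he2 he3 (x, y)); apply.
  have := normc_sqr (x +i* y) => /= h; rewrite /D /= -h.
  by rewrite exprn_ile1// ?normc_ge0//; exact: sqrtr_ge0.
Qed.

End MinimumModulus.

(** * A Wiener-type lemma for absolutely convergent Taylor series *)

Section WienerLemma.
Variable R : realType.
Implicit Types a b c : fps R.

Lemma fpsD_mul a b : fpsD (a * b) = fpsD a * b + a * fpsD b.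
Proof.
apply/funext => n; rewrite fpsDE /fpsD !fpsME mulr_sumr -big_split /=.
apply: eq_bigr => -[i iN] _ /=; rewrite ltnS in iN.
by rewrite -{1}(subnKC iN) natrD; ring.
Qed.

Lemma fpsD1 : fpsD 1 = 0 :> fps R.
Proof. by apply/funext => -[|n]; rewrite /fpsD fps1E ?mul0r ?mulr0. Qed.

Lemma fpsD_add a b : fpsD (a + b) = fpsD a + fpsD b.
Proof. by apply/funext => n; rewrite /fpsD !fpsDE mulrDr. Qed.

Lemma fpsD_inv a b : a * b = 1 -> fpsD b = - (fpsD a * b ^+ 2).
Proof.
move=> ab; have := fpsD_mul a b; rewrite ab fpsD1 => h.
have -> : fpsD b = (a * b) * fpsD b by rewrite ab mul1r.
have -> : a * b * fpsD b = b * (fpsD a * b + a * fpsD b) - fpsD a * b ^+ 2 by ring.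
by rewrite -h mulr0 sub0r.
Qed.

Lemma fpsDD_inv a b : a * b = 1 ->
  fpsD (fpsD b) = 2 * (fpsD a) ^+ 2 * b ^+ 3 - fpsD (fpsD a) * b ^+ 2.
Proof.
move=> ab; have Db := fpsD_inv ab.
have h : fpsD b + fpsD a * (b * b) = 0 by rewrite Db expr2; ring.
have := congr1 (@fpsD R) h.
rewrite fpsD_add !fpsD_mul => h2.
have -> : fpsD (fpsD b) = fpsD (fpsD b) +
   (fpsD (fpsD a) * (b * b) + fpsD a * (fpsD b * b + b * fpsD b))
   - (fpsD (fpsD a) * (b * b) + fpsD a * (fpsD b * b + b * fpsD b)) by ring.
rewrite h2 Db.
have -> : fpsD (0 : fps R) = 0 by apply/funext => n; rewrite /fpsD mulr0.
ring.
Qed.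

Definition dil (t : R) a : fps R := fun n => a n * (t%:C) ^+ n.

Lemma dilM t a b : dil t (a * b) = dil t a * dil t b.
Proof.
apply/funext => n; rewrite /dil !fpsME mulr_suml; apply: eq_bigr => -[i iN] _ /=.
by rewrite mulrACA -exprD subnKC.
Qed.

Lemma dil1 t : dil t 1 = 1.
Proof. by apply/funext => -[|n]; rewrite /dil fps1E ?mulr1 ?mul0r. Qed.

Lemma dil_one a : dil 1 a = a.
Proof. by apply/funext => n; rewrite /dil expr1n mulr1. Qed.

Lemma fpsD_dil t a : fpsD (dil t a) = dil t (fpsD a).
Proof. by apply/funext => n; rewrite /fpsD /dil mulrA. Qed.

Lemma ev_dil t a x : ev (dil t a) x = ev a (t%:C * x).
Proof. by congr csum; apply/funext => n; rewrite /dil exprMn mulrA. Qed.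

Lemma normc_unit_itv (t : R) : 0 <= t <= 1 -> normc t%:C <= 1.
Proof. by move=> /andP[t0 t1]; rewrite normcR ger0_norm. Qed.

Lemma l1_le_dil t a M : 0 <= t <= 1 -> l1_le a M -> l1_le (dil t a) M.
Proof. by move=> t01; apply: l1_le_pow; exact: normc_unit_itv. Qed.

Lemma sum_inv_sqr_le n : \sum_(i < n) (i.+1%:R * i.+2%:R)^-1 <= 1 :> R.
Proof.
suff -> : \sum_(i < n) (i.+1%:R * i.+2%:R)^-1 = 1 - n.+1%:R^-1 :> R.
  by rewrite lerBlDr lerDl invr_ge0.
elim: n => [|n IH]; first by rewrite big_ord0 invr1 subrr.
rewrite big_ord_recr /= IH -!natr1; field.
have h : 0 <= n%:R :> R by []. 
by apply/andP; split; apply: lt0r_neq0; lra.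
Qed.

(** [(n + 1)(n + 2)] is at most [8 (1 + n^2) / 2]-fold what is controlled, by [(n - 1)^2 >= 0]; the
    coefficients are thus dominated by the telescoping series of [sum_inv_sqr_le]. A single Euler
    derivative would only give a harmonic bound. *)
Lemma l1_le_of_fpsDD b S : (forall n, normc (b n) <= S) ->
  (forall n, normc (fpsD (fpsD b) n) <= S) -> l1_le b (8 * S).
Proof.
move=> h0 h2 m.
have S0 : 0 <= S by apply: le_trans (h0 0%N); exact: normc_ge0.
apply: (@le_trans _ _ (\sum_(i < m) 8 * S * (i.+1%:R * i.+2%:R)^-1)).
  apply: ler_sum => -[n _] _ /=.
  have n0 : 0 <= n%:R :> R by [].
  rewrite ler_pdivlMr ?mulr_gt0 ?ltr0n// -!natr1.
  have := h0 n; have := h2 n; rewrite /fpsD !normcM normc_nat.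
  have := normc_ge0 (b n); move: (normc _) (n%:R) n0 => B N N0 B0 h3 h4.
  have := mulr_ge0 B0 (sqr_ge0 (N - 1)); nra.
by rewrite -mulr_sumr ler_piMr ?mulr_ge0// sum_inv_sqr_le.
Qed.

(* The second derivative of 1/a is controlled by a, a', a'' and a lower bound
   of |a|, so the coefficient bound gives an a priori estimate of the l1 norm of
   1/a on every disc of radius t <= 1 on which 1/a is known to be summable;
   perturbation then enlarges t by a fixed step until t = 1. *)
Lemma wiener_inverse a : summableC a -> summableC (fpsD a) ->
  summableC (fpsD (fpsD a)) -> (forall x, normc x <= 1 -> ev a x != 0) ->
  exists2 b, a * b = 1 & summableC b.
Proof.
move=> sa sa1 sa2 a0.
have [m m0 hm] := ev_lower_bound sa sa1 a0.
move: (sa1) (sa2) => [K1 aK1] [K2 aK2].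
have [b ab] : exists b, a * b = 1.
  apply: fps_inv_ex; have := a0 0; rewrite normc0 => /(_ ler01).
  rewrite /ev (@csum_finite _ _ 1%N) ?big_ord1 ?mulr1//.
  by case=> // n _; rewrite exprS mul0r mulr0.
(* [m^-1] bounds the inverse on the disc, and the other two summands bound the two terms of
   [fpsDD_inv]. So [S] dominates the coefficients of the inverse and of its second Euler derivative,
   whatever the dilation. *)
pose S := m^-1 + 2 * K1 ^+ 2 * m^-1 ^+ 3 + K2 * m^-1 ^+ 2.
have K10 := l1_le_ge0 aK1; have K20 := l1_le_ge0 aK2.
have mV0 : 0 < m^-1 by rewrite invr_gt0.
have abt t : dil t a * dil t b = 1 by rewrite -dilM ab dil1.
have sdil t c : 0 <= t <= 1 -> summableC c -> summableC (dil t c).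
  by move=> t01 [M cM]; exists M; exact: l1_le_dil.
have apriori t : 0 <= t <= 1 -> summableC (dil t b) -> l1_le (dil t b) (8 * S).
  move=> t01 sb.
  have evb x : normc x <= 1 -> normc (ev (dil t b) x) <= m^-1.
    move=> x1.
    have tx1 : normc (t%:C * x) <= 1.
      by rewrite normcM mulr_ile1 ?normc_ge0// normc_unit_itv.
    have := evM x1 (sdil _ _ t01 sa) sb; rewrite abt ev1 => /(congr1 (@normc R)).
    rewrite normc1 normcM ev_dil => h.
    have := hm _ tx1; move: h (normc_ge0 (ev (dil t b) x)).
    move: (normc (ev a _)) (normc (ev _ x)) => A1 A2 h h1 h2.
    rewrite -[leRHS]mul1r ler_pdivlMr// h mulrC ler_wpM2r//.
  have s1 := sdil _ _ t01 sa1; have s2 := sdil _ _ t01 sa2.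
  have sq (c : fps R) : summableC c -> summableC (c ^+ 2).
    by move=> sc; exact: (summableCM sc sc).
  have s22 : summableC (2 : fps R).
    by refine (summableCD _ _); exists 1; exact: l1_le1.
  have sN : summableC (- (dil t (fpsD (fpsD a)) * dil t b ^+ 2)).
    have [M hM] := summableCM s2 (sq _ sb); by exists M; exact: l1_leN.
  have s3 : summableC (dil t b ^+ 3) by exact: (summableCM sb (sq _ sb)).
  have sP := summableCM (summableCM s22 (sq _ s1)) s3.
  have sDD : summableC (fpsD (fpsD (dil t b))).
    by rewrite (fpsDD_inv (abt t)) !fpsD_dil; exact: (summableCD sP sN).
  have m2 : 0 <= 2 * K1 ^+ 2 * m^-1 ^+ 3.
    by rewrite !mulr_ge0 ?exprn_ge0// ltW.
  have m3 : 0 <= K2 * m^-1 ^+ 2 by rewrite mulr_ge0 ?exprn_ge0// ltW.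
  apply: l1_le_of_fpsDD => n; apply: coef_le_sup => // x x1.
    apply: le_trans (evb x _) _; first by rewrite x1.
    by rewrite /S -addrA lerDl addr_ge0.
  have x1' : normc x <= 1 by rewrite x1.
  have e1 : normc (ev (dil t (fpsD a)) x) <= K1.
    by apply: ev_le => //; exact: l1_le_dil.
  have e2 : normc (ev (dil t (fpsD (fpsD a))) x) <= K2.
    by apply: ev_le => //; exact: l1_le_dil.
  have eb := evb x x1'.
  rewrite (fpsDD_inv (abt t)) !fpsD_dil.
  rewrite (evD x1' sP sN) (evN x1' (summableCM s2 (sq _ sb))).
  apply: le_trans (normcB_le _ _) _.
  rewrite (evM x1' (summableCM s22 (sq _ s1)) s3) (evM x1' s22 (sq _ s1)).
  rewrite (evM x1' s2 (sq _ sb)).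
  rewrite -[dil t b ^+ 3]/(dil t b * dil t b ^+ 2) (evM x1' sb (sq _ sb)) !expr2.
  rewrite (evM x1' s1 s1) (evM x1' sb sb) !normcM.
  have -> : ev (2 : fps R) x = 2.
    rewrite (evD x1') ?ev1//; by exists 1; exact: l1_le1.
  rewrite (normc_nat R 2) /S.
  apply: lerD.
    rewrite -[leLHS]add0r; apply: lerD; first exact: ltW.
    have -> : m^-1 ^+ 3 = m^-1 * (m^-1 * m^-1) by ring.
    by do ?[apply: ler_pM; rewrite ?mulr_ge0 ?normc_ge0 ?sqr_ge0//].
  by do ?[apply: ler_pM; rewrite ?mulr_ge0 ?normc_ge0 ?sqr_ge0//].
have S0 : 0 <= S.
  by rewrite /S !addr_ge0 ?mulr_ge0 ?exprn_ge0// ltW.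
(* A step from [j / J] to [(j + 1) / J] moves the dilated series by at most [K1 / J] in norm; [J] is
   large enough for the smallness condition of [inv_perturb] against the a priori bound [8 * S]. *)
pose J := (Num.truncn (K1 * (8 * S) * 2)).+1.
have J0 : 0 < J%:R :> R by rewrite ltr0n.
have hJ : K1 / J%:R * (8 * S) <= 2^-1.
  have : K1 * (8 * S) * 2 < J%:R by rewrite /J; exact: truncnS_gt.
  have -> : K1 / J%:R * (8 * S) = K1 * (8 * S) / J%:R by ring.
  by rewrite ler_pdivrMr//; lra.
have step j : (j <= J)%N -> summableC (dil (j%:R / J%:R) b).
  elim: j => [_|j IH jJ].
    (* Dilation by 0 leaves only the constant coefficient. *)
    exists (\sum_(i < 1) normc (dil (0%:R / J%:R) b i)).
    apply: l1_le_finite; case=> // n _.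
    by rewrite /dil mul0r exprS mul0r mulr0.
  have itv i : (i <= J)%N -> 0 <= (i%:R : R) / J%:R <= 1.
    by move=> iJ; rewrite divr_ge0//= ler_pdivrMr// mul1r ler_nat.
  have tj := itv j (ltnW jJ); have tj1 := itv _ jJ.
  have bj := apriori _ tj (IH (ltnW jJ)).
  set t := j%:R / J%:R in tj bj *; set t' := j.+1%:R / J%:R in tj1 *.
  pose e : fps R := dil t' a - dil t a.
  have le_e : l1_le e (K1 / J%:R).
    have : l1_le (fun n => (J%:R^-1)%:C * fpsD a n) (K1 / J%:R).
      have := l1_le_scale (J%:R^-1)%:C aK1.
      by rewrite normcR ger0_norm ?invr_ge0// mulrC.
    apply: l1_leS => n; rewrite /e fpsDE fpsNE /dil /fpsD -mulrBr !normcM.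
    rewrite [leRHS]mulrA [leRHS]mulrC ler_wpM2l ?normc_ge0//.
    apply: le_trans (subrX_le _ (normc_unit_itv tj1) (normc_unit_itv tj)) _.
    rewrite normc_nat [leRHS]mulrC ler_wpM2l// -rmorphB /= /t' /t -mulrBl -natrB// subSnn mul1r.
    by [].
  have [c hc cM] := inv_perturb (abt t) bj le_e hJ.
  (* Inverses are unique, so the summable [c] is the dilation of the formal inverse [b]. *)
  have -> : dil t' b = c.
    have hc' : dil t' a * c = 1 by rewrite -hc /e; congr (_ * _); ring.
    have -> : dil t' b = (dil t' a * c) * dil t' b by rewrite hc' mul1r.
    by rewrite mulrAC abt mul1r.
  by exists (2 * (8 * S)).
exists b => //.
by have := step J (leqnn J); rewrite divff ?gt_eqF// dil_one.
Qed.

End WienerLemma.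

(** * Entire series and division by a root *)

Section EntireSeries.
Variable R : realType.
Implicit Types a b f g : fps R.

Lemma l1_le_geometric a (M q : R) : 0 <= q < 1 ->
  (forall n, normc (a n) <= M * q ^+ n) -> l1_le a (M / (1 - q)).
Proof.
move=> /andP[q0 q1] h m.
have M0 : 0 <= M by have := h 0%N; rewrite expr0 mulr1; apply: le_trans; exact: normc_ge0.
apply: (@le_trans _ _ (\sum_(i < m) M * q ^+ i)); first by apply: ler_sum.
rewrite -mulr_sumr ler_wpM2l// -[leRHS]mul1r ler_pdivlMr ?subr_gt0//.
by rewrite mulrC -opprB mulNr -subrX1 opprB lerBlDr lerDl exprn_ge0.
Qed.

(** Infinite radius of convergence, stated through Cauchy estimates on single coefficients;
    summability at radius [r] follows from the estimate at [2 * r]. *)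
Definition entire a := forall r : R, 0 < r ->
  exists M, forall n, normc (a n) * r ^+ n <= M.

Lemma entire_pow_summable a (r : R) : entire a -> 0 < r ->
  exists M, forall n, \sum_(i < n) normc (a i) * r ^+ i <= M.
Proof.
move=> ea r0; have [|M hM] := ea (2 * r); first by rewrite mulr_gt0.
exists (M / (1 - 2^-1)) => n.
have : l1_le (fun i => a i * (r%:C) ^+ i) (M / (1 - 2^-1)).
  apply: l1_le_geometric; first by apply/andP; split; lra.
  move=> i; rewrite normcM normcX normcR gtr0_norm// exprVn ler_pdivlMr ?exprn_gt0//.
  by rewrite -mulrA -exprMn [r * 2]mulrC.
move=> /(_ n); under eq_bigr do rewrite normcM normcX normcR gtr0_norm//.
by [].
Qed.

Lemma entire_summable a : entire a -> summableC a.
Proof.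
move=> ea; have [M hM] := entire_pow_summable ea ltr01; exists M => n.
by have := hM n; under eq_bigr do rewrite expr1n mulr1.
Qed.

Lemma entire_fpsD a : entire a -> entire (fpsD a).
Proof.
move=> ea r r0; have [|M hM] := ea (2 * r); first by rewrite mulr_gt0.
exists M => n; apply: le_trans (hM n); rewrite /fpsD normcM normc_nat exprMn.
rewrite mulrCA [leLHS]mulrAC mulrC mulrCA mulrC -!mulrA.
rewrite [r ^+ n * _]mulrC !mulrA ler_wpM2r ?exprn_ge0 ?(ltW r0)//.
rewrite [leRHS]mulrC ler_wpM2r ?normc_ge0// -natrX ler_nat; exact/ltnW/ltn_expl.
Qed.

Lemma entireD a b : entire a -> entire b -> entire (a + b).
Proof.
move=> ea eb r r0; have [M hM] := ea r r0; have [N hN] := eb r r0.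
exists (M + N) => n; apply: le_trans (lerD (hM n) (hN n)).
by rewrite -mulrDl ler_wpM2r ?exprn_ge0 ?(ltW r0)// fpsDE normcD_le.
Qed.

Lemma entireCM k a : entire a -> entire (fpsC k * a).
Proof.
move=> ea r r0; have [M hM] := ea r r0; exists (normc k * M) => n.
by rewrite fpsCM normcM -mulrA ler_wpM2l ?normc_ge0.
Qed.

Lemma entireN a : entire a -> entire (- a).
Proof.
by move=> ea r r0; have [M hM] := ea r r0; exists M => n; rewrite fpsNE normc_opp.
Qed.

Lemma entireXM a : entire a -> entire (fpsX R * a).
Proof.
move=> ea r r0; have [M hM] := ea r r0; exists (r * M) => -[|n].
  rewrite fpsXM0 normc0 mul0r mulr_ge0 ?(ltW r0)//; apply: le_trans (hM 0%N).
  by rewrite mulr_ge0 ?normc_ge0.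
by rewrite fpsXMS exprS mulrCA ler_wpM2l ?(ltW r0).
Qed.

Lemma entire1 : entire (1 : fps R).
Proof.
move=> r r0; exists 1 => -[|n]; rewrite fps1E; first by rewrite normc_nat expr0 mulr1.
by rewrite normc_nat mul0r.
Qed.

Lemma entireX : entire (fpsX R).
Proof. by rewrite -(mulr1 (fpsX R)); apply: entireXM; exact: entire1. Qed.

(** Synthetic division makes the coefficients of the quotient multiples of the partial sums [S n] of
    [f] at [w]. As the full sum is 0, [S n] is also minus a tail, and therefore decays as fast as
    the coefficients of [f]. *)
Lemma entire_div_root f w : entire f -> normc w = 1 -> ev f w = 0 ->
  exists2 g, entire g & f = (fpsX R - fpsC w) * g.
Proof.
move=> ef w1 fw.
have w0 : w != 0 by rewrite -normc_gt0 w1.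
pose S n := \sum_(i < n) f i * w ^+ i.
exists (fun n => - (w ^- n.+1 * S n.+1)); last first.
  apply/funext => -[|n]; rewrite mulrBl fpsDE fpsNE fpsCM.
    by rewrite fpsXM0 /S big_ord1 expr1 expr0 mulr1 sub0r mulrN opprK mulrA divff// mul1r.
  rewrite fpsXMS mulrN opprK /S [in X in _ + X]big_ord_recr /=.
  have := expf_neq0 n.+1 w0; rewrite (exprS w n.+1).
  move: (w ^+ n.+1) (\sum_(i < n.+1) _) => P T P0.
  by field; rewrite w0 P0.
move=> r r0.
(* A radius at least 1 is needed for [r ^+ n <= r' ^+ i] at all [i > n]. *)
pose r' := Num.max r 1.
have r'1 : 1 <= r' by rewrite le_max lexx orbT.
have r'r : r <= r' by rewrite le_max lexx.
have r'0 : 0 < r' by apply: lt_le_trans r'1.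
have [B hB] := entire_pow_summable ef r'0.
exists (B + 1) => n.
rewrite normc_opp normcM normcV normcX w1 expr1n invr1 mul1r.
have rn0 : 0 < r ^+ n by rewrite exprn_gt0.
have := evP (x := w) _ (entire_summable ef); rewrite w1 lexx fw => /(_ isT).
(* The infinite tail is cut at an index where the partial sum is below [r ^- n]: the block before
   the cut contributes [B], the remainder contributes 1. *)
move=> /cvgC_normcP/(_ (r ^+ n)^-1); rewrite invr_gt0 => /(_ rn0)[m _ hm].
pose m' := maxn m n.+1.
have nm' : (n.+1 <= m')%N by exact: leq_maxr.
have := hm m' (leq_maxl _ _); rewrite /series /= sub0r normc_opp big_mkord -/(S m').
move=> h1.
have h2 : normc (S m' - S n.+1) * r ^+ n <= B.
  rewrite /S (sumrB_ord (fun i => f i * w ^+ i) nm').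
  apply: (@le_trans _ _ (\sum_(n.+1 <= i < m') normc (f i) * r' ^+ i)); last first.
    rewrite -(sumrB_ord (fun i => normc (f i) * r' ^+ i) nm').
    apply: le_trans (hB m'); rewrite lerBlDr lerDl sumr_ge0// => i _.
    by rewrite mulr_ge0 ?normc_ge0 ?exprn_ge0// ltW.
  apply: (@le_trans _ _ (\sum_(n.+1 <= i < m') normc (f i) * r ^+ n)).
    rewrite -mulr_suml ler_wpM2r ?(ltW rn0)//; apply: le_trans (normc_sum _ _ _) _.
    by apply: ler_sum => i _; rewrite normcM normcX w1 expr1n mulr1.
  rewrite big_nat_cond [leRHS]big_nat_cond; apply: ler_sum => i /andP[/andP[ni _] _].
  rewrite ler_wpM2l ?normc_ge0//; apply: (@le_trans _ _ (r' ^+ n)).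
    by rewrite lerXn2r ?nnegrE// ltW.
  by rewrite ler_weXn2l// ltnW.
have h3 : normc (S n.+1) <= normc (S m' - S n.+1) + normc (S m').
  have -> : S n.+1 = S m' - (S m' - S n.+1) by ring.
  by apply: le_trans (normcB_le _ _) _; rewrite addrC; rewrite subKr.
have h4 : normc (S m') * r ^+ n <= 1.
  by rewrite -ler_pdivlMr// mul1r ltW.
by apply: le_trans (lerD h2 h4); rewrite -mulrDl ler_wpM2r// ltW.
Qed.

(** In the product rule the term that keeps the factor [X - w] vanishes at [w]. This gives the value
    of the quotient at the root, where it is not a plain division. *)
Lemma ev_fpsD_root f g w : normc w = 1 -> entire g ->
  f = (fpsX R - fpsC w) * g -> ev (fpsD f) w = w * ev g w.
Proof.
move=> w1 eg ->.
have w1' : normc w <= 1 by rewrite w1.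
have sX : summableC (fpsX R) by exists 1; exact: l1_leX.
have sC : summableC (- fpsC w) by exists (normc w); apply: l1_leN; exact: l1_leC.
have sg := entire_summable eg.
have sDg := entire_summable (entire_fpsD eg).
have -> : fpsD ((fpsX R - fpsC w) * g) =
    fpsX R * g + (fpsX R - fpsC w) * fpsD g.
  rewrite fpsD_mul; congr (_ * _ + _).
  apply/funext => n; rewrite /fpsD fpsDE fpsNE /fpsC /fpsX.
  by case: n => [|[|n]]; rewrite ?mul0r ?mulr0 ?mul1r ?mulr1 ?subr0 ?mulr0 ?mul1r.
have sXC := summableCD sX sC.
rewrite (evD w1' (summableCM sX sg) (summableCM sXC sDg)) (evM w1' sX sg).
rewrite (evM w1' sXC sDg) (evD w1' sX sC) (evN w1') ?evC ?evX ?subrr ?mul0r ?addr0//.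
by exists (normc w); exact: l1_leC.
Qed.

End EntireSeries.

(** * The exponential as a power series *)

Section ComplexExponential.
Variable R : realType.
Implicit Types z w : R[i].

Lemma mulCE (a b c d : R) :
  (a +i* b) * (c +i* d) = (a * c - b * d) +i* (a * d + b * c).
Proof. by []. Qed.

Lemma addCE (a b c d : R) : (a +i* b) + (c +i* d) = (a + c) +i* (b + d).
Proof. by []. Qed.

(** Read as a series in [x], the coefficients of [e^(z x)]; read as a plain sequence, the terms of
    [e^z], for which the Cauchy product is the binomial theorem. Both readings are used. *)
Definition fps_exp z : fps R := fun n => z ^+ n / n`!%:R.

Lemma l1_le_exp z : l1_le (fps_exp z) (expR (normc z)).
Proof.
move=> n.
have -> : \sum_(i < n) normc (fps_exp z i) = series (exp_coeff (normc z)) n.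
  rewrite /series /= big_mkord; apply: eq_bigr => i _.
  by rewrite /fps_exp /exp_coeff /= normcM normcV normcX normc_nat.
rewrite /expR; apply: nondecreasing_cvgn_le; last exact: is_cvg_series_exp_coeff.
apply: nondecreasing_series => i _ _.
by rewrite /exp_coeff /= divr_ge0 ?exprn_ge0 ?normc_ge0.
Qed.

Lemma summable_exp z : summableC (fps_exp z).
Proof. by exists (expR (normc z)); exact: l1_le_exp. Qed.

Lemma fps_expD z w : fps_exp (z + w) = fps_exp z * fps_exp w.
Proof.
apply/funext => n; rewrite fpsME /fps_exp addrC exprDn mulr_suml.
apply: eq_bigr => i _.
have iN : (i <= n)%N by rewrite -ltnS.
have := bin_fact iN => /(congr1 (fun k => k%:R : R[i])); rewrite !natrM => h.
have f0 k : k`!%:R != 0 :> R[i] by rewrite pnatr_eq0 -lt0n fact_gt0.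
rewrite -mulr_natr -h.
have b0 : 'C(n, i)%:R != 0 :> R[i] by rewrite pnatr_eq0 -lt0n bin_gt0.
by field; rewrite !f0 b0.
Qed.

Lemma csum_expD z w : csum (fps_exp (z + w)) = csum (fps_exp z) * csum (fps_exp w).
Proof. by rewrite fps_expD csumM//; exact: summable_exp. Qed.

Lemma csum_exp_real (x : R) : csum (fps_exp x%:C) = (expR x)%:C.
Proof.
apply: csum_unique.
have E n : series (fps_exp x%:C : nat -> R[i]^o) n = (series (exp_coeff x) n)%:C.
  rewrite /series /= raddf_sum /=; apply: eq_bigr => i _.
  by rewrite /fps_exp /exp_coeff /= rmorphM fmorphV rmorphXn rmorph_nat.
apply: cvgC_ReIm.
  under eq_fun do rewrite E /=; exact: is_cvg_series_exp_coeff.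
by under eq_fun do rewrite E /=; exact: cvg_cst.
Qed.

Lemma expr_i_double n : (0 +i* 1 : R[i]) ^+ n.*2 = ((-1) ^+ n)%:C.
Proof. by rewrite -mul2n exprM sqr_i rmorphXn /= rmorphN1. Qed.

Lemma csum_exp_imag (y : R) : csum (fps_exp (0 +i* y)) = cos y +i* sin y.
Proof.
have yE : 0 +i* y = (0 +i* 1) * y%:C :> R[i] 
  by rewrite mulCE !(mul0r, mulr0, mul1r, subr0, addr0, add0r, oppr0).
have E n : fps_exp (0 +i* y) n = cos_coeff y n +i* sin_coeff y n.
  rewrite /fps_exp /cos_coeff /sin_coeff yE exprMn.
  have -> : y%:C ^+ n = (y ^+ n)%:C by rewrite rmorphXn.
  rewrite -(rmorph_nat (real_complex R)) -fmorphV -mulrA -rmorphM /=.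
  rewrite -(odd_double_half n); case: (odd n) => /=.
    rewrite add1n exprS expr_i_double odd_double doubleK /=.
    rewrite mulCE !(mul0r, mulr0, mul1r, subr0, sub0r, addr0, add0r, oppr0).
    by congr (_ +i* _); ring.
  rewrite add0n expr_i_double odd_double doubleK /= -exprnP.
  rewrite mulCE !(mul0r, mulr0, mul1r, subr0, sub0r, addr0, add0r, oppr0).
  by congr (_ +i* _); ring.
apply: csum_unique; apply: cvgC_ReIm.
  rewrite (_ : (fun _ => _) = series (cos_coeff y)).
    by rewrite unlock; exact: is_cvg_series_cos_coeff.
  apply/funext => n; rewrite /series /=.
  rewrite (raddf_sum (@complex.Re R : {additive Rcomplex R -> R})) /=.
  by apply: eq_bigr => i _; rewrite E.
rewrite (_ : (fun _ => _) = series (sin_coeff y)).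
  by rewrite unlock; exact: is_cvg_series_sin_coeff.
apply/funext => n; rewrite /series /=.
rewrite (raddf_sum (@complex.Im R : {additive Rcomplex R -> R})) /=.
by apply: eq_bigr => i _; rewrite E.
Qed.

Lemma csum_exp z : csum (fps_exp z) = cexp z.
Proof.
case: z => x y; have -> : x +i* y = x%:C + 0 +i* y :> R[i].
  by rewrite addCE addr0 add0r.
rewrite csum_expD csum_exp_real csum_exp_imag /cexp /= addr0 add0r.
by rewrite mulCE !mul0r subr0 addr0.
Qed.

Lemma cexpD z w : cexp (z + w) = cexp z * cexp w.
Proof. by rewrite -!csum_exp csum_expD. Qed.

Lemma ev_exp z x : ev (fps_exp z) x = cexp (z * x).
Proof.
rewrite -csum_exp /ev; congr csum; apply/funext => n.
by rewrite /fps_exp exprMn mulrAC.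
Qed.

Lemma entire_exp z : entire (fps_exp z).
Proof.
move=> r r0; exists (expR (normc (z * r%:C))) => n.
apply: le_trans (l1_le_coef n (l1_le_exp _)).
rewrite /fps_exp !normcM exprMn normcM [X in _ <= _ * X * _]normcX normcR gtr0_norm//.
by rewrite mulrAC.
Qed.

Lemma fpsD_exp z : fpsD (fps_exp z) = fpsC z * (fpsX R * fps_exp z).
Proof.
apply/funext => -[|n]; rewrite fpsCM /fpsD; first by rewrite fpsXM0 mul0r mulr0.
rewrite fpsXMS /fps_exp exprS factS natrM.
have f0 : n`!%:R != 0 :> R[i] by rewrite pnatr_eq0 -lt0n fact_gt0.
have n0 : n.+1%:R != 0 :> R[i] by rewrite pnatr_eq0.
by move: (n.+1%:R) (n`!%:R) n0 f0 => N F N0 F0; field; rewrite N0 F0.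
Qed.

End ComplexExponential.

(** * The zeros of [t + z + e^-z] for real [t >= 0] *)

Section LambertPoint.
Variable R : realType.
Implicit Types a b x y : R.

Lemma derive_lt0_decreasing (f df : R -> R) x y : x < y ->
  (forall z, x <= z <= y -> is_derive z 1 f (df z)) ->
  (forall z, x < z < y -> df z < 0) -> f y < f x.
Proof.
move=> xy hd hn.
have hc : {within `[x, y], continuous f}.
  apply: derivable_within_continuous => z; rewrite in_itv /= => zxy.
  by have := hd z zxy => hz; exact: ex_derive.
have hd' z : z \in `]x, y[%R -> is_derive z 1 f (df z).
  by rewrite in_itv /= => /andP[xz zy]; apply: hd; rewrite !ltW.
have [c] := MVT xy hd' hc.
rewrite in_itv /= => cxy h.
by rewrite -subr_lt0 h nmulr_rlt0 ?subr_gt0// hn.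
Qed.

Lemma mul_cos_lt_sin b : 0 < b < pi -> b * cos b < sin b.
Proof.
move=> /andP[b0 bpi]; rewrite -subr_lt0.
have -> : 0 = 0 * cos 0 - sin 0 :> R by rewrite sin0 mul0r subr0.
apply: (@derive_lt0_decreasing (fun x => x * cos x - sin x)
  (fun x => - (x * sin x)) _ _ b0).
  move=> z _; apply: is_derive_eq; rewrite /GRing.scale /=; ring.
move=> z /andP[z0 zb]; rewrite oppr_lt0 mulr_gt0// sin_gt0_pi// z0/=.
exact: lt_trans bpi.
Qed.

(** For a zero [x + i y] of [t + z + e^-z] with [0 < y < pi], the imaginary part of the equation
    gives [x = ln (sin y / y)], and the real part then reads [t = - lambert_phi y]. Both functions
    decrease on that interval. *)
Definition ln_sinc b := ln (sin b) - ln b.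
Definition lambert_phi b := b * cos b / sin b + ln_sinc b.

Lemma is_derive_ln_sinc b : 0 < b < pi ->
  is_derive b 1 ln_sinc (cos b / sin b - b^-1).
Proof.
move=> hb; have sb := sin_gt0_pi hb; move: hb => /andP[b0 _].
have h1 := @is_derive1_ln R _ b0.
have h2 := @is_derive1_comp R (@ln R) (@sin R) b _ _ (@is_derive1_ln R _ sb) (is_derive_sin b).
apply: (@is_derive_eq _ _ _ (@ln R \o @sin R - @ln R)).
by rewrite /GRing.scale /= mulrC.
Qed.

Lemma is_derive_lambert_phi b : 0 < b < pi ->
  is_derive b 1 lambert_phi (2 * cos b / sin b - b / sin b ^+ 2 - b^-1).
Proof.
move=> hb; have sb := sin_gt0_pi hb.
have sb0 := lt0r_neq0 sb.
have h1 := is_derive_ln_sinc hb.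
have h2 : is_derive b 1 (fun x => (sin x)^-1) (- (sin b) ^- 2 *: cos b).
  exact: is_deriveV.
apply: (@is_derive_eq _ _ _ ((fun x => x * cos x) * (fun x => (sin x)^-1) + ln_sinc)).
move: hb => /andP[b0 _]; have b0' := lt0r_neq0 b0.
rewrite /GRing.scale /=.
have := cos2Dsin2 b; set c := cos b; set s := sin b => cs.
have -> : b / s ^+ 2 = b * (c ^+ 2 + s ^+ 2) / s ^+ 2 by rewrite cs mulr1.
by field; rewrite sb0 b0'.
Qed.

Lemma ln_sinc_decreasing x y : 0 < x -> x < y -> y < pi -> ln_sinc y < ln_sinc x.
Proof.
move=> x0 xy ypi; apply: (derive_lt0_decreasing xy) => z /andP[xz zy].
  by apply: is_derive_ln_sinc; rewrite (lt_le_trans x0 xz) (le_lt_trans zy ypi).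
have z0 := lt_trans x0 xz; have zpi := lt_trans zy ypi.
have hz : 0 < z < pi by rewrite z0.
have sz := sin_gt0_pi hz.
rewrite subr_lt0 ltr_pdivrMr// mulrC ltr_pdivlMr// mulrC; exact: mul_cos_lt_sin.
Qed.

Lemma lambert_phi_decreasing x y : 0 < x -> x < y -> y < pi ->
  lambert_phi y < lambert_phi x.
Proof.
move=> x0 xy ypi; apply: (derive_lt0_decreasing xy) => z /andP[xz zy].
  by apply: is_derive_lambert_phi; rewrite (lt_le_trans x0 xz) (le_lt_trans zy ypi).
have z0 := lt_trans x0 xz; have zpi := lt_trans zy ypi.
have hz : 0 < z < pi by rewrite z0.
have sz := sin_gt0_pi hz.
have z0' := lt0r_neq0 z0; have sz' := lt0r_neq0 sz.
(* Completing the square in [z^2 - 2 z sin z cos z + sin^2 z] makes the sign visible. *)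
have -> : 2 * cos z / sin z - z / sin z ^+ 2 - z^-1 =
    - ((z - sin z * cos z) ^+ 2 + sin z ^+ 2 * (1 - cos z ^+ 2)) / (z * sin z ^+ 2).
  by field; rewrite z0' sz'.
rewrite mulNr oppr_lt0 divr_gt0 ?mulr_gt0 ?exprn_gt0//.
by rewrite -sin2cos2 ltr_wpDl ?sqr_ge0// mulr_gt0 ?exprn_gt0.
Qed.

Lemma pihalf_gt1 : 1 < pi / 2 :> R.
Proof.
rewrite lt_neqAle pihalf_ge1 andbT; apply/eqP => h.
by have := @cos1_gt0 R; rewrite h cos_pihalf ltxx.
Qed.

Lemma lambert_point_ex : exists2 b : R, 1 <= b <= pi / 2 & lambert_phi b = 0.
Proof.
have p1 := pihalf_gt1.
have pilt : pi / 2 < pi :> R by have := @pi_gt0 R; lra.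
have s1 : 0 < sin 1 :> R by apply: sin2_gt0; apply/andP; split; lra.
have c1 := @cos1_gt0 R.
have hc : {within `[1, pi / 2], continuous lambert_phi}.
  apply: derivable_within_continuous => z; rewrite in_itv /= => /andP[z1 z2].
  have hz : 0 < z < pi by apply/andP; split; lra.
  by have := is_derive_lambert_phi hz => h; exact: ex_derive.
(* From [ln y <= y - 1] at [y = 1 / sin 1], together with [cos 1 + sin 1 > 1]. *)
have phi1 : 0 < lambert_phi 1.
  rewrite /lambert_phi /ln_sinc ln1 subr0 mul1r.
  have : ln ((sin 1)^-1 : R) <= (sin 1)^-1 - 1.
    have := @le_ln1Dx R ((sin 1)^-1 - 1).
    have -> : 1 + ((sin 1)^-1 - 1) = (sin 1)^-1 :> R by ring.
    apply; have : 0 < (sin 1)^-1 :> R by rewrite invr_gt0.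
    lra.
  rewrite lnV ?posrE// => h.
  have : 0 < (cos 1 + sin 1 - 1) / sin 1 :> R.
    rewrite divr_gt0// subr_gt0 -(@ltr_pXn2r _ 2)// ?nnegrE ?addr_ge0 ?(ltW c1) ?(ltW s1)//.
    rewrite sqrrD expr1n addrAC cos2Dsin2 ltrDl.
    by rewrite pmulrn_lgt0// mulr_gt0.
  have -> : (cos 1 + sin 1 - 1) / sin 1 = cos 1 / sin 1 + 1 - (sin 1)^-1 :> R.
    by field; exact: lt0r_neq0.
  lra.
have phi2 : lambert_phi (pi / 2) < 0.
  rewrite /lambert_phi /ln_sinc cos_pihalf sin_pihalf mulr0 mul0r add0r ln1 sub0r.
  by rewrite oppr_lt0 ln_gt0.
have [||b hb hb0] := @IVT R lambert_phi 1 (pi / 2) 0 _ hc.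
- by rewrite ltW.
- by rewrite ge_min (ltW phi2) orbT le_max (ltW phi1).
by exists b => //; move: hb; rewrite in_itv.
Qed.

(** Such a [b] is the imaginary part of [W_0(-1)], about 1.337. The bounds put it between [pi / 4]
    and [pi / 2], hence [0 < cos b < sin b] and [- b < a <= 0]. *)
Definition is_lambert_pt (b : R) := [/\ 1 <= b, b < pi / 2 & lambert_phi b = 0].

Lemma is_lambert_pt_ex : exists b, is_lambert_pt b.
Proof.
have [b /andP[b1 b2] hb] := lambert_point_ex; exists b; split => //.
rewrite lt_neqAle b2 andbT; apply/eqP => hb2.
move: hb; rewrite hb2 /lambert_phi /ln_sinc cos_pihalf sin_pihalf mulr0 mul0r add0r.
rewrite ln1 sub0r => /eqP; rewrite oppr_eq0 gt_eqF//.
exact: ln_gt0 pihalf_gt1.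
Qed.

Variable b : R.
Hypothesis hb : is_lambert_pt b.
Let a := ln_sinc b.

Let b_itv : 0 < b < pi.
Proof.
by case: hb => b1 b2 _; have := pi_gt0 R => p0; apply/andP; split; lra.
Qed.

Let sb : 0 < sin b. Proof. exact: sin_gt0_pi. Qed.

Lemma lambert_aE : a = - (b * cos b / sin b).
Proof.
by case: hb => _ _ /eqP; rewrite /lambert_phi addrC addr_eq0 => /eqP.
Qed.

(** The first inequality keeps the disc of radius |W| inside the strip [|Im z| < pi], where
    [lambert_eq_pos] applies; the second becomes the positivity of [be], i.e. that the perturbed
    roots move outwards. *)
Lemma lambert_norm_lt_pi : a ^+ 2 + b ^+ 2 < pi ^+ 2 /\ a + a ^+ 2 < b ^+ 2.
Proof.
case: (hb) => b1 b2 _; have p2 := pihalf_gt1; have p3 := @pihalf_lt2 R.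
have p0 := pi_gt0 R.
have cb : 0 < cos b by apply: cos_gt0_pihalf; apply/andP; split; lra.
have csb : cos b < sin b.
  have -> : sin b = cos (b - pi / 2) by rewrite cosBpihalf.
  have -> : cos (b - pi / 2) = cos (pi / 2 - b) by rewrite -cosN opprB.
  by rewrite ltr_cos ?in_itv /=; [lra | apply/andP; split; lra | apply/andP; split; lra].
have a0 : a <= 0.
  by rewrite lambert_aE oppr_le0 divr_ge0 ?mulr_ge0 ?(ltW cb) ?(ltW sb)//; lra.
have ab : - a < b.
  rewrite lambert_aE opprK ltr_pdivrMr// ltr_pM2l//; lra.
have a2 : a ^+ 2 < b ^+ 2 by rewrite -[a ^+ 2]sqrrN ltr_pXn2r ?nnegrE//; lra.
split; last lra.
have : b ^+ 2 < (pi / 2) ^+ 2 by rewrite ltr_pXn2r ?nnegrE//; lra.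
rewrite [(pi / 2) ^+ 2]exprMn.
have := exprn_gt0 2 p0; lra.
Qed.

Lemma cexp_eq_re_im (x y t : R) : t%:C + (x +i* y) + cexp (- (x +i* y)) = 0 ->
  t + x + expR (- x) * cos y = 0 /\ y = expR (- x) * sin y.
Proof.
rewrite /cexp /= cosN sinN mulrN.
move=> [h1 h2]; split; first by rewrite -h1.
by apply/eqP; rewrite -subr_eq0; apply/eqP; rewrite -[RHS]h2 add0r.
Qed.

Lemma lambert_eq_pos (x y t : R) : 0 < y < pi ->
  t + x + expR (- x) * cos y = 0 -> y = expR (- x) * sin y ->
  x = ln_sinc y /\ t = - lambert_phi y.
Proof.
move=> hy h1 h2; have sy := sin_gt0_pi hy; have sy0 := lt0r_neq0 sy.
have E : expR (- x) = y / sin y by rewrite {1}h2 mulfK.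
have xE : x = ln_sinc y.
  move: hy => /andP[y0 _].
  have := congr1 (@ln R) E; rewrite expRK ln_div ?posrE// => h.
  by rewrite /ln_sinc; lra.
split=> //; move: h1; rewrite E /lambert_phi -xE => h1.
have -> : y * cos y / sin y = y / sin y * cos y by rewrite mulrAC.
lra.
Qed.

(** For [0 < y < pi], [t = - lambert_phi y >= 0] forces [y >= b], and [y > b] would give
    [x < a <= 0], outside the disc. Conjugation covers [y < 0]; on the real axis [x + e^-x >= 1]. *)
Lemma lambert_zero_unique (x y t : R) : 0 <= t ->
  x ^+ 2 + y ^+ 2 <= a ^+ 2 + b ^+ 2 ->
  t%:C + (x +i* y) + cexp (- (x +i* y)) = 0 ->
  t = 0 /\ ((x +i* y) = (a +i* b) \/ (x +i* y) = (a -i* b)).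
Proof.
move=> t0 hxy /cexp_eq_re_im[h1 h2].
have [hpi _] := lambert_norm_lt_pi.
have [b1 b2 phib] := hb.
have main z : 0 < z -> z ^+ 2 = y ^+ 2 ->
    t + x + expR (- x) * cos z = 0 -> z = expR (- x) * sin z ->
    [/\ t = 0, x = a & z = b].
  move=> z0 zy g1 g2.
  have zpi : z < pi.
    rewrite -(@ltr_pXn2r _ 2)// ?nnegrE ?(ltW z0) ?pi_ge0// zy.
    by have := sqr_ge0 x; lra.
  have hz : 0 < z < pi by rewrite z0.
  have [xE tE] := lambert_eq_pos hz g1 g2.
  have bz : b <= z.
    rewrite leNgt; apply/negP => zb.
    have := lambert_phi_decreasing z0 zb; move: b_itv => /andP[_ bpi] /(_ bpi).
    by rewrite phib; lra.
  have zb : z = b.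
    apply/eqP; rewrite eq_sym eq_le bz /= leNgt; apply/negP => bz'.
    have xa : x < a by rewrite xE /a; apply: ln_sinc_decreasing => //; case/andP: b_itv.
    have a0 : a <= 0.
      have cb : 0 < cos b.
        by apply: cos_gt0_pihalf; have := pihalf_gt1; move=> ?; apply/andP; split; lra.
      rewrite lambert_aE oppr_le0 divr_ge0 ?mulr_ge0 ?(ltW cb) ?(ltW sb)//; lra.
    have : a ^+ 2 < x ^+ 2 by rewrite -[a ^+ 2]sqrrN -[x ^+ 2]sqrrN ltr_pXn2r ?nnegrE//; lra.
    have : b ^+ 2 < y ^+ 2 by rewrite -zy ltr_pXn2r ?nnegrE//; lra.
    lra.
  by split=> //; [rewrite tE zb phib oppr0 | rewrite xE zb].
case: (ltgtP y 0) => y0.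
- have [||||-> -> hbz] := main (- y).
  + by rewrite oppr_gt0.
  + by rewrite sqrrN.
  + by rewrite cosN.
  + by rewrite sinN mulrN -h2.
  by split=> //; right; rewrite -hbz opprK.
- have [//|//|//|//|-> -> ->] := main y; by split=> //; left.
- exfalso; move: h1; rewrite y0 cos0 mulr1.
  by have := expR_ge1Dx (- x); lra.
Qed.

Lemma lambert_sol : (a +i* b) + cexp (- (a +i* b)) = 0.
Proof.
have E : expR (- a) = b / sin b.
  rewrite expRN /a /ln_sinc expRB !lnK ?posrE ?invf_div//.
  by case/andP: b_itv.
rewrite /cexp /= cosN sinN E mulrN divfK ?lt0r_neq0// /GRing.add /=.
congr (_ +i* _); rewrite ?subrr// lambert_aE mulrAC.
by rewrite addrC subrr.
Qed.

End LambertPoint.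

(** * The values at -1 of the two branches *)

Section LambertBranches.
Variable R : realType.

Lemma cexp0 : cexp 0 = 1 :> R[i].
Proof. by rewrite /cexp /= expR0 cos0 sin0 mulr1 mulr0. Qed.

Lemma cexp_conj (z : R[i]) : cexp z^*%C = (cexp z)^*%C.
Proof. by case: z => x y; rewrite /cexp /= cosN sinN mulrN. Qed.

Lemma mul_cexp_eqN1 (w : R[i]) : w * cexp w = -1 <-> w + cexp (- w) = 0.
Proof.
have E : cexp w * cexp (- w) = 1 by rewrite -cexpD subrr cexp0.
split=> [h|/eqP].
  have h2 : w = - cexp (- w) by rewrite -[LHS]mulr1 -E mulrA h mulN1r.
  by rewrite {1}h2 addNr.
by rewrite addr_eq0 => /eqP h; rewrite {1}h mulNr mulrC E.
Qed.

(* The equation forces Re w = - Im w cot (Im w), i.e. w lies on the curve that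
   bounds the range of the principal branch. *)
Lemma mul_cexp_eqN1_curve (x y : R) : (x +i* y) * cexp (x +i* y) = -1 ->
  [/\ y != 0, sin y != 0, x = lambert_curve y, y = expR (- x) * sin y &
      x + expR (- x) * cos y = 0].
Proof.
move=> /mul_cexp_eqN1 h.
have /cexp_eq_re_im[h1 h2] : 0%:C + (x +i* y) + cexp (- (x +i* y)) = 0.
  by rewrite -[RHS]h add0r.
rewrite add0r in h1.
have y0 : y != 0.
  apply/eqP => y0; move: h1; rewrite y0 cos0 mulr1.
  by have := expR_ge1Dx (- x); lra.
have s0 : sin y != 0.
  by apply: contra y0 => /eqP s0; rewrite h2 s0 mulr0.
split=> //; rewrite /lambert_curve.
have -> : y * cos y / sin y = expR (- x) * cos y.
  by rewrite {1}h2 mulrAC mulfK.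
lra.
Qed.

Variable b : R.
Hypothesis hb : is_lambert_pt b.
Let a := ln_sinc b.

Let b_itv : 0 < b < pi.
Proof.
by case: hb => b1 b2 _; have := pi_gt0 R => p0; apply/andP; split; lra.
Qed.

Lemma lambert_pt_pos (x y : R) : 0 < y < pi ->
  (x +i* y) * cexp (x +i* y) = -1 -> x +i* y = a +i* b.
Proof.
move=> hy /mul_cexp_eqN1_curve[_ _ _ h2 h1].
have [|xE tE] := @lambert_eq_pos R x y 0 hy _ h2; first by rewrite add0r.
suff yb : y = b by rewrite xE yb.
move: (hb) (hy) (b_itv) => [_ _ phib] /andP[y0 ypi] /andP[b0 bpi].
have [yb|yb|//] := ltgtP y b.
  by have := lambert_phi_decreasing y0 yb bpi; lra.
by have := lambert_phi_decreasing b0 yb ypi; lra.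
Qed.

Lemma lambert_pt_neg (x y : R) : 0 < - y < pi ->
  (x +i* y) * cexp (x +i* y) = -1 -> x +i* y = a -i* b.
Proof.
move=> hy h.
have [-> <-] : x +i* (- y) = a +i* b; last by rewrite opprK.
apply: lambert_pt_pos => //.
have -> : x +i* (- y) = (x +i* y)^*%C by [].
by rewrite cexp_conj -rmorphM h rmorphN1.
Qed.

Lemma lambert_pt_sol : (a +i* b) * cexp (a +i* b) = -1.
Proof. by apply/mul_cexp_eqN1; exact: lambert_sol. Qed.

Lemma lambert_pt_sol_conj : (a -i* b) * cexp (a -i* b) = -1.
Proof.
have -> : a -i* b = (a +i* b)^*%C by [].
by rewrite cexp_conj -rmorphM lambert_pt_sol rmorphN1.
Qed.

(** The two candidate points lie exactly on separating curves, so strictness decides: the upper one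
    is not strictly beyond its curve and stays in the range of [W_0], while the lower one satisfies
    the non-strict inequality and falls to [W_(-1)]. *)
Lemma lambertW0_N1 : lambertW 0 (-1) = a +i* b.
Proof.
apply: xget_unique => [|w [wE [nA nB]]].
  split; first exact: lambert_pt_sol.
  move: b_itv => /andP[b0 bpi].
  have := mul_cexp_eqN1_curve lambert_pt_sol => -[_ _ ac _ _].
  split=> /=; last left; rewrite /lambert_above /lambert_below /=.
    move=> [|[_]]; first by rewrite mul1r leNgt bpi.
    by rewrite -ac ltxx.
  move=> [|[/andP[_]]|[_ b0' _]].
  - by rewrite mul1r => h; lra.
  - by rewrite mul0r oppr0 => h; lra.
  - by move: b0; rewrite b0' ltxx.
case: w => x y in wE nA nB *.
have [y0 s0 xc h2 h1] := mul_cexp_eqN1_curve wE.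
apply: lambert_pt_pos => //.
have ypi : y < pi by rewrite ltNge; apply/negP => h; apply: nA; left; rewrite /= mul1r.
rewrite ypi andbT lt_neqAle eq_sym y0 /= leNgt; apply/negP => yn.
(* The branch point -1 is real, which [y0] excludes; a solution with [y < 0] satisfies the curve
   equation and thus belongs to a range of negative index. *)
case: nB => [nB|[_ /eqP]]; last by rewrite oppr0 (negbTE y0).
apply: nB; rewrite /lambert_below /=.
case: (leP y (- pi)) => h; first by apply: Or31; rewrite mul1r.
by apply: Or32; rewrite mul1r mul0r oppr0 h yn; split=> //; rewrite -xc.
Qed.

Lemma lambertWN1_N1 : lambertW (-1) (-1) = a -i* b.
Proof.
apply: xget_unique => [|w [wE [nB nA]]].
  split; first exact: lambert_pt_sol_conj.
  move: b_itv => /andP[b0 bpi].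
  have := mul_cexp_eqN1_curve lambert_pt_sol_conj => -[_ _ ac _ _].
  split; rewrite /lambert_below /=.
    apply: Or32; split; last by rewrite -ac.
    by rewrite mul1r mul0r oppr0 ltrN2 bpi oppr_lt0.
  have p0 := pi_gt0 R.
  rewrite (_ : 1.*2.+1 = 3)%N// (_ : 1.*2 = 2)%N//.
  move=> [h|[/andP[_ h] _]|[//]].
  - by move: h; rewrite lerN2 => h; lra.
  - by move: h; rewrite ltrN2 => h; lra.
case: w => x y in wE nA nB *.
have p0 := pi_gt0 R.
have [y0 s0 xc h2 h1] := mul_cexp_eqN1_curve wE.
apply: lambert_pt_neg => //.
have yn : y < 0.
  case: nB => /= [|[/andP[_]]|[_ h]].
  - by rewrite mul1r => h; lra.
  - by rewrite mul0r oppr0.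
  - by move: y0; rewrite h eqxx.
rewrite oppr_gt0 yn /= ltNge; apply/negP => ypi.
(* If [y <= - pi], the range of [W_(-1)] leaves only [- 2 pi <= y], where [sin y >= 0]; but
   [y = e^-x sin y] makes [sin y] negative. *)
have sneg : sin y < 0.
  by have := expR_gt0 (- x) => e0; rewrite -(pmulr_rlt0 _ e0) -h2.
have y2 : - (2 * pi) <= y.
  rewrite leNgt; apply/negP => y2; apply: nA; rewrite /lambert_below /=.
  rewrite (_ : 1.*2.+1 = 3)%N// (_ : 1.*2 = 2)%N//.
  case: (leP y (- (3 * pi))) => h; first by apply: Or31.
  by apply: Or32; split; [apply/andP; split; [by [] | exact: y2] | rewrite -xc].
have : 0 <= sin y.
  have <- : sin (y + pi *+ 2) = sin y by rewrite sinD2pi.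
  by apply: sin_ge0_pi; rewrite -mulr_natl; apply/andP; split; lra.
lra.
Qed.

End LambertBranches.

(** * The inverse of a perturbed quadratic factor *)

Section QuadraticInverse.
Variable R : realType.

Lemma fps_sub_inv (z : R[i]) : z != 0 ->
  (fpsX R - fpsC z) * ((fun n => - z ^- n.+1) : fps R) = 1.
Proof.
move=> z0; apply/funext => -[|n]; rewrite mulrBl fpsDE fpsNE fpsCM fps1E.
  by rewrite fpsXM0 expr1 mulrN opprK divff// add0r.
rewrite fpsXMS mulrN opprK (exprS z n.+1) [RHS](_ : _ = 0)//; have := expf_neq0 n.+1 z0.
by move: (z ^+ n.+1) => P P0; field; rewrite z0 P0.
Qed.

Lemma l1_le_sub_inv (z : R[i]) : 1 < normc z ->
  l1_le (fun n => - z ^- n.+1) (normc z - 1)^-1.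
Proof.
move=> z1; have z0 : 0 < normc z by lra.
have -> : (normc z - 1)^-1 = (normc z)^-1 / (1 - (normc z)^-1).
  by field; rewrite ?lt0r_neq0//; lra.
apply: l1_le_geometric; first by rewrite invr_ge0 ltW//= invf_lt1.
by move=> n; rewrite normc_opp normcV normcX exprS invfM exprVn.
Qed.

(* Adding eps (al X + be) with be > 0 pushes the roots of q out of the unit disc
   by an amount proportional to eps and keeps them apart from each other. *)
Lemma quadratic_inverse (p r al be : R) : 0 < r -> p ^+ 2 + r ^+ 2 = 1 -> 0 < be ->
  exists C e0 : R, [/\ 0 < C, 0 < e0 & forall e : R, 0 < e <= e0 ->
    exists2 v : fps R,
      (fpsC (1 - e)%:C * ((fpsX R - fpsC (p +i* r)) * (fpsX R - fpsC (p -i* r))) +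
       fpsC e%:C * (fpsC al%:C * fpsX R + fpsC be%:C)) * v = 1 &
      l1_le v (C / e)].
Proof.
move=> r0 pr1 be0.
have p1 : `|p| < 1.
  rewrite -(@ltr_pXn2r _ 2)// ?nnegrE// real_normK ?num_real// expr1n -pr1 ltrDl.
  by rewrite exprn_gt0.
(* Strictly between [|p|] and 1: it will bound the real part of the perturbed roots, so that their
   imaginary part stays at least [d]. *)
pose m := (1 + `|p|) / 2.
have m1 : m < 1 by rewrite /m; lra.
have m0 : 0 < m by rewrite /m; have := normr_ge0 p; lra.
pose d := Num.sqrt (1 - m ^+ 2).
have d2 : 0 < 1 - m ^+ 2 by rewrite subr_gt0 exprn_ilt1// ltW.
have d0 : 0 < d by rewrite sqrtr_gt0.
have al1 : 0 < `|al| + 1 by have := normr_ge0 al; lra.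
(* In [C], [1 / d] comes from the distance between the roots, and [(2 + be) / be], twice, from their
   distance to the unit circle. The bounds on [e] ensure [1 - e >= 1/2] and [|a'| <= m]. *)
exists (2 / d * (2 + be) / be), (Num.min (2^-1) ((1 - `|p|) / 2 / (`|al| + 1))).
split.
- by rewrite !mulr_gt0 ?invr_gt0//; lra.
- by rewrite lt_min; apply/andP; split; [lra | rewrite divr_gt0//; lra].
move=> e /andP[e0]; rewrite le_min => /andP[e2]; rewrite ler_pdivlMr// => eal.
have s0 : 0 < 1 - e by lra.
(* Divided by [1 - e], the quadratic is [X^2 - 2 a' X + c0], and [c0 > 1] is the squared modulus of
   both roots. *)
pose a' := p - e * al / (2 * (1 - e)).
pose c0 := 1 + e * be / (1 - e).
have c01 : e * be <= c0 - 1.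
  rewrite /c0 addrAC subrr add0r ler_pdivlMr// ler_piMr ?mulr_ge0 ?(ltW e0) ?(ltW be0)//; lra.
have c02 : c0 <= 1 + be.
  rewrite /c0 lerD2l ler_pdivrMr// mulrC ler_wpM2l ?(ltW be0)//; lra.
have ebe : 0 < e * be by rewrite mulr_gt0.
have a'm : `|a'| <= m.
  apply: le_trans (ler_normB _ _) _.
  have : `|e * al / (2 * (1 - e))| <= e * (`|al| + 1).
    rewrite normrM normfV [`|2 * _|]gtr0_norm ?mulr_gt0// normrM gtr0_norm//.
    rewrite ler_pdivrMr ?mulr_gt0// -mulrA ler_wpM2l ?(ltW e0)//.
    apply: (@le_trans _ _ (`|al| + 1)); first lra.
    by rewrite ler_peMr ?(ltW al1)//; lra.
  by rewrite /m; lra.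
have a'2 : a' ^+ 2 <= m ^+ 2.
  by rewrite -[a' ^+ 2]real_normK ?num_real// lerXn2r ?nnegrE// ltW.
pose b' := Num.sqrt (c0 - a' ^+ 2).
have db' : d <= b' by rewrite ler_wsqrtr//; lra.
have b'2 : b' ^+ 2 = c0 - a' ^+ 2 by rewrite sqr_sqrtr//; lra.
pose z := a' +i* b'; pose zc := a' -i* b'.
have nz2 : normc z ^+ 2 = c0 by rewrite normc_sqr /= b'2; lra.
have nzc : normc zc = normc z by rewrite /= sqrrN.
have z1 : 1 < normc z.
  by rewrite -(@ltr_pXn2r _ 2)// ?nnegrE ?normc_ge0// expr1n nz2; lra.
have zle : normc z <= 1 + be.
  rewrite -(@ler_pXn2r _ 2)// ?nnegrE ?normc_ge0//; last lra.
  rewrite nz2; apply: le_trans c02 _.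
  by rewrite -{1}[1 + be]expr1 ler_weXn2l//; lra.
have znz : z != 0 by rewrite -normc_gt0; lra.
have zcnz : zc != 0 by rewrite -normc_gt0 nzc; lra.
pose Gz : fps R := fun n => - z ^- n.+1.
pose Gc : fps R := fun n => - zc ^- n.+1.
(* Partial fractions; [0 +i* (2 * b')] is [z - zc]. *)
pose v : fps R := fpsC ((1 - e)%:C * (0 +i* (2 * b')))^-1 * (Gz - Gc).
have b'0 : 0 < b' by apply: lt_le_trans db'.
exists v.
  have -> : fpsC (1 - e)%:C * ((fpsX R - fpsC (p +i* r)) * (fpsX R - fpsC (p -i* r))) +
       fpsC e%:C * (fpsC al%:C * fpsX R + fpsC be%:C) =
       fpsC (1 - e)%:C * ((fpsX R - fpsC z) * (fpsX R - fpsC zc)).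
    have E (x y : R) : (fpsX R - fpsC (x +i* y)) * (fpsX R - fpsC (x -i* y)) =
        fpsX R * fpsX R - fpsC (2 * x)%:C * fpsX R + fpsC (x ^+ 2 + y ^+ 2)%:C.
      have -> : (2 * x)%:C = (x +i* y) + (x -i* y).
        by rewrite addCE subrr mulrDl mul1r.
      have -> : (x ^+ 2 + y ^+ 2)%:C = (x +i* y) * (x -i* y).
        by rewrite mulCE; congr (_ +i* _); ring.
      by rewrite fpsC_add fpsC_mul; ring.
    rewrite !E b'2 pr1 (_ : a' ^+ 2 + _ = c0); last by ring.
    have -> : fpsC (2 * p)%:C = fpsC (2 * a')%:C + fpsC (e * al / (1 - e))%:C :> fps R.
      rewrite -fpsC_add -rmorphD /=; congr (fpsC _%:C); rewrite /a'.
      by field; rewrite lt0r_neq0.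
    have -> : fpsC c0%:C = fpsC 1%:C + fpsC (e * be / (1 - e))%:C :> fps R.
      by rewrite -fpsC_add -rmorphD.
    have F (t : R) : fpsC (1 - e)%:C * fpsC (e * t / (1 - e))%:C = fpsC e%:C * fpsC t%:C :> fps R.
      rewrite -!fpsC_mul -!rmorphM /=; congr (fpsC _%:C).
      by field; rewrite lt0r_neq0.
    have := F al; have := F be; move: (fpsC (e * be / _)%:C) (fpsC (e * al / _)%:C).
    move=> X1 X2 h1 h2.
    rewrite [fpsC e%:C * (_ + _)]mulrDr [fpsC e%:C * (_ * _)]mulrA -h2 -h1; ring.
  rewrite /v.
  have h1 : (fpsX R - fpsC z) * Gz = 1 by exact: fps_sub_inv.
  have h2 : (fpsX R - fpsC zc) * Gc = 1 by exact: fps_sub_inv.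
  transitivity (fpsC (1 - e)%:C * fpsC ((1 - e)%:C * (0 +i* (2 * b')))^-1 *
    ((fpsX R - fpsC zc) * ((fpsX R - fpsC z) * Gz) -
     (fpsX R - fpsC z) * ((fpsX R - fpsC zc) * Gc))).
    ring.
  rewrite h1 h2 !mulr1.
  have -> : fpsX R - fpsC zc - (fpsX R - fpsC z) = fpsC (0 +i* (2 * b')).
    have -> : (0 +i* (2 * b')) = z + (-1) * zc.
      rewrite /z /zc mulN1r; rewrite -[- _]/((- a') +i* (- - b')) addCE subrr opprK.
      by rewrite mulrDl mul1r.
    rewrite fpsC_add fpsC_mul.
    have -> : fpsC (-1) = -1 :> fps R.
      rewrite -[RHS]add0r -fpsC1; apply/funext => n.
      by rewrite fpsDE fpsNE /fpsC add0r mulN1r mul1r.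
    ring.
  rewrite -!fpsC_mul -[RHS]fpsC1; congr fpsC.
  have e1 : (1 - e)%:C != 0 :> R[i] by rewrite -normc_gt0 normcR gtr0_norm.
  have e2' : 0 +i* (2 * b') != 0 :> R[i].
    by rewrite -normc_gt0 /= expr0n /= add0r sqrtr_sqr normr_gt0 lt0r_neq0// mulr_gt0.
  by move: (_%:C) (_ +i* _) e1 e2' => A1 A2 A10 A20; field; rewrite A10 A20.
have hv := l1_leM (@l1_leC R ((1 - e)%:C * (0 +i* (2 * b')))^-1)
  (l1_leD (l1_le_sub_inv z1) (l1_leN (l1_le_sub_inv (z := zc) _))).
apply: l1_le_trans (hv _) _; first by rewrite nzc.
rewrite nzc normcV normcM normcR gtr0_norm// [normc (0 +i* _)]/= expr0n /= add0r.
rewrite sqrtr_sqr gtr0_norm ?mulr_gt0//.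
have zm : e * be / (2 + be) <= normc z - 1.
  rewrite ler_pdivrMr; last lra.
  apply: (le_trans c01); rewrite -nz2.
  have -> : normc z ^+ 2 - 1 = (normc z - 1) * (normc z + 1) by ring.
  by rewrite ler_wpM2l; lra.
have h3 : (normc z - 1)^-1 <= (2 + be) / be / e.
  have -> : (2 + be) / be / e = (e * be / (2 + be))^-1.
    by field; rewrite !lt0r_neq0//; lra.
  rewrite lef_pV2 ?posrE//; first lra.
  by rewrite divr_gt0//; lra.
have h4 : ((1 - e) * (2 * b'))^-1 <= d^-1.
  rewrite lef_pV2 ?posrE ?mulr_gt0//.
  apply: (le_trans db'); rewrite mulrA ler_peMl ?(ltW b'0)//; lra.
have -> : 2 / d * (2 + be) / be / e = d^-1 * ((2 + be) / be / e + (2 + be) / be / e) by ring.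
have z2 : 0 <= (normc z - 1)^-1 by rewrite invr_ge0 subr_ge0 ltW.
apply: ler_pM; [|exact: addr_ge0|exact: h4|exact: lerD].
by rewrite invr_ge0 mulr_ge0 ?mulr_ge0// ltW.
Qed.

End QuadraticInverse.

(** * The estimate of 1 / (1 - s u) in the l1 norm *)

Section ResolventBound.
Variable R : realType.
Variable b : R.
Hypothesis hb : is_lambert_pt b.
Let a := ln_sinc b.
Let W : R[i] := a +i* b.

Definition lambert_rho : R := normc (ln_sinc b +i* b).
Local Notation rho := lambert_rho.

(* In the scaled variable x / rho: [hseries] is x + e^-x and [useries] is
   1 - x - e^-x. *)
Definition hseries : fps R := fpsC rho%:C * fpsX R + fps_exp (- rho%:C).
Definition useries : fps R := 1 - hseries.

Let b0 : 0 < b. Proof. by case: hb => b1 _ _; lra. Qed.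

Let rho2 : rho ^+ 2 = a ^+ 2 + b ^+ 2.
Proof. by rewrite normc_sqr. Qed.

Let rho0 : 0 < rho.
Proof.
rewrite normc_gt0; apply/eqP => -[_ h]; by have := b0; rewrite h ltxx.
Qed.

Let rhoC : rho%:C != 0 :> R[i].
Proof. by rewrite -normc_gt0 normcR gtr0_norm. Qed.

Let w : R[i] := (a / rho) +i* (b / rho).
Let wc : R[i] := (a / rho) -i* (b / rho).

Let Ww : rho%:C * w = W.
Proof.
rewrite /w -[rho%:C]/(rho +i* 0) mulCE !mul0r subr0 addr0.
by rewrite ![rho * _]mulrC !divfK// lt0r_neq0.
Qed.

Let Wwc : rho%:C * wc = W^*%C.
Proof.
rewrite /wc -[rho%:C]/(rho +i* 0) mulCE !mul0r subr0 addr0.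
by rewrite mulrN ![rho * _]mulrC !divfK// lt0r_neq0.
Qed.

Let wn : normc w = 1.
Proof.
apply: (mulfI (lt0r_neq0 rho0)); rewrite mulr1.
by have := congr1 (@normc R) Ww; rewrite normcM normcR gtr0_norm.
Qed.

Let wcn : normc wc = 1.
Proof. by rewrite -wn /= sqrrN. Qed.

Let wne : w - wc != 0.
Proof.
rewrite -normc_gt0 /w /wc -[- _]/((- (a / rho)) +i* (- - (b / rho))) addCE subrr opprK.
rewrite /= expr0n /= add0r sqrtr_sqr normr_gt0 lt0r_neq0// addr_gt0// divr_gt0//.
Qed.

Lemma entire_hseries : entire hseries.
Proof.
by apply: entireD; [apply: entireCM; exact: entireX | exact: entire_exp].
Qed.

Lemma ev_hseries x : normc x <= 1 -> ev hseries x = rho%:C * x + cexp (- (rho%:C * x)).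
Proof.
move=> x1; have sX : summableC (fpsX R) by exists 1; exact: l1_leX.
have sC : summableC (fpsC rho%:C : fps R) by exists (normc rho%:C); exact: l1_leC.
rewrite /hseries (evD x1 (summableCM sC sX) (summable_exp _)) evCM// evX ev_exp.
by rewrite mulNr.
Qed.

Let eh_w : ev hseries w = 0.
Proof. by rewrite ev_hseries ?wn// Ww; exact: lambert_sol. Qed.

Let sol_c : W^*%C + cexp (- W^*%C) = 0.
Proof.
by rewrite -rmorphN cexp_conj -rmorphD (lambert_sol hb) rmorph0.
Qed.

Let eh_wc : ev hseries wc = 0.
Proof. by rewrite ev_hseries ?wcn// Wwc; exact: sol_c. Qed.

Lemma hseries_zero x (t : R) : normc x <= 1 -> 0 <= t -> t%:C + ev hseries x = 0 ->
  t = 0 /\ (x = w \/ x = wc).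
Proof.
move=> x1 t0; rewrite ev_hseries// addrA => h.
case E : (rho%:C * x) => [y z].
have hyz : y ^+ 2 + z ^+ 2 <= a ^+ 2 + b ^+ 2.
  have <- : normc (y +i* z) ^+ 2 = y ^+ 2 + z ^+ 2 by rewrite normc_sqr.
  rewrite -rho2 -E normcM normcR gtr0_norm//.
  by rewrite lerXn2r ?nnegrE ?mulr_ge0 ?normc_ge0 ?(ltW rho0)// ler_piMr// ltW.
rewrite E in h; have [tE hE] := lambert_zero_unique hb t0 hyz h; split=> //.
by case: hE; rewrite -E => hE; [left|right]; apply: (mulfI rhoC);
  rewrite hE ?Ww ?Wwc.
Qed.

Let evDh x : normc x <= 1 -> ev (fpsD hseries) x =
  rho%:C * x * (1 - cexp (- (rho%:C * x))).
Proof.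
move=> x1; have sX : summableC (fpsX R) by exists 1; exact: l1_leX.
have sC : summableC (fpsC rho%:C : fps R) by exists (normc rho%:C); exact: l1_leC.
have sE := summable_exp (- rho%:C).
have sXE := summableCM sX sE.
have -> : fpsD hseries = fpsC rho%:C * fpsX R + fpsC (- rho%:C) * (fpsX R * fps_exp (- rho%:C)).
  rewrite /hseries fpsD_add fpsD_exp; congr (_ + _); apply/funext => n.
  rewrite /fpsD fpsCM /fpsX.
  by case: n => [|[|n]]; rewrite ?mulr0 ?mul0r ?mul1r ?mulr1.
have sC' : summableC (fpsC (- rho%:C) : fps R) by exists (normc (- rho%:C)); exact: l1_leC.
rewrite (evD x1 (summableCM sC sX) (summableCM sC' sXE)) !evCM// (evM x1 sX sE).
by rewrite evX ev_exp !mulNr; ring.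
Qed.

Let fpsXC_ev z x : normc x <= 1 -> ev (fpsX R - fpsC z) x = x - z.
Proof.
move=> x1; have sX : summableC (fpsX R) by exists 1; exact: l1_leX.
have sC : summableC (fpsC z : fps R) by exists (normc z); exact: l1_leC.
rewrite (evD x1 sX) ?(evN x1 sC) ?evX ?evC//.
by exists (normc z); apply: l1_leN; exact: l1_leC.
Qed.

Let sXC z : summableC (fpsX R - fpsC z).
Proof.
apply: summableCD; first by exists 1; exact: l1_leX.
by exists (normc z); apply: l1_leN; exact: l1_leC.
Qed.

Let div2 f : entire f -> ev f w = 0 -> ev f wc = 0 ->
  exists2 g, entire g & f = (fpsX R - fpsC w) * (fpsX R - fpsC wc) * g.
Proof.
move=> ef fw fwc; have [g1 eg1 fE] := entire_div_root ef wn fw.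
have wc1 : normc wc <= 1 by rewrite wcn.
have g1c : ev g1 wc = 0.
  have E : ev f wc = (wc - w) * ev g1 wc.
    by rewrite {1}fE (evM wc1 (sXC w) (entire_summable eg1)) (fpsXC_ev w wc1).
  move: fwc; rewrite E => /eqP; rewrite mulf_eq0 subr_eq0 eq_sym -subr_eq0.
  by rewrite (negbTE wne) => /eqP.
have [g eg g1E] := entire_div_root eg1 wcn g1c.
by exists g => //; rewrite fE g1E mulrA.
Qed.

Let q : fps R := (fpsX R - fpsC w) * (fpsX R - fpsC wc).
(** With [hseries = q * g], the linear series [lin] interpolates [1 / g] at the two roots:
    differentiating [hseries] at [w] gives [(w - wc) * g(w) = rho (1 + W)]. The coefficients are
    real by symmetry under conjugation, and [N2] is [|1 + W|^2]. *)
Let N2 : R := (1 + a) ^+ 2 + b ^+ 2.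
Let al : R := 2 * (1 + a) / N2 / rho.
Let be : R := 2 * (b ^+ 2 - a - a ^+ 2) / N2 / rho ^+ 2.
Let lin : fps R := fpsC al%:C * fpsX R + fpsC be%:C.

Let N20 : 0 < N2.
Proof. by rewrite /N2 ltr_wpDl ?sqr_ge0// exprn_gt0. Qed.

Let be0 : 0 < be.
Proof.
rewrite /be !divr_gt0// ?exprn_gt0// mulr_gt0//.
have [_ h] := lambert_norm_lt_pi hb; rewrite -/a in h; lra.
Qed.

Let ev_lin x : normc x <= 1 -> ev lin x = al%:C * x + be%:C.
Proof.
move=> x1; have sX : summableC (fpsX R) by exists 1; exact: l1_leX.
have sC z : summableC (fpsC z : fps R) by exists (normc z); exact: l1_leC.
by rewrite /lin (evD x1 (summableCM (sC _) sX) (sC _)) evCM// evX evC.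
Qed.

Let lin_w : (al%:C * w + be%:C) * (rho%:C * (1 + W)) = w - wc.
Proof.
have n0 := lt0r_neq0 N20; have r0 := lt0r_neq0 rho0.
have -> : al%:C * w + be%:C =
    (2 * b ^+ 2 / N2 / rho ^+ 2) +i* (2 * (1 + a) * b / N2 / rho ^+ 2).
  rewrite /w -![_%:C]/(_ +i* 0) !(mulCE, addCE) !mul0r subr0 !addr0 /al /be.
  by congr (_ +i* _); field; rewrite n0 r0.
have -> : rho%:C * (1 + W) = (rho * (1 + a)) +i* (rho * b).
  rewrite /W -[1 : R[i]]/(1 +i* 0) -![_%:C]/(_ +i* 0) !(mulCE, addCE).
  by rewrite !mul0r subr0 !addr0 add0r.
rewrite /w /wc -[- (_ +i* _)]/((- (a / rho)) +i* (- - (b / rho))) mulCE addCE.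
have NE : b ^+ 2 = N2 - (1 + a) ^+ 2 by rewrite /N2; ring.
congr (_ +i* _); first by field; rewrite n0 r0.
rewrite NE; have -> : 2 * (N2 - (1 + a) ^+ 2) / N2 / rho ^+ 2 * (rho * b) +
  2 * (1 + a) * b / N2 / rho ^+ 2 * (rho * (1 + a)) = 2 * (b / rho).
  by field; rewrite n0 r0.
by rewrite opprK mulrDl mul1r.
Qed.

Let lin_wc : (al%:C * wc + be%:C) * (rho%:C * (1 + W^*%C)) = wc - w.
Proof.
have := congr1 (fun z => z^*%C) lin_w.
have cM (x y : R[i]) : (x * y)^*%C = x^*%C * y^*%C by rewrite rmorphM.
have cD (x y : R[i]) : (x + y)^*%C = x^*%C + y^*%C by rewrite rmorphD.
have cN (x : R[i]) : (- x)^*%C = - x^*%C by rewrite rmorphN.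
rewrite !(cM, cD, cN) !conjc_real.
have -> : w^*%C = wc by [].
by have -> : wc^*%C = w by rewrite /wc /= opprK.
Qed.

(** [1 - s u = e + s q g = g (s q + e / g)] with [e = 1 - s]. Because [lin] interpolates [1 / g],
    [r = 1 / g] equals [lin + q (k r)]; up to the multiple [e q k r] of [q], the second factor is
    the quadratic [Q] of [quadratic_inverse], and [s r Qi] is an inverse up to an error of order
    [e]. *)
Lemma resolvent_bound_near1 : exists C e0 : R, [/\ 0 < C, 0 < e0 &
  forall e : R, 0 < e <= e0 ->
    exists2 v : fps R, (1 - fpsC (1 - e)%:C * useries) * v = 1 & l1_le v (C / e)].
Proof.
have w1 : normc w <= 1 by rewrite wn.
have wc1 : normc wc <= 1 by rewrite wcn.
have [g eg hE] := div2 entire_hseries eh_w eh_wc.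
have sg := entire_summable eg.
have W1 : 1 + W != 0.
  by apply/eqP => -[_]; rewrite add0r => h; have := b0; rewrite h ltxx.
have Wc1 : 1 + W^*%C != 0.
  by rewrite -[1](rmorph1 (@conjc R)) -rmorphD conjc_eq0.
have gw : (w - wc) * ev g w = rho%:C * (1 + W).
  have wnz : w != 0 by rewrite -normc_gt0 wn.
  have hE' : hseries = (fpsX R - fpsC w) * ((fpsX R - fpsC wc) * g) by rewrite hE mulrA.
  have eg1 : entire ((fpsX R - fpsC wc) * g).
    rewrite mulrBl; apply: entireD; first exact: entireXM.
    by apply: entireN; exact: entireCM.
  have := ev_fpsD_root wn eg1 hE'.
  rewrite evDh// Ww (evM w1 (sXC wc) sg) (fpsXC_ev wc w1).
  have -> : cexp (- W) = - W by apply/eqP; rewrite -addr_eq0 addrC (lambert_sol hb).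
  rewrite opprK -{1}Ww [rho%:C * w]mulrC -mulrA => /(mulfI wnz) <-//.
have gwc : (wc - w) * ev g wc = rho%:C * (1 + W^*%C).
  have wnz : wc != 0 by rewrite -normc_gt0 wcn.
  have hE' : hseries = (fpsX R - fpsC wc) * ((fpsX R - fpsC w) * g).
    by rewrite hE mulrA; congr (_ * _); rewrite mulrC.
  have eg1 : entire ((fpsX R - fpsC w) * g).
    rewrite mulrBl; apply: entireD; first exact: entireXM.
    by apply: entireN; exact: entireCM.
  have := ev_fpsD_root wcn eg1 hE'.
  rewrite evDh// Wwc (evM wc1 (sXC w) sg) (fpsXC_ev w wc1).
  have -> : cexp (- W^*%C) = - W^*%C by apply/eqP; rewrite -addr_eq0 addrC sol_c.
  rewrite opprK -{1}Wwc [rho%:C * wc]mulrC -mulrA => /(mulfI wnz) <-//.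
(* A zero of [g] is one of [hseries], hence [w] or [wc], where [gw] and [gwc] show that [g] does not
   vanish: the roots are simple. *)
have g0 x : normc x <= 1 -> ev g x != 0.
  move=> x1; apply/eqP => gx.
  have hx : ev hseries x = 0.
    by rewrite hE (evM x1 (summableCM (sXC w) (sXC wc)) sg) gx mulr0.
  have [|_ [xE|xE]] := @hseries_zero x 0 x1 (lexx _); first by rewrite add0r.
  - by move/eqP: gw; rewrite -xE gx mulr0 eq_sym mulf_eq0 (negbTE rhoC) (negbTE W1).
  - by move/eqP: gwc; rewrite -xE gx mulr0 eq_sym mulf_eq0 (negbTE rhoC) (negbTE Wc1).
have eDg := entire_fpsD eg; have eDDg := entire_fpsD eDg.
have [r gr [Mr rM]] := wiener_inverse sg (entire_summable eDg) (entire_summable eDDg) g0.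
have sX : summableC (fpsX R) by exists 1; exact: l1_leX.
have slin : summableC lin.
  by apply: summableCD; [apply: summableCM => // |]; eexists; exact: l1_leC.
have elg : entire (1 - lin * g).
  apply: entireD; first exact: entire1.
  apply: entireN; rewrite /lin mulrDl; apply: entireD; last exact: entireCM.
  by rewrite -mulrA; apply: entireCM; exact: entireXM.
have ev1lg x : normc x <= 1 -> ev (1 - lin * g) x = 1 - (al%:C * x + be%:C) * ev g x.
  move=> x1; have s1 : summableC (1 : fps R) by exists 1; exact: l1_le1.
  have slg := summableCM slin sg.
  have [M hM] := slg.
  rewrite (evD x1 s1); last by exists M; exact: l1_leN.
  by rewrite (evN x1 slg) ev1 (evM x1 slin sg) ev_lin.
have zw : ev (1 - lin * g) w = 0.
  rewrite ev1lg//; apply/eqP; rewrite subr_eq0 eq_sym; apply/eqP.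
  apply: (mulfI wne); rewrite mulrCA gw mulr1; exact: lin_w.
have wne' : wc - w != 0 by rewrite -opprB oppr_eq0.
have zwc : ev (1 - lin * g) wc = 0.
  rewrite ev1lg//; apply/eqP; rewrite subr_eq0 eq_sym; apply/eqP.
  apply: (mulfI wne'); rewrite mulrCA gwc mulr1; exact: lin_wc.
have [k ek kE] := div2 elg zw zwc.
have [Mkr krM] := summableCM (entire_summable ek) (ex_intro _ Mr rM).
have [Mlkr lkrM] := summableCM slin (ex_intro _ Mkr krM).
have pr1 : (a / rho) ^+ 2 + (b / rho) ^+ 2 = 1.
  have := normc_sqr w; rewrite wn expr1n /= => <-//.
have [C [e1 [C0 e10 hQ]]] := quadratic_inverse al (divr_gt0 b0 rho0) pr1 be0.
have Mr0 := l1_le_ge0 rM; have Mkr0 := l1_le_ge0 krM; have Mlkr0 := l1_le_ge0 lkrM.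
pose D := 1 + Mkr + Mlkr * C.
have D0 : 0 < D by have := mulr_ge0 Mlkr0 (ltW C0); rewrite /D; lra.
exists (2 * (Mr + 1) * C), (Num.min e1 (Num.min 2^-1 (2 * D)^-1)); split.
- by rewrite !mulr_gt0//; lra.
- rewrite !lt_min e10 /=; apply/andP; split; first lra.
  by rewrite invr_gt0 mulr_gt0.
move=> e /andP[e0]; rewrite !le_min => /andP[ee1 /andP[e2 eD]].
have he : 0 < e <= e1 by rewrite e0.
have [Qi hQi' QiM] := hQ e he.
pose s : fps R := fpsC (1 - e)%:C; pose E : fps R := fpsC e%:C.
pose Q : fps R := s * q + E * lin.
have hQi : Q * Qi = 1 := hQi'.
have sE1 : s = 1 - E.
  rewrite /s /E -fpsC1; apply/funext => n.
  by rewrite fpsDE fpsNE /fpsC rmorphB /= mulrBl.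
rewrite -/s.
(* In the last term one of the two factors [E] pays for the norm [C / e] of [Qi], so the whole error
   has norm at most [e * D]. *)
pose err : fps R := E - E * (k * r) + E * E * (lin * (k * r)) * Qi.
have key : (1 - s * useries) * (s * (r * Qi)) = 1 - err.
  have rE : r = lin + q * (k * r).
    have h1 : 1 = lin * g + q * k by rewrite -[RHS]addrC -kE subrK.
    by rewrite -[LHS]mul1r h1 mulrDl -mulrA gr mulr1 mulrA.
  have f1 : 1 - s * useries = E + s * (q * g).
    by rewrite /useries hE -/q mulrBr mulr1 sE1; ring.
  transitivity (s * (s * q * (g * r) + E * r) * Qi); first by rewrite f1; ring.
  rewrite gr mulr1 {1}rE.
  transitivity ((s + E * (k * r)) * (Q * Qi) - E * E * (lin * (k * r)) * Qi).
    by rewrite /Q; ring.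
  by rewrite hQi /err sE1; ring.
have errM : l1_le err 2^-1.
  have EM : l1_le E e by have := @l1_leC R e%:C; rewrite normcR gtr0_norm.
  have h1 := l1_leM EM krM.
  have h2 := l1_leM (l1_leM (l1_leM EM EM) lkrM) QiM.
  have := l1_leD (l1_leD EM (l1_leN h1)) h2; rewrite -/err => h3.
  apply: l1_le_trans h3 _.
  have -> : e + e * Mkr + e * e * Mlkr * (C / e) = e * D.
    by rewrite /D; field; rewrite lt0r_neq0.
  apply: (@le_trans _ _ ((2 * D)^-1 * D)); first by rewrite ler_wpM2r// ltW.
  by rewrite invfM -mulrA mulVf ?lt0r_neq0// mulr1.
have [c hc] : exists c, (1 - err) * c = 1.
  apply: fps_inv_ex; rewrite fpsDE fpsNE fps1E /= subr_eq0 eq_sym.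
  apply/eqP => h; have := l1_le_coef 0 errM; rewrite h normc1; lra.
have h12 : 2^-1 < 1 :> R by lra.
have cM := l1_le_inv_sub1 errM h12 hc.
exists (s * (r * Qi) * c); first by rewrite -[RHS]hc -key -/s; ring.
have sM : l1_le s (1 - e) by have := @l1_leC R (1 - e)%:C; rewrite normcR gtr0_norm//; lra.
apply: l1_le_trans (l1_leM (l1_leM sM (l1_leM rM QiM)) cM) _.
have -> : (1 - 2^-1)^-1 = 2 :> R by field.
have Ce : 0 < C / e by rewrite divr_gt0.
have -> : 2 * (Mr + 1) * C / e = (1 * ((Mr + 1) * (C / e))) * 2 by ring.
rewrite ler_wpM2r// ler_pM//; first lra.
- by rewrite mulr_ge0 ?(ltW Ce).
- lra.
- by rewrite ler_wpM2r ?(ltW Ce)//; lra.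
Qed.

(** Compactness of [[0, 1]], with [C] tending to [+oo], glues the local bounds. The glued property
    is guarded by [s < 1]: it is void at the end point 1, whose neighbourhood is served by
    [resolvent_bound_near1]. *)
Lemma resolvent_bound : exists C : R, forall s : R, 0 <= s < 1 ->
  exists2 v : fps R, (1 - fpsC s%:C * useries) * v = 1 & l1_le v (C / (1 - s)).
Proof.
have euser : entire useries.
  by apply: entireD; [exact: entire1 | apply: entireN; exact: entire_hseries].
have su := entire_summable euser; have [U uU] := su.
have U0 := l1_le_ge0 uU.
have := @segment_compact R 0 1 => /compact_near_coveringP/near_covering_withinP.
move=> /(_ R +oo%R (fun C s => s < 1 -> exists2 v : fps R,
  (1 - fpsC s%:C * useries) * v = 1 & l1_le v (C / (1 - s))) _).
case.
- move=> s0; rewrite /= in_itv /= => /andP[s00 s01].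
  have [s1|s1] := ltP s0 1; last first.
    have -> : s0 = 1 by lra.
    have [C [e0 [C0 e00 hC]]] := resolvent_bound_near1.
    exists (ball (1 : R) e0, [set x | C <= x]).
      by split => /=; [exact: nbhsx_ballx | apply: nbhs_pinfty_ge; exact: num_real].
    move=> [s x] [/= bs Cx] _ s1'.
    have [|v hv vM] := hC (1 - s).
      rewrite subr_gt0 s1' /=; move: bs; rewrite /ball /= => bs; apply: ltW.
      by apply: le_lt_trans bs; exact: ler_norm.
    exists v; first by move: hv; rewrite subKr.
    by apply: l1_le_trans vM _; rewrite ler_wpM2r ?invr_ge0//; lra.
  have es0 : entire (1 - fpsC s0%:C * useries).
    by apply: entireD; [exact: entire1 | apply: entireN; exact: entireCM].
  have nz x : normc x <= 1 -> ev (1 - fpsC s0%:C * useries) x != 0.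
    move=> x1; apply/eqP.
    have s1' : summableC (1 : fps R) by exists 1; exact: l1_le1.
    have sh := entire_summable entire_hseries.
    have [Mh hMh] := sh.
    have shN : summableC (- hseries) by exists Mh; exact: l1_leN.
    have sC : summableC (fpsC s0%:C : fps R) by exists (normc s0%:C); exact: l1_leC.
    have sCu := summableCM sC su; have [M hM] := sCu.
    have sN : summableC (- (fpsC s0%:C * useries)) by exists M; exact: l1_leN.
    rewrite (evD x1 s1' sN) (evN x1 sCu) ev1 evCM// /useries (evD x1 s1' shN) (evN x1 sh) ev1.
    move=> h.
    have s0n : s0 != 0.
      apply/eqP => s00'; move/eqP: h; rewrite s00' mul0r subr0; exact/negP/oner_neq0.
    have s0p : 0 < s0 by rewrite lt_def s0n.
    have s0C : s0%:C != 0 :> R[i] by rewrite -normc_gt0 normcR gtr0_norm.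
    (* Dividing [1 - s0 (1 - h) = 0] by [s0] gives [t + h = 0] with [t = (1 - s0) / s0 > 0]. *)
    have [||tE _] := @hseries_zero x ((1 - s0) / s0) x1.
    - by rewrite divr_ge0//; lra.
    - apply: (mulfI s0C); rewrite mulr0 -[RHS]h mulrDr -rmorphM /= [s0 * _]mulrC divfK// rmorphB /=.
      ring.
    - have : 0 < (1 - s0) / s0 by rewrite divr_gt0//; lra.
      by rewrite tE ltxx.
  have eDg := entire_fpsD es0; have eDDg := entire_fpsD eDg.
  have [v hv [M vM]] := wiener_inverse (entire_summable es0) (entire_summable eDg)
    (entire_summable eDDg) nz.
  have M0 := l1_le_ge0 vM.
  (* Within this distance of [s0] the perturbation satisfies [|s0 - s| * U * M <= 1/2]. *)
  have d0 : 0 < (2 * (U + 1) * (M + 1))^-1 by rewrite invr_gt0 !mulr_gt0//; lra.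
  exists (ball (s0 : R) (2 * (U + 1) * (M + 1))^-1, [set x | 2 * M <= x]).
    by split => /=; [exact: nbhsx_ballx | apply: nbhs_pinfty_ge; exact: num_real].
  move=> [s x] [/= bs Mx] ss s1'.
  move: ss; rewrite in_itv /= => /andP[ss0 _].
  have eM : l1_le (fpsC (s0 - s)%:C * useries) (`|s0 - s| * U).
    by apply: l1_leM => //; have := @l1_leC R (s0 - s)%:C; rewrite normcR.
  have [|v' hv' v'M] := inv_perturb hv vM eM.
    move: bs; rewrite /ball /= => bs.
    apply: (@le_trans _ _ ((2 * (U + 1) * (M + 1))^-1 * (U + 1) * (M + 1))).
      by rewrite !ler_pM ?mulr_ge0// ?ltW//; lra.
    rewrite !invfM -!mulrA; have -> : (U + 1)^-1 * ((M + 1)^-1 * ((U + 1) * (M + 1))) = 1.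
      by field; rewrite !lt0r_neq0//; lra.
    by rewrite mulr1.
  exists v'.
    have fB : fpsC (s0 - s)%:C = fpsC s0%:C - fpsC s%:C :> fps R.
      by apply/funext => n; rewrite fpsDE fpsNE /fpsC rmorphB /= mulrBl.
    by rewrite -[RHS]hv' fB; ring.
  apply: l1_le_trans v'M _; apply: (le_trans Mx).
  by rewrite ler_peMr ?invf_ge1//; lra.
- move=> C [_ hC]; exists (C + 1) => s /andP[s0 s1].
  by have := hC (C + 1) _ s _ s1; apply; [rewrite ltrDl | rewrite /= in_itv /= s0 ltW].
Qed.

End ResolventBound.

(** * Counting partitions by removing one block *)

Section PartitionCount.
Local Open Scope set_scope.
Variable T : finType.
Implicit Types (A B : {set T}) (P : {set {set T}}).

Definition partitions_ge2 A k := [set P : {set {set T}} | [&& finset.partition P A,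
  #|P| == k & [forall (B | B \in P), 2 <= #|B|]%N]].

Lemma card_partitions_ge2_block A B k : B \subset A -> (2 <= #|B|)%N ->
  #|[set P in partitions_ge2 A k.+1 | B \in P]| = #|partitions_ge2 (A :\: B) k|.
Proof.
move=> BA B2.
have B0 : B != finset.set0 by rewrite -card_gt0; apply: leq_trans B2.
have BP' P : finset.partition P (A :\: B) -> B \notin P.
  move=> PA; apply/negP => BP; have := finset.partitionS PA BP.
  rewrite finset.subsetD => /andP[_]; rewrite -finset.setI_eq0 finset.setIid.
  exact/negP.
have inj : {in partitions_ge2 (A :\: B) k &, injective (fun P => B |: P)}.
  move=> P Q; rewrite !inE => /and3P[/BP' BP _ _] /and3P[/BP' BQ _ _] h.
  by rewrite -(setU1K BP) -(setU1K BQ) h.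
rewrite -(card_in_imset inj); apply: eq_card => P; apply/idP/imsetP.
  rewrite !inE => /andP[/and3P[PA /eqP Pk /forall_inP P2] BP].
  exists (P :\ B); last by rewrite finset.setD1K.
  rewrite inE finset.partitionD1//=; apply/andP; split.
    by have := cardsD1 B P; rewrite BP Pk add1n => -[->].
  by apply/forall_inP => C; rewrite !inE => /andP[_ CP]; exact: P2.
move=> [Q + ->]; rewrite !inE => /and3P[QA /eqP Qk /forall_inP Q2].
rewrite eqxx /= andbT; apply/and3P; split.
- have -> : A = B :|: (A :\: B).
    apply/finset.setP => x; rewrite !inE; case: (boolP (x \in B)) => //= xB.
    exact: (fintype.subsetP BA).
  apply: finset.partitionU1 => //.
  by rewrite -finset.setI_eq0; apply/eqP/finset.setP => x; rewrite !inE; case: (x \in B).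
- by rewrite cardsU1 BP'// Qk.
- by apply/forall_inP => C; rewrite !inE => /orP[/eqP ->//|]; exact: Q2.
Qed.

(** The pairs formed by a partition and one of its blocks are counted in two ways. *)
Lemma card_partitions_ge2S A k :
  (k.+1 * #|partitions_ge2 A k.+1| =
   \sum_(B : {set T} | (B \subset A) && (2 <= #|B|)) #|partitions_ge2 (A :\: B) k|)%N.
Proof.
transitivity (\sum_(P in partitions_ge2 A k.+1) \sum_(B in P) 1)%N.
  rewrite mulnC -sum_nat_const; apply: eq_bigr => P.
  by rewrite inE => /and3P[_ /eqP <- _]; rewrite sum1_card.
rewrite (exchange_big_dep xpredT)//= [RHS]big_mkcond /=; apply: eq_bigr => B _.
rewrite sum1_card; case: ifP => [/andP[BA B2]|nB].
  by rewrite -card_partitions_ge2_block//; apply: eq_card => P; rewrite [RHS]inE.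
apply: eq_card0 => P; rewrite unfold_in inE; apply/negP => /andP[/and3P[PA _ /forall_inP P2] BP].
by move: nB; rewrite (finset.partitionS PA BP) P2.
Qed.

Lemma sum_subset_card (V : nmodType) A (F : nat -> V) :
  \sum_(B : {set T} | B \subset A) F #|B| = \sum_(j < #|A|.+1) F j *+ 'C(#|A|, j).
Proof.
rewrite (partition_big (fun B : {set T} => inord #|B| : 'I_(#|A|.+1)) xpredT)//=.
apply: eq_bigr => j _; rewrite -cards_draws.
rewrite (eq_bigr (fun=> F j)); last first.
  move=> B /andP[BA /eqP <-]; rewrite inordK// ltnS; exact: subset_leq_card.
rewrite sumr_const; congr (_ *+ _); apply: eq_card => B; rewrite !inE.
rewrite unfold_in /=; case: (boolP (B \subset A)) => //= BA.
by rewrite -val_eqE /= inordK// ltnS; exact: subset_leq_card.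
Qed.

End PartitionCount.

(** * The exponential generating function of the restricted Stirling numbers *)

Section StirlingSeries.
Variable R : realType.

(** The Taylor coefficients of [e^x - 1 - x]. *)
Definition vseries : fps R := fun n => if (2 <= n)%N then n`!%:R^-1 else 0.

(** Removing a block of size [j] is a Cauchy product with [vseries], the factorials absorbing the
    binomial coefficient. The induction ranges over arbitrary sets [A], since what a block leaves
    behind is an arbitrary subset. *)
Lemma partitions_ge2_coef (T : finType) (A : {set T}) k :
  (k`! * #|partitions_ge2 A k|)%:R = (#|A|)`!%:R * (vseries ^+ k) #|A| :> R[i].
Proof.
elim: k A => [|k IH] A.
  rewrite fact0 mul1n expr0 fps1E.
  have -> : partitions_ge2 A 0 = if #|A| == 0%N then [set finset.set0]%SET else finset.set0.
    apply/finset.setP => P; rewrite inE !cards_eq0.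
    case: (eqVneq A finset.set0) => [->|A0]; rewrite inE.
      rewrite finset.partition_set0; case: (eqVneq P finset.set0) => //= ->.
      by apply/forall_inP => B; rewrite inE.
    apply/negP => /and3P[PA /eqP P0 _]; move: PA; rewrite P0 /finset.partition.
    by rewrite /finset.cover big_set0 eq_sym (negbTE A0).
  case: (eqVneq #|A| 0%N) => [->|_]; first by rewrite cards1 fact0 mulr1.
  by rewrite cards0 mulr0.
rewrite factS mulnAC [(k.+1 * _)%N]card_partitions_ge2S mulnC natrM natr_sum mulr_sumr.
have -> : \sum_(B : {set T} | (B \subset A) && (2 <= #|B|)%N)
     (k`!%:R : R[i]) * (#|partitions_ge2 (A :\: B)%SET k|)%:R =
   \sum_(B : {set T} | (B \subset A) && (2 <= #|B|)%N)
     (#|A| - #|B|)%N`!%:R * (vseries ^+ k) (#|A| - #|B|)%N.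
  apply: eq_bigr => B /andP[BA _]; rewrite -natrM IH.
  by rewrite cardsD (finset.setIidPr BA).
rewrite big_mkcondr /=.
rewrite (sum_subset_card A (fun j => if (2 <= j)%N then
  (#|A| - j)%N`!%:R * (vseries ^+ k) (#|A| - j)%N else 0)).
rewrite exprS fpsME mulr_sumr; apply: eq_bigr => -[j jA] _ /=.
rewrite [vseries j]/vseries; case: ifP => _; last by rewrite mul0r mulr0 mul0rn.
rewrite ltnS in jA; rewrite -(bin_fact jA) !natrM -mulr_natl.
have j0 : j`!%:R != 0 :> R[i] by rewrite pnatr_eq0 -lt0n fact_gt0.
by move: ((vseries ^+ k) _) => X; field.
Qed.

Lemma dil_exp t (a : fps R) k : dil t (a ^+ k) = dil t a ^+ k.
Proof. by elim: k => [|k IH]; rewrite ?expr0 ?dil1// !exprS dilM IH. Qed.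

Lemma useries_vseries (b : R) : useries b = - dil (- lambert_rho b) vseries.
Proof.
apply/funext => n; rewrite /useries /hseries !(fpsDE, fpsNE) fpsCM.
rewrite /fps_exp /dil /fpsX /vseries fps1E.
set r := lambert_rho b.
have rE : (- r)%:C = - r%:C :> R[i] by rewrite rmorphN.
rewrite rE; case: n => [|[|n]].
- by rewrite !expr0 /= fact0; field.
- by rewrite /= !expr1 factS fact0; field.
- by rewrite /= mulr0 !add0r mulrC.
Qed.

(* k! S(n, k) / n! are the coefficients of (e^x - 1 - x)^k *)
Lemma useries_exp_coef (b : R) n k : (useries b ^+ k) n =
  (-1) ^+ (n + k) * (lambert_rho b)%:C ^+ n * (k`!%:R * (stirling2_ge2 n k)%:R / n`!%:R).
Proof.
have := partitions_ge2_coef [set: 'I_n]%SET k.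
rewrite cardsT card_ord natrM => h.
have -> : (stirling2_ge2 n k) = #|partitions_ge2 [set: 'I_n]%SET k| by [].
rewrite h useries_vseries (exprNn (dil (- lambert_rho b) vseries)) -dil_exp.
have -> : (-1 : fps R) ^+ k = fpsC ((-1) ^+ k).
  elim: k {h} => [|k IH]; first by rewrite !expr0 fpsC1.
  rewrite !exprS IH fpsC_mul; congr (_ * _).
  by apply/funext => m; rewrite fpsNE fps1E /fpsC mulN1r.
rewrite fpsCM /dil rmorphN /= [(- _) ^+ n]exprNn exprD.
have n0 : n`!%:R != 0 :> R[i] by rewrite pnatr_eq0 -lt0n fact_gt0.
by move: (_ n) => X; field.
Qed.

End StirlingSeries.

(** * The substitution of [c x] for [x] in Lebesgue integrals *)

Section LebesgueScaling.
Variable R : realType.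
Local Notation mu := (@lebesgue_measure R).

Definition scal (c : R) : measurableTypeR R -> measurableTypeR R := fun x => c * x.

Lemma measurable_scal c : measurable_fun [set: measurableTypeR R] (scal c).
Proof. by apply: measurable_funM. Qed.

Definition push_scal (c : R) : {measure set (measurableTypeR R) -> \bar R}.
Proof.
refine (pushforward mu (scal c) : {measure set (measurableTypeR R) -> \bar R}).
exact: measurable_scal.
Defined.

Lemma scal_preimage_pos (c : R) : 0 < c ->
  scal c @^-1` `]0%R, +oo[%classic = `]0%R, +oo[%classic.
Proof.
by move=> c0; apply/seteqP; split=> x /=; rewrite /scal !in_itv /= !andbT pmulr_rgt0.
Qed.

(** The image measure times [c] gives the right length to half-open intervals, which characterises
    Lebesgue measure. *)
Lemma lebesgue_measure_scal (c : R) (c0 : 0 < c) (A : set (measurableTypeR R)) :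
  measurable A -> mu A = mscale (NngNum (ltW c0)) (push_scal c) A.
Proof.
move=> mA; apply: lebesgue_measure_unique => //= _ [[a b]] _ <-.
rewrite /mscale /push_scal /= /pushforward.
have -> : scal c @^-1` `]a, b]%classic = `]a / c, b / c]%classic.
  by apply/seteqP; split=> x /=; rewrite /scal !in_itv /= ltr_pdivrMr// ler_pdivlMr//
    mulrC.
rewrite !lebesgue_measure_itv /= !lte_fin ltr_pM2r ?invr_gt0//.
case: ifPn => ab; last by rewrite mule0.
rewrite -!EFinB -EFinM; congr EFin.
by rewrite -mulrBl mulrCA divff ?mulr1// gt_eqF.
Qed.

Lemma ge0_integral_scal (c : R) (f : R -> \bar R) : 0 < c ->
  measurable_fun [set: measurableTypeR R] f -> (forall x, 0 <= f x)%E ->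
  (\int[mu]_(x in `]0%R, +oo[) f x =
   c%:E * \int[mu]_(x in `]0%R, +oo[) f (c * x)%R)%E.
Proof.
move=> c0 mf f0.
pose m : {measure set (measurableTypeR R) -> \bar R} := mscale (NngNum (ltW c0)) (push_scal c).
transitivity (\int[m]_(x in `]0%R, +oo[) f x)%E.
  by apply: eq_measure_integral => A mA _; exact: lebesgue_measure_scal.
have mfD : measurable_fun (`]0%R, +oo[%classic : set (measurableTypeR R)) f.
  exact: measurable_funS mf.
rewrite /m ge0_integral_mscale//=.
have h := @ge0_integral_pushforward _ _ _ _ _ _ (measurable_scal c) mu
  `]0%R, +oo[%classic f (measurable_itv _) mfD (fun y _ => f0 y).
by rewrite h scal_preimage_pos.
Qed.

Lemma fine_mulB (c : R) (x y : \bar R) : 0 < c ->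
  (c%:E * x)%E \is a fin_num -> (c%:E * y)%E \is a fin_num ->
  fine (c%:E * x - c%:E * y)%E = c * fine (x - y)%E.
Proof.
move=> c0.
have F z : (c%:E * z)%E \is a fin_num -> exists r, z = r%:E.
  case: z => [r _| |]; first by exists r.
    by rewrite gt0_muley ?lte_fin.
  by rewrite gt0_muleNy ?lte_fin.
by move=> /F[r ->] /F[r' ->]; rewrite -!EFinM -!EFinB /= mulrBr.
Qed.

(** Positive and negative parts are scaled separately; integrability of [f] makes both scaled
    integrals finite, so the difference can be taken in [R]. *)
Lemma Rintegral_scal (c : R) (f : R -> R) : 0 < c ->
  measurable_fun [set: measurableTypeR R] f ->
  mu.-integrable `]0%R, +oo[ (EFin \o f) ->
  \int[mu]_(x in `]0%R, +oo[) f x = c * \int[mu]_(x in `]0%R, +oo[) f (c * x).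
Proof.
move=> c0 mf If; rewrite /Rintegral.
have mF : measurable_fun [set: measurableTypeR R] (EFin \o f) by exact/measurable_EFinP.
have hp := @ge0_integral_scal c _ c0 (measurable_funepos mF) (funepos_ge0 _).
have hn := @ge0_integral_scal c _ c0 (measurable_funeneg mF) (funeneg_ge0 _).
rewrite /= in hp hn.
have mI : measurable (`]0%R, +oo[%classic : set (measurableTypeR R)) by [].
have Ip := integrable_funepos mI If.
have In := integrable_funeneg mI If.
have fP := integrable_fin_num mI Ip; have fN := integrable_fin_num mI In.
pose P := (\int[mu]_(x in `]0%R, +oo[) ((EFin \o f)^\+)%E (c * x)%R)%E.
pose N := (\int[mu]_(x in `]0%R, +oo[) ((EFin \o f)^\-)%E (c * x)%R)%E.
have hL : (\int[mu]_(x in `]0%R, +oo[) (f x)%:E = c%:E * P - c%:E * N)%E.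
  by rewrite -hp -hn [LHS]integralE; congr (_ - _)%E; apply: eq_integral.
have hR : (\int[mu]_(x in `]0%R, +oo[) (f (c * x)%R)%:E = P - N)%E.
  rewrite [LHS]integralE.
  have eP : (\int[mu]_(x in `]0%R, +oo[) ((fun x => (f (c * x)%R)%:E)^\+)%E x = P)%E.
    by apply: eq_integral => x _; rewrite !funeposE.
  have eN : (\int[mu]_(x in `]0%R, +oo[) ((fun x => (f (c * x)%R)%:E)^\-)%E x = N)%E.
    by apply: eq_integral => x _; rewrite !funenegE.
  by rewrite eP eN.
rewrite hL hR; rewrite hp -/P in fP; rewrite hn -/N in fN.
exact: fine_mulB.
Qed.

End LebesgueScaling.

(** * Complex-valued integrals over the positive half-line *)

Section ComplexIntegral.
Variable R : realType.
Local Notation mu := (@lebesgue_measure R).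
Let D : set (measurableTypeR R) := `]0%R, +oo[%classic.
Implicit Types (F : R -> R[i]) (G : R -> R).

Definition Cint F : R[i] :=
  (\int[mu]_(t in D) complex.Re (F t)) +i* (\int[mu]_(t in D) complex.Im (F t)).

Definition Cmeasurable F :=
  measurable_fun [set: measurableTypeR R] (fun t => complex.Re (F t)) /\
  measurable_fun [set: measurableTypeR R] (fun t => complex.Im (F t)).

Definition Cintegrable F :=
  mu.-integrable D (fun t => (complex.Re (F t))%:E) /\
  mu.-integrable D (fun t => (complex.Im (F t))%:E).

Let mD : measurable D. Proof. exact: measurable_itv. Qed.

Lemma Cintegrable_le F G : Cmeasurable F -> mu.-integrable D (EFin \o G) ->
  (forall t, 0 < t -> normc (F t) <= G t) -> Cintegrable F.
Proof.
move=> [mR mI] iG h.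
have le1 t : D t -> normc (F t) <= G t by rewrite /D /= in_itv /= andbT; exact: h.
split; apply: (le_integrable mD _ _ iG).
- by apply/measurable_EFinP; exact: measurable_funS mR.
- move=> t Dt; rewrite /= lee_fin; apply: le_trans (ler_Re_normc _) _.
  by apply: le_trans (le1 _ Dt) _; exact: ler_norm.
- by apply/measurable_EFinP; exact: measurable_funS mI.
- move=> t Dt; rewrite /= lee_fin; apply: le_trans (ler_Im_normc _) _.
  by apply: le_trans (le1 _ Dt) _; exact: ler_norm.
Qed.

Lemma CintegrableD F1 F2 : Cintegrable F1 -> Cintegrable F2 ->
  Cintegrable (fun t => F1 t + F2 t).
Proof.
move=> [a1 b1] [a2 b2]; split.
  apply: eq_integrable (integrableD mD a1 a2) => // t _ /=.
  by case: (F1 t) (F2 t) => [? ?] [? ?].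
apply: eq_integrable (integrableD mD b1 b2) => // t _ /=.
by case: (F1 t) (F2 t) => [? ?] [? ?].
Qed.

Lemma CintD F1 F2 : Cintegrable F1 -> Cintegrable F2 ->
  Cint (fun t => F1 t + F2 t) = Cint F1 + Cint F2.
Proof.
move=> [a1 b1] [a2 b2]; rewrite /Cint addCE; congr (_ +i* _).
  rewrite -RintegralD//; apply: eq_Rintegral => t _.
  by case: (F1 t) (F2 t) => [? ?] [? ?].
rewrite -RintegralD//; apply: eq_Rintegral => t _.
by case: (F1 t) (F2 t) => [? ?] [? ?].
Qed.

Lemma CintegrableZ (z : R[i]) F : Cintegrable F -> Cintegrable (fun t => z * F t).
Proof.
move=> [a b]; case: z => x y; split.
  apply: eq_integrable (integrableB mD (integrableZl mD x a) (integrableZl mD y b)) => //.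
  by move=> t _ /=; case: (F t) => [? ?] /=.
apply: eq_integrable (integrableD mD (integrableZl mD x b) (integrableZl mD y a)) => //.
by move=> t _ /=; case: (F t) => [? ?] /=.
Qed.

Lemma CintZ (z : R[i]) F : Cintegrable F -> Cint (fun t => z * F t) = z * Cint F.
Proof.
move=> [a b]; case: z => x y; rewrite /Cint mulCE.
have Za (w : R) : mu.-integrable D (EFin \o (fun t => w * complex.Re (F t))).
  by apply: eq_integrable (integrableZl mD w a).
have Zb (w : R) : mu.-integrable D (EFin \o (fun t => w * complex.Im (F t))).
  by apply: eq_integrable (integrableZl mD w b).
congr (_ +i* _).
  rewrite -(RintegralZl x mD a) -(RintegralZl y mD b) -RintegralB//.
  by apply: eq_Rintegral => t _; case: (F t).
rewrite -(RintegralZl y mD a) -(RintegralZl x mD b) -RintegralD//.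
by apply: eq_Rintegral => t _; case: (F t).
Qed.

Lemma Cint0 : Cint (fun=> 0) = 0.
Proof.
rewrite /Cint; have -> : \int[mu]_(t in D) complex.Re (0 : R[i]) = 0.
  by rewrite /Rintegral integral0.
by [].
Qed.

Lemma Cintegrable0 : Cintegrable (fun=> 0).
Proof. by split; exact: integrable0. Qed.

Lemma Cint_sum n (c : nat -> R[i]) (F : nat -> R -> R[i]) :
  (forall k, Cintegrable (F k)) ->
  Cintegrable (fun t => \sum_(k < n) c k * F k t) /\
  Cint (fun t => \sum_(k < n) c k * F k t) = \sum_(k < n) c k * Cint (F k).
Proof.
move=> iF; elim: n => [|n [IH1 IH2]].
  rewrite big_ord0 (_ : (fun t => _) = (fun=> 0)); last first.
    by apply/funext => t; rewrite big_ord0.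
  by split; [exact: Cintegrable0 | exact: Cint0].
rewrite (_ : (fun t => _) = (fun t => \sum_(k < n) c k * F k t + c n * F n t)); last first.
  by apply/funext => t; rewrite big_ord_recr.
have i2 := CintegrableZ (c n) (iF n).
by split; [exact: CintegrableD | rewrite CintD// IH2 CintZ// big_ord_recr].
Qed.

Lemma eq_Cint F1 F2 : (forall t, 0 < t -> F1 t = F2 t) -> Cint F1 = Cint F2.
Proof.
move=> h; rewrite /Cint; congr (_ +i* _); apply: eq_Rintegral => t;
  by rewrite inE /D /= in_itv /= andbT => t0; rewrite h.
Qed.

Lemma Cint_scal (c : R) F : 0 < c -> Cmeasurable F -> Cintegrable F ->
  Cint F = c%:C * Cint (fun t => F (c * t)).
Proof.
move=> c0 [mR mI] [iR iI].
have h1 := Rintegral_scal c0 mR iR; have h2 := Rintegral_scal c0 mI iI.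
by rewrite /Cint h1 h2 -[c%:C]/(c +i* 0) mulCE !mul0r subr0 addr0.
Qed.

Lemma Rintegral_dominated (f_ : nat -> R -> R) (f G : R -> R) :
  (forall n, measurable_fun [set: measurableTypeR R] (f_ n)) ->
  (forall t, 0 < t -> f_ ^~ t @ \oo --> f t) ->
  mu.-integrable D (EFin \o G) -> (forall n t, 0 < t -> `|f_ n t| <= G t) ->
  (fun n => \int[mu]_(t in D) f_ n t) @ \oo --> \int[mu]_(t in D) f t.
Proof.
move=> mf cf iG fG.
have Dt t : D t -> 0 < t by rewrite /D /= in_itv /= andbT.
have mF n : measurable_fun D (EFin \o f_ n).
  by apply/measurable_EFinP; exact: measurable_funS (mf n).
have cF t : D t -> (fun n => (EFin \o f_ n) t) @ \oo --> (EFin \o f) t.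
  by move=> /Dt t0; apply: cvg_EFin; [exact: nearW | exact: cf].
have fing t : D t -> (EFin \o G) t \is a fin_num by [].
have absG n t : D t -> (`|(EFin \o f_ n) t| <= (EFin \o G) t)%E.
  by move=> /Dt t0; rewrite /= lee_fin; exact: fG.
have mf' : measurable_fun D (EFin \o f) by exact: (emeasurable_fun_cvg _ _ mF cF).
have iF : mu.-integrable D (EFin \o f).
  apply: (le_integrable mD mf' _ iG) => t /Dt t0; rewrite /= lee_fin.
  have h : (fun n => `|f_ n t|) @ \oo --> `|f t| by apply: cvg_norm; exact: cf.
  rewrite -(cvg_lim _ h)//; apply: limr_le; first exact: cvgP h.
  by apply: nearW => n; apply: le_trans (fG n t t0) _; exact: ler_norm.
have := dominated_cvg mD mF cF fing iG absG.
have fF := integrable_fin_num mD iF.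
rewrite -(fineK fF) => h.
exact: fine_cvg h.
Qed.

Lemma Cint_dominated (F_ : nat -> R -> R[i]) F G :
  (forall n, Cmeasurable (F_ n)) ->
  (forall t, 0 < t -> ((fun n => F_ n t) : nat -> R[i]^o) @ \oo --> (F t : R[i]^o)) ->
  mu.-integrable D (EFin \o G) -> (forall n t, 0 < t -> normc (F_ n t) <= G t) ->
  ((fun n => Cint (F_ n)) : nat -> R[i]^o) @ \oo --> (Cint F : R[i]^o).
Proof.
move=> mF cF iG hG; apply: cvgC_ReIm.
- apply: (@Rintegral_dominated (fun n t => complex.Re (F_ n t)) _ G) => //.
  + by move=> n; case: (mF n).
  + move=> t t0; apply/cvgrPdist_lt => e e0.
    have /cvgC_normcP/(_ _ e0) := cF t t0; apply: filterS => n; apply: le_lt_trans.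
    apply: le_trans (ler_Re_normc _).
    by case: (F t) (F_ n t) => [? ?] [? ?].
  + by move=> n t t0; apply: le_trans (ler_Re_normc _) _; exact: hG.
- apply: (@Rintegral_dominated (fun n t => complex.Im (F_ n t)) _ G) => //.
  + by move=> n; case: (mF n).
  + move=> t t0; apply/cvgrPdist_lt => e e0.
    have /cvgC_normcP/(_ _ e0) := cF t t0; apply: filterS => n; apply: le_lt_trans.
    apply: le_trans (ler_Im_normc _).
    by case: (F t) (F_ n t) => [? ?] [? ?].
  + by move=> n t t0; apply: le_trans (ler_Im_normc _) _; exact: hG.
Qed.

End ComplexIntegral.

(** * Bounded partial sums of the p-series *)

Section PSeriesBound.
Variable R : realType.

(* S_(2n+1) <= 1 + 2^(1-x) S_n, by pairing the terms of even and odd index. *)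
Lemma pseries_bounded (x : R) : 1 < x ->
  exists B, forall n, \sum_(k < n) expR (- (x * ln k.+1%:R)) <= B.
Proof.
move=> x1; pose a k : R := expR (- (x * ln k.+1%:R)).
have a0 k : 0 <= a k by exact: expR_ge0.
have ln_le j k : (j <= k)%N -> ln (j.+1%:R : R) <= ln k.+1%:R.
  by move=> jk; rewrite ler_ln ?posrE ?ltr0n// ler_nat.
have amono j k : (j <= k)%N -> a k <= a j.
  by move=> jk; rewrite /a ler_expR lerN2 ler_pM2l ?ln_le//; lra.
pose q : R := expR ((1 - x) * ln 2).
have ln2 : 0 < ln 2 :> R by rewrite ln_gt0// ltr1n.
have q1 : q < 1 by rewrite /q expR_lt1 nmulr_rlt0//; lra.
(* Index [k] stands for the integer [k + 1], so the odd indices are the even integers [2 (j + 1)];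
   [q] is [2^(1 - x)]. *)
have aodd j : 2 * a j.*2.+1 = q * a j.
  rewrite /a (_ : j.*2.+2 = 2 * j.+1)%N; last by rewrite mul2n.
  rewrite natrM lnM ?posrE ?ltr0n// mulrDr opprD expRD mulrA; congr (_ * _).
  have e2 : 2 = expR (ln 2) :> R by rewrite lnK ?posrE.
  by rewrite /q {1}e2 -expRD; congr expR; ring.
have split2 n : \sum_(k < n.*2.+1) a k = a 0%N + \sum_(j < n) (a j.*2.+1 + a j.*2.+2).
  elim: n => [|n IH]; first by rewrite big_ord1 big_ord0 addr0.
  by rewrite doubleS 2!big_ord_recr /= IH [in RHS]big_ord_recr /= !addrA.
have mono n m : (n <= m)%N -> \sum_(k < n) a k <= \sum_(k < m) a k.
  by move=> nm; exact: ler_sum_ord.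
exists (1 - q)^-1 => n; rewrite -[X in X <= _]/(\sum_(k < n) a k).
(* The sum is bounded by 1 plus [q < 1] times itself, and this is solved for the sum. *)
have h : \sum_(k < n.*2.+1) a k <= 1 + q * \sum_(k < n.*2.+1) a k.
  rewrite {1}split2; apply: lerD; first by rewrite /a ln1 mulr0 oppr0 expR0.
  apply: (@le_trans _ _ (\sum_(j < n) 2 * a j.*2.+1)).
    apply: ler_sum => j _; have := amono j.*2.+1 j.*2.+2 (leqnSn _); lra.
  under eq_bigr do rewrite aodd.
  rewrite -mulr_sumr ler_wpM2l ?expR_ge0// mono//; lia.
apply: (le_trans (mono n n.*2.+1 _)); first lia.
by rewrite -[leRHS]mul1r ler_pdivlMr; lra.
Qed.

End PSeriesBound.

(** * The Gamma kernel, its moments and its integrability *)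

Section GammaKernel.
Variable R : realType.
Local Notation mu := (@lebesgue_measure R).
Let D : set (measurableTypeR R) := `]0%R, +oo[%classic.
Let mD : measurable D. Proof. exact: measurable_itv. Qed.

Lemma normc_cexp (z : R[i]) : normc (cexp z) = expR (complex.Re z).
Proof.
by rewrite /cexp /= !exprMn -mulrDr cos2Dsin2 mulr1 sqrtr_sqr ger0_norm// expR_ge0.
Qed.

(** [t^(m-1) e^-t], so that [Cint (gamma_ker m)] is [Gamma(m)]; [gamma_abs] is its modulus. *)
Definition gamma_ker (m : R[i]) (t : R) : R[i] := cexp ((m - 1) * (ln t)%:C - t%:C).
Definition gamma_abs (x t : R) : R := expR ((x - 1) * ln t - t).

Lemma gamma_kerE m t : gamma_ker m t =
  (gamma_abs (complex.Re m) t * cos (complex.Im m * ln t)) +i*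
  (gamma_abs (complex.Re m) t * sin (complex.Im m * ln t)).
Proof.
case: m => x y; rewrite /gamma_ker /gamma_abs /cexp /=.
by rewrite !mulr0 !subr0 add0r.
Qed.

Lemma normc_gamma_ker m t : normc (gamma_ker m t) = gamma_abs (complex.Re m) t.
Proof.
case: m => x y; rewrite normc_cexp /gamma_abs /=.
by rewrite !mulr0 !subr0.
Qed.

Lemma gamma_ker_real x t : gamma_ker x%:C t = (gamma_abs x t)%:C.
Proof. by rewrite gamma_kerE /= mul0r cos0 sin0 mulr1 mulr0. Qed.

Lemma measurable_gamma_abs x : measurable_fun [set: measurableTypeR R] (gamma_abs x).
Proof.
apply: (measurableT_comp (@measurable_expR R)); apply: measurable_funB => //.
exact: measurable_funM.
Qed.

Let measurable_mul_ln (y : R) : measurable_fun [set: measurableTypeR R] (fun t => y * ln t).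
Proof. exact: measurable_funM. Qed.

Lemma Cmeasurable_gamma_ker m : Cmeasurable (gamma_ker m).
Proof.
split; under eq_fun do rewrite gamma_kerE /=; apply: measurable_funM;
  try exact: measurable_gamma_abs.
- apply: (measurableT_comp _ (measurable_mul_ln _)).
  by apply: continuous_measurable_fun; exact: continuous_cos.
- apply: (measurableT_comp _ (measurable_mul_ln _)).
  by apply: continuous_measurable_fun; exact: continuous_sin.
Qed.

Lemma CmeasurableM (F1 F2 : R -> R[i]) : Cmeasurable F1 -> Cmeasurable F2 ->
  Cmeasurable (fun t => F1 t * F2 t).
Proof.
move=> [a1 b1] [a2 b2]; split.
  rewrite (_ : (fun t => _) = (fun t => complex.Re (F1 t) * complex.Re (F2 t) -
    complex.Im (F1 t) * complex.Im (F2 t))).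
    by apply: measurable_funB; apply: measurable_funM.
  by apply/funext => t; case: (F1 t) (F2 t) => [? ?] [? ?].
rewrite (_ : (fun t => _) = (fun t => complex.Re (F1 t) * complex.Im (F2 t) +
  complex.Im (F1 t) * complex.Re (F2 t))).
  by apply: measurable_funD; apply: measurable_funM.
by apply/funext => t; case: (F1 t) (F2 t) => [? ?] [? ?].
Qed.

Lemma CmeasurableD (F1 F2 : R -> R[i]) : Cmeasurable F1 -> Cmeasurable F2 ->
  Cmeasurable (fun t => F1 t + F2 t).
Proof.
move=> [a1 b1] [a2 b2]; split.
  rewrite (_ : (fun t => _) = (fun t => complex.Re (F1 t) + complex.Re (F2 t))).
    exact: measurable_funD.
  by apply/funext => t; case: (F1 t) (F2 t) => [? ?] [? ?].
rewrite (_ : (fun t => _) = (fun t => complex.Im (F1 t) + complex.Im (F2 t))).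
  exact: measurable_funD.
by apply/funext => t; case: (F1 t) (F2 t) => [? ?] [? ?].
Qed.

Lemma Cmeasurable_cst (z : R[i]) : Cmeasurable (fun=> z).
Proof. by split; exact: measurable_cst. Qed.

Lemma Cmeasurable_sum n (c : nat -> R[i]) (F : nat -> R -> R[i]) :
  (forall k, Cmeasurable (F k)) -> Cmeasurable (fun t => \sum_(k < n) c k * F k t).
Proof.
move=> mF; elim: n => [|n IH].
  rewrite (_ : (fun t => _) = (fun=> 0)); first exact: Cmeasurable_cst.
  by apply/funext => t; rewrite big_ord0.
rewrite (_ : (fun t => _) = (fun t => \sum_(k < n) c k * F k t + c n * F n t)).
  by apply: CmeasurableD => //; apply: CmeasurableM => //; exact: Cmeasurable_cst.
by apply/funext => t; rewrite big_ord_recr.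
Qed.

Definition ekt (k : nat) (t : R) : R := expR (- (k%:R * t)).

Lemma Cmeasurable_gamma_ker_ekt m k : Cmeasurable (fun t => gamma_ker m t * (ekt k t)%:C).
Proof.
apply: CmeasurableM; first exact: Cmeasurable_gamma_ker.
split => /=; last exact: measurable_cst.
by apply: (measurableT_comp (@measurable_expR R)); apply: measurable_funN;
  apply: measurable_funM.
Qed.

Lemma integrable_gamma_abs x : 1 < x -> mu.-integrable D (EFin \o gamma_abs x).
Proof.
move=> x1.
(* The kernel is at most [C e^(-t/2)], by [ln y <= y - 1] at [y = t / (2 (x - 1))]. The exponential
   density of rate 1/2 carries a factor 1/2, whence [C * 2]. *)
pose C := expR ((x - 1) * (ln (2 * (x - 1)) - 1)).
have mg : measurable_fun D (EFin \o gamma_abs x).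
  by apply/measurable_EFinP; exact: measurable_funS (measurable_gamma_abs x).
have half : 0 < 2^-1 :> R by lra.
have iE : mu.-integrable D (fun t => (C * 2)%:E * (EFin \o exponential_pdf (2^-1 : R)) t)%E.
  apply: integrableZl => //.
  by apply: (integrableS _ _ _ (integrable_exponential_pdf half)).
apply: (le_integrable mD mg _ iE) => t; rewrite /D /= in_itv /= andbT => t0.
rewrite lee_fin !ger0_norm ?expR_ge0//; last first.
  by rewrite !mulr_ge0 ?expR_ge0 ?exponential_pdf_ge0// ltW.
have -> : C * 2 * exponential_pdf 2^-1 t = expR ((x - 1) * (ln (2 * (x - 1)) - 1) - 2^-1 * t).
  by rewrite exponential_pdfE ?ltW// expRD -/C -mulNr; move: (expR _) => Y; field.
rewrite /gamma_abs ler_expR.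
have A0 : 0 < 2 * (x - 1) by lra.
have : ln (t / (2 * (x - 1))) <= t / (2 * (x - 1)) - 1.
  have := @le_ln1Dx R (t / (2 * (x - 1)) - 1).
  have -> : 1 + (t / (2 * (x - 1)) - 1) = t / (2 * (x - 1)) by ring.
  have tA : 0 < t / (2 * (x - 1)) by rewrite divr_gt0.
  by apply; lra.
rewrite ln_div ?posrE// => h.
have h2 : (x - 1) * (ln t - ln (2 * (x - 1))) <= (x - 1) * (t / (2 * (x - 1)) - 1).
  by rewrite ler_pM2l//; lra.
have E : (x - 1) * (t / (2 * (x - 1)) - 1) = t / 2 - (x - 1).
  by field; rewrite lt0r_neq0//; lra.
rewrite E in h2; move: h2; rewrite !mulrBr mulr1; lra.
Qed.

Lemma ekt_le1 k t : 0 < t -> ekt k t <= 1.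
Proof. by move=> t0; rewrite expR_le1 oppr_le0 mulr_ge0// ltW. Qed.

Lemma Cintegrable_gamma_ker_ekt m k : 1 < complex.Re m ->
  Cintegrable (fun t => gamma_ker m t * (ekt k t)%:C).
Proof.
move=> hm; apply: (Cintegrable_le (Cmeasurable_gamma_ker_ekt m k) (integrable_gamma_abs hm)).
move=> t t0; rewrite normcM normc_gamma_ker normcR ger0_norm ?expR_ge0//.
by rewrite ler_piMr ?expR_ge0// ekt_le1.
Qed.

Lemma Cintegrable_gamma_ker m : 1 < complex.Re m -> Cintegrable (gamma_ker m).
Proof.
move=> hm; apply: (Cintegrable_le (Cmeasurable_gamma_ker m) (integrable_gamma_abs hm)).
by move=> t t0; rewrite normc_gamma_ker.
Qed.

Lemma cexp_neq0 (z : R[i]) : cexp z != 0.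
Proof. by rewrite -normc_gt0 normc_cexp expR_gt0. Qed.

(* Substituting (k+1) t for t in the Gamma integral. *)
Lemma gamma_ker_moment m k : 1 < complex.Re m ->
  Cint (fun t => gamma_ker m t * (ekt k t)%:C) = Cint (gamma_ker m) / cpow k.+1%:R m.
Proof.
move=> hm.
have k0 : 0 < k.+1%:R :> R by rewrite ltr0n.
have h := Cint_scal k0 (Cmeasurable_gamma_ker m) (Cintegrable_gamma_ker hm).
have E t : 0 < t -> gamma_ker m (k.+1%:R * t) =
    cexp ((m - 1) * (ln k.+1%:R)%:C) * (gamma_ker m t * (ekt k t)%:C).
  move=> t0; have -> : (ekt k t)%:C = cexp (- (k%:R * t)%:C).
    by rewrite -[- _%:C]/((- (k%:R * t)) +i* (- 0)) oppr0 /cexp /= cos0 sin0 mulr1 mulr0.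
  rewrite -!cexpD /gamma_ker; congr cexp; rewrite lnM ?posrE// !rmorphD !rmorphM /= -natr1.
  rewrite rmorphD /= rmorph1; ring.
rewrite (eq_Cint E) (CintZ _ (Cintegrable_gamma_ker_ekt k hm)) mulrA in h.
rewrite h; have -> : (k.+1%:R : R)%:C * cexp ((m - 1) * (ln k.+1%:R)%:C) = cpow k.+1%:R m.
  have -> : (k.+1%:R : R)%:C = cexp (ln k.+1%:R)%:C.
    by rewrite /cexp /= cos0 sin0 mulr1 mulr0 lnK ?posrE.
  by rewrite -cexpD /cpow; congr cexp; ring.
by rewrite mulrAC divff ?mul1r//; exact: cexp_neq0.
Qed.

(** Monotone convergence along the geometric sums in [e^-t]: their integrals are [Gamma(x)] times
    partial sums of the p-series, bounded since [x > 1]. *)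
Lemma integrable_gamma_abs_geometric x : 1 < x ->
  mu.-integrable D (EFin \o (fun t => gamma_abs x t / (1 - expR (- t)))).
Proof.
move=> x1.
have xR : 1 < complex.Re (x%:C : R[i]) by [].
have [B hB] := pseries_bounded x1.
pose G n t := gamma_abs x t * \sum_(k < n) ekt k t.
have G0 n t : 0 <= G n t.
  by rewrite mulr_ge0 ?expR_ge0// sumr_ge0// => k _; exact: expR_ge0.
have iG n : mu.-integrable D (EFin \o G n) /\
    \int[mu]_(t in D) G n t <= `|complex.Re (Cint (gamma_ker x%:C))| * B.
  have [] := @Cint_sum R n (fun=> 1) (fun k t => gamma_ker x%:C t * (ekt k t)%:C)
    (fun k => Cintegrable_gamma_ker_ekt k xR).
  have E t : \sum_(k < n) 1 * (gamma_ker x%:C t * (ekt k t)%:C) = (G n t)%:C.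
    rewrite /G gamma_ker_real rmorphM /= rmorph_sum /= mulr_sumr.
    by apply: eq_bigr => k _; rewrite mul1r.
  under eq_fun do rewrite E.
  rewrite /Cintegrable /Cint /= => -[iR _] h; split=> //.
  have := congr1 (@complex.Re R) h => /= ->.
  have -> : \sum_(k < n) 1 * Cint (fun t => gamma_ker x%:C t * (ekt k t)%:C) =
      Cint (gamma_ker x%:C) * (\sum_(k < n) expR (- (x * ln k.+1%:R)))%:C.
    rewrite rmorph_sum /= mulr_sumr; apply: eq_bigr => k _.
    rewrite mul1r gamma_ker_moment//; congr (_ * _).
    have -> : cpow k.+1%:R x%:C = (expR (x * ln k.+1%:R))%:C :> R[i].
      by rewrite /cpow -rmorphM /= /cexp /= cos0 sin0 mulr1 mulr0.
    by rewrite -fmorphV /= expRN.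
  set S := \sum_(k < n) _; have S0 : 0 <= S by apply: sumr_ge0 => k _; exact: expR_ge0.
  have -> : complex.Re (Cint (gamma_ker x%:C) * S%:C) = complex.Re (Cint (gamma_ker x%:C)) * S.
    by case: (Cint (gamma_ker x%:C)) => c d; rewrite /= mulr0 subr0.
  apply: (@le_trans _ _ (`|complex.Re (Cint (gamma_ker x%:C))| * S)).
    by rewrite ler_wpM2r// ler_norm.
  by rewrite ler_wpM2l//; exact: hB.
have mG n : measurable_fun D (EFin \o G n) by have [+ _] := iG n => /measurable_int.
have cvG t : D t -> (fun n => (EFin \o G n) t) @ \oo --> (gamma_abs x t / (1 - expR (- t)))%:E.
  rewrite /D /= in_itv /= andbT => t0; apply: cvg_EFin; first exact: nearW.
  apply: cvgMl_tmp.
  have e1 : `|expR (- t)| < 1 by rewrite ger0_norm ?expR_ge0// expR_lt1 oppr_lt0.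
  have := cvg_geometric_series (a := 1) e1; rewrite mul1r; apply: cvg_trans.
  apply: near_eq_cvg; apply: nearW => n; rewrite /series /= big_mkord.
  by apply: eq_bigr => k _; rewrite /geometric /= mul1r /ekt -mulrN expRM_natl.
have mlim : measurable_fun D (fun t => (gamma_abs x t / (1 - expR (- t)))%:E).
  exact: (emeasurable_fun_cvg _ _ mG cvG).
apply/integrableP; split=> //.
have ndG t : D t -> {homo (fun n => (EFin \o G n) t) : n m / (n <= m)%N >-> (n <= m)%E}.
  move=> _ n m nm; rewrite /= lee_fin ler_wpM2l ?expR_ge0//.
  by apply: (ler_sum_ord (f := fun k => ekt k t)) => // k; exact: expR_ge0.
have mc := @cvg_monotone_convergence _ _ _ mu D mD (fun n => EFin \o G n) mG
  (fun n t _ => G0 n t) ndG.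
apply: (@le_lt_trans _ _ (`|complex.Re (Cint (gamma_ker x%:C))| * B)%:E); last by rewrite ltry.
have -> : (\int[mu]_(t in D) `|(gamma_abs x t / (1 - expR (- t)))%:E| =
    \int[mu]_(t in D) limn (fun n => (EFin \o G n) t))%E.
  apply: eq_integral => t; rewrite inE => Dt.
  rewrite (cvg_lim _ (cvG t Dt))// gee0_abs// lee_fin divr_ge0 ?expR_ge0//.
  move: Dt; rewrite /D /= in_itv /= andbT => t0.
  by rewrite subr_ge0 expR_le1 oppr_le0 ltW.
rewrite -(cvg_lim _ mc)//; apply: lime_le; first exact: cvgP mc.
apply: nearW => n; have [iGn hn] := iG n.
by rewrite -(fineK (integrable_fin_num mD iGn)) lee_fin.
Qed.

End GammaKernel.

(** * Nonvanishing of the Gamma integral, and passage to the limit under it *)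

Section GammaNonzero.
Variable R : realType.
Local Notation mu := (@lebesgue_measure R).
Let D : set (measurableTypeR R) := `]0%R, +oo[%classic.
Let mD : measurable D. Proof. exact: measurable_itv. Qed.
Variable m : R[i].
Hypothesis hm : 1 < complex.Re m.

Lemma ReM (x y : R[i]) : complex.Re (x * y) =
  complex.Re x * complex.Re y - complex.Im x * complex.Im y.
Proof. by case: x y => [? ?] [? ?]. Qed.

Lemma Cint_gamma_ker_poly n (c : nat -> R[i]) :
  Cint (fun t => gamma_ker m t * \sum_(k < n) c k * (ekt k t)%:C) =
  Cint (gamma_ker m) * \sum_(k < n) c k / cpow k.+1%:R m.
Proof.
have [_ h] := Cint_sum n c (fun k => Cintegrable_gamma_ker_ekt k hm).
transitivity (Cint (fun t => \sum_(k < n) c k * (gamma_ker m t * (ekt k t)%:C))).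
  by apply: eq_Cint => t _; rewrite mulr_sumr; apply: eq_bigr => k _; rewrite mulrCA.
rewrite h mulr_sumr; apply: eq_bigr => k _.
by rewrite gamma_ker_moment// mulrCA.
Qed.

Lemma Cintegrable_gamma_ker_poly n (c : nat -> R[i]) :
  Cintegrable (fun t => gamma_ker m t * \sum_(k < n) c k * (ekt k t)%:C).
Proof.
have [h _] := Cint_sum n c (fun k => Cintegrable_gamma_ker_ekt k hm).
rewrite (_ : (fun t => _) = (fun t => \sum_(k < n) c k * (gamma_ker m t * (ekt k t)%:C)))//.
by apply/funext => t; rewrite mulr_sumr; apply: eq_bigr => k _; rewrite mulrCA.
Qed.

Lemma gamma_abs_continuous (x t : R) : 0 < t -> {for t, continuous (gamma_abs x)}.
Proof.
move=> t0; apply: (@continuous_comp _ _ _ (fun t => (x - 1) * ln t - t) (@expR R)).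
  apply: cvgB; last exact: cvg_id.
  by apply: cvgMl_tmp; exact: continuous_ln.
exact: continuous_expR.
Qed.

(* If the Gamma integral vanished, then the kernel, turned so as to be positive
   at ln 2, would be orthogonal to every polynomial in e^-t, in particular to the
   powers of 4 e^-t (1 - e^-t), which peak at ln 2. *)
Lemma Cint_gamma_ker_neq0 : Cint (gamma_ker m) != 0.
Proof.
apply/eqP => K0.
pose t0 : R := ln 2; have t00 : 0 < t0 by rewrite ln_gt0// ltr1n.
have e0 : expR (- t0) = 2^-1 by rewrite expRN lnK ?posrE.
pose x0 := complex.Re (gamma_ker m t0); pose y0 := complex.Im (gamma_ker m t0).
(* The real part of [gamma_ker m t] times the conjugate of its value at [t0], hence positive at
   [t0]. *)
pose th t := x0 * complex.Re (gamma_ker m t) + y0 * complex.Im (gamma_ker m t).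
have ith : mu.-integrable D (EFin \o th).
  have [] := CintegrableZ (x0 -i* y0) (Cintegrable_gamma_ker hm) => h _.
  by apply: eq_integrable h => // t _; rewrite ReM /= mulNr opprK.
have orth (p : {poly R}) :
    mu.-integrable D (EFin \o (fun t => th t * p.[expR (- t)])) /\
    \int[mu]_(t in D) (th t * p.[expR (- t)]) = 0.
  have E t : (p.[expR (- t)])%:C = \sum_(k < size p) (p`_k)%:C * (ekt k t)%:C :> R[i].
    rewrite horner_coef rmorph_sum /=; apply: eq_bigr => k _.
    by rewrite rmorphM /= /ekt -mulrN expRM_natl.
  have h1 := Cint_gamma_ker_poly (size p) (fun k => (p`_k)%:C).
  have h2 := Cintegrable_gamma_ker_poly (size p) (fun k => (p`_k)%:C).
  rewrite K0 mul0r in h1.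
  have h3 := CintZ (x0 -i* y0) h2; rewrite h1 mulr0 in h3.
  have [h4 _] := CintegrableZ (x0 -i* y0) h2.
  have F t : complex.Re ((x0 -i* y0) * (gamma_ker m t * \sum_(k < size p) (p`_k)%:C * (ekt k t)%:C))
      = th t * p.[expR (- t)].
    rewrite -E /th; move: (x0) (y0) (gamma_ker m t) (p.[_]) => X Y [u v] z /=.
    ring.
  split; first by apply: eq_integrable h4 => // t _ /=; rewrite F.
  have := congr1 (@complex.Re R) h3; rewrite /Cint /= => h5; rewrite -[RHS]h5.
  by apply: eq_Rintegral => t _; rewrite F.
pose ep := th t0 / 2.
have tht0 : 0 < th t0.
  rewrite /th -/x0 -/y0 -!expr2 -normc_sqr exprn_gt0// normc_gamma_ker; exact: expR_gt0.
have ep0 : 0 < ep by rewrite /ep; lra.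
have cth : {for t0, continuous th}.
  have cl := continuous_ln t00.
  have cg := gamma_abs_continuous (x := complex.Re m) t00.
  have cc : {for t0, continuous (fun t => cos (complex.Im m * ln t))}.
    apply: (@continuous_comp _ _ _ (fun t => complex.Im m * ln t) (@cos R)).
      by apply: cvgMl_tmp; exact: cl.
    exact: continuous_cos.
  have cs : {for t0, continuous (fun t => sin (complex.Im m * ln t))}.
    apply: (@continuous_comp _ _ _ (fun t => complex.Im m * ln t) (@sin R)).
      by apply: cvgMl_tmp; exact: cl.
    exact: continuous_sin.
  rewrite (_ : th = (fun t => x0 * (gamma_abs (complex.Re m) t * cos (complex.Im m * ln t)) +
     y0 * (gamma_abs (complex.Re m) t * sin (complex.Im m * ln t)))); last first.
    by apply/funext => t; rewrite /th gamma_kerE.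
  by apply: cvgD; apply: cvgMl_tmp; apply: cvgM; [exact: cg|exact: cc|exact: cg|exact: cs].
have [dl dl0 hdl] : exists2 dl : R, 0 < dl & forall t, `|t - t0| < dl -> ep < th t.
  move/cvgrPdist_lt: cth => /(_ ep ep0)[dl /= dl0 h]; exists dl => // t ht.
  have := h t; rewrite /ball /= distrC => /(_ ht).
  by move=> /ltr_distlDr; rewrite /ep; lra.
pose s1 := expR (- (t0 + dl)); pose s2 := expR (- (t0 - dl)).
have hs1 : s1 < 2^-1 by rewrite -e0 ltr_expR; lra.
have hs2 : 2^-1 < s2 by rewrite -e0 ltr_expR; lra.
have s10 : 0 < s1 by exact: expR_gt0.
pose x := Num.min (2^-1 - s1) (s2 - 2^-1).
have x0' : 0 < x by rewrite lt_min; apply/andP; split; lra.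
have x1 : x < 2^-1 by rewrite gt_min; apply/orP; left; lra.
pose pk t : R := 4 * (expR (- t) * (1 - expR (- t))).
have pkE t : pk t = 1 - 4 * (expR (- t) - 2^-1) ^+ 2 by rewrite /pk; field.
(* [pk <= l] once [e^-t] is at distance at least [x] from 1/2, and [pk >= l'] up to distance
   [x / 2]; the gap [l < l'] makes the powers of [pk / l'] concentrate. *)
pose l : R := 1 - 4 * x ^+ 2; pose l' : R := 1 - x ^+ 2.
have x2 : 0 < x ^+ 2 by rewrite exprn_gt0.
have x2' : x ^+ 2 < 4^-1.
  have -> : 4^-1 = 2^-1 ^+ 2 :> R by field.
  by rewrite ltr_pXn2r ?nnegrE//; lra.
have l0 : 0 < l by rewrite /l; lra.
have l'0 : 0 < l' by rewrite /l'; lra.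
have out t : dl <= `|t - t0| -> pk t <= l.
  move=> ht; rewrite pkE /l lerD2l lerN2 ler_pM2l// -[leRHS]real_normK ?num_real//.
  rewrite lerXn2r ?nnegrE ?(ltW x0')//.
  move: ht; rewrite ler_normr => /orP[h|h].
    apply: (@le_trans _ _ (2^-1 - s1)); first by rewrite ge_min lexx.
    rewrite distrC; apply: le_trans (ler_norm _); rewrite lerD2l lerN2 ler_expR; lra.
  apply: (@le_trans _ _ (s2 - 2^-1)); first by rewrite ge_min lexx orbT.
  apply: le_trans (ler_norm _); rewrite lerD2r ler_expR; lra.
have [d1 d10 hd1] : exists2 d : R, 0 < d & forall t, `|t - t0| < d -> l' <= pk t.
  have ce : {for t0, continuous (fun t : R => expR (- t))}.
    apply: (@continuous_comp _ _ _ (fun t : R => - t) (@expR R)).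
      by apply: cvgN; exact: cvg_id.
    exact: continuous_expR.
  have hx : 0 < x / 2 by lra.
  move/cvgrPdist_lt: ce => /(_ _ hx)[d /= d0 h]; exists d => // t ht.
  have := h t; rewrite /ball /= distrC => /(_ ht); rewrite e0 distrC => h3.
  rewrite pkE /l' lerD2l lerN2 -[X in 4 * X]real_normK ?num_real//.
  have : `|expR (- t) - 2^-1| ^+ 2 <= (x / 2) ^+ 2.
    by rewrite lerXn2r ?nnegrE ?(ltW hx)// ltW.
  rewrite expr_div_n; lra.
pose d := Num.min d1 dl.
have d0 : 0 < d by rewrite lt_min d10.
pose J : set (measurableTypeR R) := `]t0, (t0 + d)[%classic.
have mJ : measurable J by exact: measurable_itv.
have mJE : mu J = d%:E.
  rewrite /J lebesgue_measure_itv /= lte_fin ltrDl d0 -EFinB; congr EFin; ring.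
pose r := l / l'.
have r1 : r < 1 by rewrite /r ltr_pdivrMr// mul1r /l /l'; lra.
have r0 : 0 <= r by rewrite divr_ge0// ltW.
have pk0 t : 0 < t -> 0 <= pk t.
  by move=> tt; rewrite !mulr_ge0 ?expR_ge0// subr_ge0 expR_le1 oppr_le0 ltW.
(* The orthogonal polynomial [(pk / l')^n] is at least 1 on [J], where [th > ep]; it is at most
   [r^n] outside the window of radius [dl], and inside the window its product with [th] is
   nonnegative. Its integral being 0, the left side is squeezed by [r^n], which tends to 0. *)
have main n : ep * d <= r ^+ n * \int[mu]_(t in D) `|th t|.
  pose p0 : {poly R} := (4 / l')%:P * ('X * (1%:P - 'X)).
  pose p : {poly R} := p0 ^+ n.
  have p0E y : p0.[y] = 4 * (y * (1 - y)) / l'.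
    by rewrite /p0 hornerM hornerC hornerM hornerX hornerD hornerN hornerX hornerC mulrAC.
  have [ip hp] := orth p.
  have pE t : p.[expR (- t)] = (pk t / l') ^+ n.
    by rewrite /p horner_exp p0E.
  have iJ' : mu.-integrable D (EFin \o \1_J).
    have iT := @integrable_indic_itv R t0 (t0 + d) false true.
    by apply: (integrableS _ _ _ iT).
  have iJ : mu.-integrable D (EFin \o (fun t => ep * \1_J t)).
    by apply: eq_integrable (integrableZl mD ep iJ') => //.
  have iA : mu.-integrable D (EFin \o (fun t => r ^+ n * `|th t|)).
    have h : mu.-integrable D (EFin \o (fun t => `|th t|)).
      by apply: eq_integrable (integrable_abse ith) => //.
    by apply: eq_integrable (integrableZl mD (r ^+ n) h) => //.
  have iB : mu.-integrable D (EFin \o (fun t => ep * \1_J t - r ^+ n * `|th t|)).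
    by apply: eq_integrable (integrableB mD iJ iA) => //.
  have pt t : D t -> ep * \1_J t - r ^+ n * `|th t| <= th t * p.[expR (- t)].
    rewrite /D /= in_itv /= andbT => tt; rewrite pE.
    have rn0 : 0 <= r ^+ n * `|th t| by rewrite mulr_ge0// exprn_ge0.
    have [tJ|tJ] := boolP (t \in J).
      rewrite indicE tJ mulr1; move: tJ; rewrite inE /J /= in_itv /= => /andP[h1 h2].
      have tt0 : `|t - t0| < d by rewrite gtr0_norm; lra.
      have ht : ep < th t by apply: hdl; apply: lt_le_trans tt0 _; rewrite ge_min lexx orbT.
      have hq : 1 <= (pk t / l') ^+ n.
        rewrite exprn_ege1// ler_pdivlMr// mul1r; apply: hd1.
        by apply: lt_le_trans tt0 _; rewrite ge_min lexx.
      apply: (@le_trans _ _ (th t)); first lra.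
      by rewrite ler_peMr//; lra.
    rewrite indicE (negbTE tJ) mulr0 sub0r.
    have q0 : 0 <= pk t / l' by rewrite divr_ge0 ?pk0// ltW.
    have [h|h] := ltP `|t - t0| dl.
      apply: (@le_trans _ _ 0); first by rewrite oppr_le0.
      by rewrite mulr_ge0 ?exprn_ge0// ltW// (lt_trans ep0)// hdl.
    have h2 : `|th t * (pk t / l') ^+ n| <= r ^+ n * `|th t|.
      rewrite normrM [`|_ ^+ n|]ger0_norm ?exprn_ge0// mulrC ler_wpM2r//.
      by rewrite lerXn2r ?nnegrE// ler_pM2r ?invr_gt0// out.
    have h3 := ler_norm (- (th t * (pk t / l') ^+ n)); rewrite normrN in h3.
    by rewrite lerNl; exact: le_trans h3 h2.
  have := le_Rintegral mD iB ip pt; rewrite hp.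
  have h := @RintegralB _ _ _ mu D (fun t => ep * \1_J t) (fun t => r ^+ n * `|th t|) mD iJ iA.
  rewrite h.
  have iA' : mu.-integrable D (EFin \o (fun t => `|th t|)).
    by apply: eq_integrable (integrable_abse ith) => //.
  rewrite (RintegralZl ep mD iJ') (RintegralZl (r ^+ n) mD iA').
  have -> : \int[mu]_(t in D) \1_J t = d.
    have JD : J `<=` D.
      move=> t; rewrite /J /D /= !in_itv /= andbT => /andP[t1 _].
      exact: lt_trans t1.
    have hI : (\int[mu]_(t in D) (\1_J t)%:E = d%:E)%E.
      transitivity (mu (J `&` D)); first exact: integral_indic.
      by rewrite -mJE (setIidl JD).
    by rewrite /Rintegral hI.
  lra.
have ab : `|r| < 1 by rewrite ger0_norm.
have := cvg_expr ab.
move=> /(@cvgMr_tmp _ _ _ _ _ _ (\int[mu]_(t in D) `|th t|)); rewrite mul0r.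
have ed : 0 < ep * d by rewrite mulr_gt0.
move=> /cvgrPdist_lt/(_ _ ed)[n _ /(_ n (leqnn n))]; rewrite /= sub0r normrN => h.
by have := le_lt_trans (le_trans (main n) (ler_norm _)) h; rewrite ltxx.
Qed.

(** With [s = e^-t], integration against the kernel turns [s^k] into [(k + 1)^-m] up to the Gamma
    factor, and the assumed bound is an integrable majorant. The limit no longer mentions the
    polynomials, so two different families can be compared through it. *)
Lemma moment_limit (n_ : nat -> nat) (c : nat -> nat -> R[i]) (C : R) :
  (forall s : R, 0 < s < 1 ->
    ((fun N => \sum_(k < n_ N) c N k * (s%:C) ^+ k) : nat -> R[i]^o) @ \oo
      --> ((1 - s%:C)^-1 : R[i]^o)) ->
  (forall N (s : R), 0 < s < 1 ->
    normc (\sum_(k < n_ N) c N k * (s%:C) ^+ k) <= C / (1 - s)) ->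
  ((fun N => \sum_(k < n_ N) c N k / cpow k.+1%:R m) : nat -> R[i]^o) @ \oo -->
  (Cint (fun t => gamma_ker m t / (1 - (expR (- t))%:C)) / Cint (gamma_ker m) : R[i]^o).
Proof.
move=> hc hC.
have sE t k : (ekt k t)%:C = ((expR (- t))%:C) ^+ k :> R[i].
  by rewrite /ekt -mulrN expRM_natl rmorphXn.
have s01 (t : R) : 0 < t -> 0 < expR (- t) < 1.
  by move=> t0; rewrite expR_gt0 expR_lt1 oppr_lt0.
pose F N t := gamma_ker m t * \sum_(k < n_ N) c N k * (ekt k t)%:C.
have mF N : Cmeasurable (F N).
  have h := Cmeasurable_sum (n_ N) (c N) (fun k => Cmeasurable_gamma_ker_ekt m k).
  rewrite (_ : F N = (fun t => \sum_(k < n_ N) c N k * (gamma_ker m t * (ekt k t)%:C)))//.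
  by apply/funext => t; rewrite /F mulr_sumr; apply: eq_bigr => k _; rewrite mulrCA.
have cF t : 0 < t -> ((fun N => F N t) : nat -> R[i]^o) @ \oo -->
    (gamma_ker m t / (1 - (expR (- t))%:C) : R[i]^o).
  move=> t0; have h := hc _ (s01 t t0).
  have -> : ((fun N => F N t) : nat -> R[i]^o) =
      (fun N => gamma_ker m t * (\sum_(k < n_ N) c N k * ((expR (- t))%:C) ^+ k)).
    by apply/funext => N; rewrite /F; congr (_ * _); apply: eq_bigr => k _; rewrite sE.
  exact: cvgMl_tmp h.
have iG : mu.-integrable D (EFin \o (fun t => C * (gamma_abs (complex.Re m) t / (1 - expR (- t))))).
  by apply: eq_integrable (integrableZl mD C (integrable_gamma_abs_geometric hm)) => //.
have bF N t : 0 < t -> normc (F N t) <= C * (gamma_abs (complex.Re m) t / (1 - expR (- t))).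
  move=> t0; rewrite normcM normc_gamma_ker mulrCA ler_wpM2l ?expR_ge0//.
  have := hC N _ (s01 t t0); under eq_bigr do rewrite -sE.
  by [].
have := Cint_dominated mF cF iG bF.
have E N : Cint (F N) = Cint (gamma_ker m) * \sum_(k < n_ N) c N k / cpow k.+1%:R m.
  exact: Cint_gamma_ker_poly.
move=> /(@cvgMr_tmp _ _ _ _ _ _ (Cint (gamma_ker m))^-1); apply: cvg_trans.
apply: near_eq_cvg; apply: nearW => N; rewrite E mulrAC divff ?mul1r//.
exact: Cint_gamma_ker_neq0.
Qed.

End GammaNonzero.

(** * Convergence of both series to a common limit *)

Section FinalSum.
Variable R : realType.
Variable b : R.
Hypothesis hb : is_lambert_pt b.
Local Notation rho := (lambert_rho b).
Local Notation u := (useries b).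

Let u0 : u 0%N = 0.
Proof. by rewrite useries_vseries fpsNE /dil /vseries /= mul0r oppr0. Qed.

Lemma useries_exp_small k n : (n < k)%N -> (u ^+ k) n = 0.
Proof.
elim: k n => // k IH n nk; rewrite exprS fpsME big1// => -[[|i] iN] _ /=.
  by rewrite u0 mul0r.
by rewrite IH ?mulr0//; lia.
Qed.

(** The Taylor coefficients of [1 / (1 - s u)]: the geometric series stops at [k = n] because [u]
    has no constant term. *)
Definition resolvent_coef (s : R[i]) : fps R := fun n => \sum_(k < n.+1) s ^+ k * (u ^+ k) n.

Lemma resolvent_coef_wide s n N : (n < N)%N ->
  resolvent_coef s n = \sum_(k < N) s ^+ k * (u ^+ k) n.
Proof.
move=> nN; rewrite /resolvent_coef.
apply/eqP; rewrite eq_sym -subr_eq0 (sumrB_ord (fun k => s ^+ k * (u ^+ k) n) nN).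
by rewrite big_nat_cond big1// => k /andP[/andP[h _] _]; rewrite useries_exp_small ?mulr0.
Qed.

Lemma resolvent_coefP s : (1 - fpsC s * u) * resolvent_coef s = 1.
Proof.
apply/funext => n; rewrite mulrBl mul1r fpsDE fpsNE -mulrA fpsCM.
have -> : (u * resolvent_coef s) n = \sum_(k < n.+1) s ^+ k * (u ^+ k.+1) n.
  rewrite fpsME; transitivity (\sum_(i < n.+1) \sum_(k < n.+1) u i * (s ^+ k * (u ^+ k) (n - i)%N)).
    apply: eq_bigr => i _; rewrite (@resolvent_coef_wide s _ n.+1) ?ltnS ?leq_subr//.
    by rewrite mulr_sumr.
  rewrite exchange_big /=; apply: eq_bigr => k _.
  by rewrite exprS fpsME mulr_sumr; apply: eq_bigr => i _; rewrite mulrCA.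
rewrite (@resolvent_coef_wide s n n.+2)// big_ord_recl /= expr0 mul1r expr0.
rewrite mulr_sumr -[RHS]addr0 -addrA; congr (_ + _); apply/eqP; rewrite subr_eq0; apply/eqP.
by apply: eq_bigr => k _; rewrite /bump /= add1n [s ^+ k.+1]exprS mulrA.
Qed.

Lemma resolvent_coef_bound : exists C : R, forall s : R, 0 < s < 1 ->
  l1_le (resolvent_coef s%:C) (C / (1 - s)).
Proof.
have [C hC] := resolvent_bound hb; exists C => s /andP[s0 s1].
have [|v hv vM] := hC s; first by rewrite ltW.
suff -> : resolvent_coef s%:C = v by [].
transitivity ((1 - fpsC s%:C * u) * v * resolvent_coef s%:C); first by rewrite hv mul1r.
by rewrite mulrAC resolvent_coefP mul1r.
Qed.

Variable m : R[i].
Hypothesis hm : 1 < complex.Re m.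
(** To be instantiated by [W] and by its conjugate, which share the modulus and the equation. *)
Variable w : R[i].
Hypothesis w_norm : normc w = rho.
Hypothesis w_sol : w + cexp (- w) = 0.

Let rho0 : 0 < rho.
Proof.
rewrite normc_gt0; apply/eqP => -[_ h]; by case: hb => b1 _ _; lra.
Qed.

Let rhoC : rho%:C != 0 :> R[i].
Proof. by rewrite -normc_gt0 normcR gtr0_norm. Qed.

Let om : R[i] := w / rho%:C.

Let om1 : normc om = 1.
Proof.
by rewrite /om normcM normcV w_norm normcR gtr0_norm// divff// lt0r_neq0.
Qed.

Let ev_u : ev u om = 1.
Proof.
have om1' : normc om <= 1 by rewrite om1.
have sh := entire_summable (@entire_hseries R b).
have [M hM] := sh.
have s1 : summableC (1 : fps R) by exists 1; exact: l1_le1.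
have shN : summableC (- hseries b) by exists M; exact: l1_leN.
rewrite /useries (evD om1' s1 shN) (evN om1' sh) ev1 ev_hseries//.
have -> : rho%:C * om = w by rewrite /om mulrC divfK.
by rewrite w_sol subr0.
Qed.

Lemma ev_resolvent_coef s : 0 < s < 1 -> ev (resolvent_coef s%:C) om = (1 - s%:C)^-1.
Proof.
move=> hs; have [C hC] := resolvent_coef_bound.
have om1' : normc om <= 1 by rewrite om1.
have sr : summableC (resolvent_coef s%:C) by eexists; exact: hC.
have s1 : summableC (1 : fps R) by exists 1; exact: l1_le1.
have eu : entire u by apply: entireD; [exact: entire1 | apply: entireN; exact: entire_hseries].
have su := entire_summable eu.
have sC : summableC (fpsC s%:C : fps R) by exists (normc s%:C); exact: l1_leC.
have [M hM] := summableCM sC su.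
have sN : summableC (- (fpsC s%:C * u)) by exists M; exact: l1_leN.
have h := evM om1' (summableCD s1 sN) sr.
rewrite resolvent_coefP ev1 (evD om1' s1 sN) (evN om1' (summableCM sC su)) ev1 evCM// in h.
rewrite ev_u mulr1 in h.
have s0 : 1 - s%:C != 0 :> R[i].
  apply/eqP => e; move/eqP: h; rewrite e mul0r; exact/negP/oner_neq0.
by apply: (mulfI s0); rewrite -h divff.
Qed.

Lemma termE n : poly_bernoulli_ge2 m n * w ^+ n / n`!%:R =
  om ^+ n * \sum_(k < n.+1) (u ^+ k) n / cpow k.+1%:R m.
Proof.
rewrite /poly_bernoulli_ge2 mulr_suml mulr_suml mulr_sumr; apply: eq_bigr => -[k kn] _ /=.
have wE : w ^+ n = om ^+ n * rho%:C ^+ n by rewrite -exprMn /om divfK.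
rewrite wE useries_exp_coef.
have -> : (-1 : R[i]) ^+ (n + k) = (-1) ^+ (n - k).
  have -> : (n + k = (n - k) + k.*2)%N by lia.
  by rewrite exprD -mul2n exprM sqrrN !expr1n mulr1.
ring.
Qed.

Lemma bernoulli_series_cvg :
  series (fun n : nat => poly_bernoulli_ge2 m n * w ^+ n / n`!%:R : R[i]^o)
    @ \oo --> (Cint (fun t => gamma_ker m t / (1 - (expR (- t))%:C)) / Cint (gamma_ker m) : R[i]^o).
Proof.
(* The coefficient of [s^k] in the N-th partial sum of the resolvent series at [om]; its degree in
   [s] is below [N] since [u ^+ k] starts at degree [k]. *)
pose c N k : R[i] := \sum_(n < N) om ^+ n * (u ^+ k) n.
have E N (z : nat -> R[i]) : \sum_(k < N) c N k * z k =
    \sum_(n < N) om ^+ n * \sum_(k < n.+1) z k * (u ^+ k) n.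
  rewrite /c; under eq_bigr do rewrite mulr_suml.
  rewrite exchange_big /=; apply: eq_bigr => -[n nN] _ /=.
  have -> : \sum_(k < n.+1) z k * (u ^+ k) n = \sum_(k < N) z k * (u ^+ k) n.
    apply/eqP; rewrite eq_sym -subr_eq0 (sumrB_ord (fun k => z k * (u ^+ k) n) nN).
    by rewrite big_nat_cond big1// => k /andP[/andP[h _] _]; rewrite useries_exp_small ?mulr0.
  by rewrite mulr_sumr; apply: eq_bigr => k _; rewrite [z k * _]mulrC mulrA.
have [C hC] := resolvent_coef_bound.
have om1' : normc om <= 1 by rewrite om1.
have Es N (s : R) : \sum_(k < N) c N k * s%:C ^+ k =
    \sum_(n < N) resolvent_coef s%:C n * om ^+ n.
  by rewrite (E N (fun k => s%:C ^+ k)); apply: eq_bigr => n _; rewrite mulrC.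
have h := @moment_limit R m hm id c C.
have -> : series (fun n : nat => poly_bernoulli_ge2 m n * w ^+ n / n`!%:R : R[i]^o) =
    (fun N => \sum_(k < id N) c N k / cpow k.+1%:R m).
  apply/funext => N; rewrite /series /= big_mkord (E N (fun k => (cpow k.+1%:R m)^-1)).
  by apply: eq_bigr => n _; rewrite termE; congr (_ * _); apply: eq_bigr => k _; rewrite mulrC.
apply: h.
- move=> s hs; rewrite -(ev_resolvent_coef hs).
  have sr : summableC (resolvent_coef s%:C) by eexists; exact: hC.
  have := evP om1' sr; apply: cvg_trans; apply: near_eq_cvg; apply: nearW => N.
  by rewrite /series /= big_mkord Es.
- move=> N s hs; rewrite /= Es; apply: le_trans (normc_sum _ _ _) _.
  exact: (l1_le_pow om1' (hC s hs)).
Qed.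

Lemma zeta_cvg : series (fun n : nat => (cpow n.+1%:R m)^-1 : R[i]^o)
    @ \oo --> (Cint (fun t => gamma_ker m t / (1 - (expR (- t))%:C)) / Cint (gamma_ker m) : R[i]^o).
Proof.
have -> : series (fun n : nat => (cpow n.+1%:R m)^-1 : R[i]^o) =
    (fun N => \sum_(k < id N) (fun _ _ => 1) N k / cpow k.+1%:R m).
  by apply/funext => N; rewrite /series /= big_mkord; apply: eq_bigr => k _; rewrite mul1r.
apply: (@moment_limit R m hm id (fun _ _ => 1) 2).
- move=> s /andP[s0 s1].
  have s1' : `|s| < 1 by rewrite gtr0_norm.
  have -> : (1 - s%:C)^-1 = (1 - s)^-1 +i* 0 :> R[i].
    by rewrite -[RHS]/((1 - s)^-1)%:C fmorphV rmorphB rmorph1.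
  have E N : \sum_(k < id N) 1 * s%:C ^+ k = (series (geometric 1 s) N)%:C :> R[i].
    rewrite /series /= big_mkord rmorph_sum /=; apply: eq_bigr => k _.
    by rewrite /geometric /= !mul1r rmorphXn.
  apply: cvgC_ReIm; under eq_fun do rewrite E /=; last exact: cvg_cst.
  by have := cvg_geometric_series (a := 1) s1'; rewrite mul1r.
- move=> N s /andP[s0 s1] /=; apply: le_trans (normc_sum _ _ _) _.
  have h : l1_le (fun k => 1 * s%:C ^+ k) (1 / (1 - s)).
    apply: l1_le_geometric; first by rewrite ltW.
    by move=> k; rewrite mul1r mul1r normcX normcR gtr0_norm.
  by apply: le_trans (h N) _; rewrite ler_pM2r ?invr_gt0; lra.
Qed.

End FinalSum.

Theorem theorem4 (R : realType) (mu : R[i]) (k : int)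
    (hmu : 1 < complex.Re mu) (hk : k = 0 \/ k = -1) :
  series (fun n : nat =>
      poly_bernoulli_ge2 mu n * lambertW k (-1) ^+ n / n`!%:R : R[i]^o)
    @ \oo --> zeta mu.
Proof.
have [b hb] := is_lambert_pt_ex R.
(* [zeta] is a limit by definition, so uniqueness of limits identifies it with the common value. *)
have -> : zeta mu = Cint (fun t => gamma_ker mu t / (1 - (expR (- t))%:C)) / Cint (gamma_ker mu).
  exact: csum_unique (zeta_cvg hmu).
case: hk => ->.
  rewrite (lambertW0_N1 hb); apply: (bernoulli_series_cvg hb hmu) => //.
  exact: lambert_sol.
rewrite (lambertWN1_N1 hb); apply: (bernoulli_series_cvg hb hmu).
  by rewrite /lambert_rho /= sqrrN.
by apply/mul_cexp_eqN1; exact: lambert_pt_sol_conj.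
Qed.
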